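(* Let $A$ be the operator on the Hilbert space $H$ defined in the context. The eigenfunctions of the problem (BVP) of the context, augmented to become eigenfunctions of $A$, are complete in $H$; i.e., if $$\left\{\Phi_n=\begin{pmatrix}\phi_n(x)\\ R_1'(\phi_n)\end{pmatrix};\ n\in\mathbb N\right\}$$ is a maximal set of orthonormal eigenfunctions of $A$, where $\{\phi_n(x);\ n\in\mathbb N\}$ are eigenfunctions of (BVP), then for all $F\in H$, $F=\sum_{n=1}^\infty\langle F,\Phi_n\rangle\Phi_n$.
   Context: Let $m\ge1$, $-1<h_1<\dots<h_m<1$, $h_0:=-1$, $h_{m+1}:=1$, $\Omega_i:=[h_{i-1},h_i]$. Let $q$ be real-valued and continuous on $[-1,h_1)\cup(h_1,h_2)\cup\dots\cup(h_m,1]$ with finite one-sided limits $q(h_i\pm0)$. Let $\delta_i\ne0$ ($1\le i\le m$), $\alpha_j,\beta_j,\beta_j'$ ($j=1,2$) be real numbers with $|\alpha_1|+|\alpha_2|\ne0$ and $\rho:=\beta_1'\beta_2-\beta_1\beta_2'>0$. Put $\tau u:=-u''+qu$, $R_1(u):=\beta_1u(1)-\beta_2u'(1)$, $R_1'(u):=\beta_1'u(1)-\beta_2'u'(1)$. Problem (BVP), with $\lambda\in\mathbb C$: $\tau u=\lambda u$ on $[-1,h_1)\cup(h_1,h_2)\cup\dots\cup(h_m,1]$; $\alpha_1u(-1)+\alpha_2u'(-1)=0$; $(\beta_1'\lambda+\beta_1)u(1)-(\beta_2'\lambda+\beta_2)u'(1)=0$; and for $i=1,\dots,m$: $u(h_i-0)=\delta_iu(h_i+0)$,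 $u'(h_i-0)=\delta_iu'(h_i+0)$. Eigenfunctions of (BVP) are its nontrivial solutions. Here the restriction of $u$ to each interval, together with its derivative, extends to be absolutely continuous on the closed interval. $H=L_2(-1,1)\oplus\mathbb C$ with inner product, for $F=(f,f_1)^T$, $G=(g,g_1)^T$, $$\langle F,G\rangle=\sum_{i=1}^{m+1}\left(\prod_{j=1}^{i-1}\delta_j^2\right)\int_{h_{i-1}}^{h_i}f\overline g\,dx+\frac{\prod_{i=1}^m\delta_i^2}{\rho}f_1\overline{g_1}.$$ $D(A)$ is the set of $F=(f,f_1)^T\in H$ such that on each $\Omega_i$ the restriction of $f$ (extended by one-sided limits) and its derivative are absolutely continuous, $\tau f\in L_2(-1,1)$, $\alpha_1f(-1)+\alpha_2f'(-1)=0$, $f(h_i-0)=\delta_if(h_i+0)$ and $f'(h_i-0)=\delta_if'(h_i+0)$ for $i=1,\dots,m$, and $f_1=R_1'(f)$. For such $F$, $AF:=(\tau f,\,-R_1(f))^T$. *)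

(* Defs.v *)
From HB Require Import structures.
From mathcomp Require Import all_boot all_order all_algebra.
From mathcomp Require Import all_classical all_reals all_analysis.
From mathcomp.real_closed Require Import complex.

Set Implicit Arguments.
Unset Strict Implicit.
Unset Printing Implicit Defensive.

Import Order.TTheory GRing.Theory Num.Theory.
Import numFieldNormedType.Exports.

Local Open Scope classical_set_scope.
Local Open Scope complex_scope.
Local Open Scope ring_scope.

(* MathComp-Analysis puts no topology or integral on [R[i]]: limits,
   derivatives and integrals of functions [R -> R[i]] are taken on the real and
   imaginary parts. *)
Section ComplexValued.
Context {R : realType}.
Implicit Types (f g : R -> R[i]) (a b x : R) (D : set R).

Definition cderive f x : R[i] :=
  derive1 (fun t => complex.Re (f t)) x +i*
  derive1 (fun t => complex.Im (f t)) x.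

Definition cderivable f x : Prop :=
  derivable (fun t => complex.Re (f t)) x 1 /\
  derivable (fun t => complex.Im (f t)) x 1.

Definition llim f a : R[i] :=
  lim (complex.Re (f t) @[t --> a^'-]) +i* lim (complex.Im (f t) @[t --> a^'-]).

Definition rlim f a : R[i] :=
  lim (complex.Re (f t) @[t --> a^'+]) +i* lim (complex.Im (f t) @[t --> a^'+]).

Definition cintegral D f : R[i] :=
  (\int[lebesgue_measure]_(x in D) complex.Re (f x)) +i*
  (\int[lebesgue_measure]_(x in D) complex.Im (f x)).

Definition cmeasurable D f : Prop :=
  measurable_fun D (fun x => complex.Re (f x)) /\
  measurable_fun D (fun x => complex.Im (f x)).

Definition L2 D f : Prop :=
  cmeasurable D f /\
  (\int[lebesgue_measure]_(x in D) ((ComplexField.Normc.normc (f x)) ^+ 2)%:E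
     < +oo)%E.

Definition absolutely_continuous a b g : Prop :=
  forall e : R, 0 < e -> exists2 d : R, 0 < d &
    forall (n : nat) (s t : 'I_n -> R),
      (forall k, [/\ a <= s k, s k <= t k & t k <= b]) ->
      trivIset setT (fun k => `]s k, t k[%classic) ->
      \sum_(k < n) (t k - s k) < d ->
      \sum_(k < n) ComplexField.Normc.normc (g (t k) - g (s k)) < e.

Definition extends_AC a b f : Prop :=
  exists2 g, {in `]a, b[, f =1 g} & absolutely_continuous a b g.

End ComplexValued.

(* [npts] is the number of interior points; only the values [mesh i] with
   [i <= npts.+1] and [delta i] with [1 <= i <= npts] matter.
   [betap1], [betap2] are the primed coefficients. *)
Record bvp (R : realType) := BVP {
  npts : nat;
  mesh : nat -> R;
  potential : R -> R;
  delta : nat -> R;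
  alpha1 : R; alpha2 : R;
  beta1 : R; beta2 : R;
  betap1 : R; betap2 : R;
  rho : R := betap1 * beta2 - beta1 * betap2;
  mesh_dom : set R :=
    [set x | x \in `[-1, 1] /\ forall i, (1 <= i <= npts)%N -> x != mesh i];
  npts_gt0 : (1 <= npts)%N;
  mesh0 : mesh 0 = -1;
  mesh_last : mesh npts.+1 = 1;
  mesh_lt : forall i, (i <= npts)%N -> mesh i < mesh i.+1;
  potential_continuous : {within mesh_dom, continuous potential};
  potential_llim : forall i, (1 <= i <= npts)%N ->
    cvg (potential x @[x --> (mesh i)^'-]);
  potential_rlim : forall i, (1 <= i <= npts)%N ->
    cvg (potential x @[x --> (mesh i)^'+]);
  delta_neq0 : forall i, (1 <= i <= npts)%N -> delta i != 0;
  alpha_neq0 : `|alpha1| + `|alpha2| != 0;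
  rho_gt0 : 0 < rho
}.

Section TransmissionProblem.
Context {R : realType} (P : bvp R).
Implicit Types (f u : R -> R[i]) (l : R[i]).

Definition tau f (x : R) : R[i] :=
  - cderive (cderive f) x + (potential P x)%:C * f x.

(* The value of a piecewise regular function (or of its derivative) at an end
   point is the one-sided limit there. *)
Definition R1 u : R[i] :=
  (beta1 P)%:C * llim u 1 - (beta2 P)%:C * llim (cderive u) 1.

Definition R1p u : R[i] :=
  (betap1 P)%:C * llim u 1 - (betap2 P)%:C * llim (cderive u) 1.

Definition piecewise_AC1 f : Prop :=
  forall i, (i <= npts P)%N ->
    [/\ extends_AC (mesh P i) (mesh P i.+1) f,
        forall x, x \in `]mesh P i, mesh P i.+1[ -> cderivable f x
      & extends_AC (mesh P i) (mesh P i.+1) (cderive f)].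

Definition left_bc f : Prop :=
  (alpha1 P)%:C * rlim f (-1) + (alpha2 P)%:C * rlim (cderive f) (-1) = 0.

Definition transmission f : Prop :=
  forall i, (1 <= i <= npts P)%N ->
    llim f (mesh P i) = (delta P i)%:C * rlim f (mesh P i) /\
    llim (cderive f) (mesh P i) =
      (delta P i)%:C * rlim (cderive f) (mesh P i).

(* At -1 and 1 the equation [tau u = l u] is the limit of the one inside, since
   [u] and the potential are continuous there. *)
Definition bvp_solution l u : Prop :=
  [/\ piecewise_AC1 u,
      forall i x, (i <= npts P)%N -> x \in `]mesh P i, mesh P i.+1[ ->
        cderivable (cderive u) x /\ tau u x = l * u x,
      left_bc u,
      ((betap1 P)%:C * l + (beta1 P)%:C) * llim u 1
        - ((betap2 P)%:C * l + (beta2 P)%:C) * llim (cderive u) 1 = 0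
    & transmission u].

Definition bvp_eigenfunction u : Prop :=
  (exists l, bvp_solution l u) /\
  exists i x,
    [/\ (i <= npts P)%N, x \in `]mesh P i, mesh P i.+1[ & u x != 0].

(* Elements of H are represented by functions, and equality in H is [Heq]. *)
Definition Hspace : lmodType R[i] := ((R -> R[i]) * R[i])%type.
Implicit Types F G : Hspace.

Definition inH F : Prop := L2 `]-1, 1[ F.1.

Definition Heq F G : Prop :=
  {ae lebesgue_measure, forall x : R, x \in `]-1, 1[ -> F.1 x = G.1 x} /\
  F.2 = G.2.

Definition ip F G : R[i] :=
  \sum_(1 <= i < (npts P).+2)
     (\prod_(1 <= j < i) delta P j ^+ 2)%:C *
     cintegral `[mesh P i.-1, mesh P i] (fun x => F.1 x * conjc (G.1 x))
  + ((\prod_(1 <= i < (npts P).+1) delta P i ^+ 2) / rho P)%:C *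
    (F.2 * conjc G.2).

Definition Hnorm F : R := Num.sqrt (complex.Re (ip F F)).

Definition domA : set Hspace :=
  [set F | [/\ inH F /\ piecewise_AC1 F.1, L2 `]-1, 1[ (tau F.1),
               left_bc F.1, transmission F.1 & F.2 = R1p F.1]].

Definition opA F : Hspace := (tau F.1, - R1 F.1).

Definition A_eigenfunction : set Hspace :=
  [set F | [/\ domA F, ~ Heq F 0 & exists l, Heq (opA F) (l *: F)]].

Definition orthonormal_set (S : set Hspace) : Prop :=
  forall F G, S F -> S G -> ip F F = 1 /\ (~ Heq F G -> ip F G = 0).

(* The family is injective, so that the sum over [nat] counts each member of
   the set [range Phi] once. *)
Definition maximal_orthonormal_eigenfunctions (Phi : nat -> Hspace) : Prop :=
  [/\ forall n, A_eigenfunction (Phi n),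
      forall k n, ip (Phi k) (Phi n) = (k == n)%:R
    & forall S, S `<=` A_eigenfunction -> orthonormal_set S ->
        range Phi `<=` S -> forall G, S G -> exists n, Heq G (Phi n)].

Definition augment u : Hspace := (u, R1p u).

End TransmissionProblem.

(* Main.v *)
Require Import Defs.
From HB Require Import structures.
From mathcomp Require Import all_boot all_order all_algebra.
From mathcomp Require Import all_classical all_reals all_analysis.
From mathcomp Require Import measurable_realfun zify ring lra.
From mathcomp.real_closed Require Import complex.

(** Multiplying the restriction of [u] to the [i]-th interval by
    [delta_1 ... delta_(i-1)] removes the transmission conditions and turns the
    inner product of [H] into that of [L2(-1,1) + C] with weight [1/rho].  The
    transformed operator is real, so it acts separately on real and imaginary
    parts.  Green's formula makes it symmetric, and its resolvent at a suitable
    real point is obtained by shooting from [-1], the initial value problem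
    being a Volterra equation.  This resolvent is symmetric and injective, and
    compact because it maps bounded sets to bounded sets of uniformly Lipschitz
    functions.

    Let [M] be the orthogonal complement of the given eigenvectors; the
    resolvent [K] preserves it.  If [K] were nonzero on [M], a sequence
    maximizing [|K u|] on its unit ball would produce an eigenvector of [K] in
    [M], hence an eigenfunction of the problem orthogonal to all the given ones,
    against maximality.  So [K] vanishes on [M], and [M] is null by injectivity.
    Partial sums of the expansion of [F] converge by Bessel and Riesz-Fischer,
    and [F] minus the limit lies in [M]. *)

Set Implicit Arguments.
Unset Strict Implicit.
Unset Printing Implicit Defensive.

Import Order.TTheory GRing.Theory Num.Theory.
Import numFieldNormedType.Exports.

Local Open Scope classical_set_scope.
Local Open Scope ring_scope.

(** * Eigenvector expansions for compact symmetric operators *)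

(** Vectors are functions rather than classes, so the forms are only semidefinite: eigenvectors,
    injectivity and limits are understood up to null vectors, and identities between vectors are
    often stated by testing them against all others. The differential equation is kept in integrated
    form. For a square integrable right side the second derivative exists only almost everywhere,
    whereas the two first order integral equations hold at every point and can be compared and
    iterated. Classical derivatives come back only for eigenfunctions, where the potential is
    continuous inside each piece and the integrals can be differentiated. Working over the reals has
    a price on the complex side: a complex coefficient is two real ones, so [Phi n] and [i Phi n]
    both enter the real orthonormal family, and a complex eigenvalue of (BVP) must first be shown to
    be replaceable by a real one. *)

Section SemiInner.
Context {R : realType} {V : lmodType R} (D : V -> Prop) (B : V -> V -> R).
Hypothesis D0 : D 0.
Hypothesis DZD : forall a u v, D u -> D v -> D (a *: u + v).
Hypothesis Bsym : forall u v, B u v = B v u.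
Hypothesis BZD : forall a u v w, D u -> D v -> D w ->
  B (a *: u + v) w = a * B u w + B v w.
Hypothesis Bge0 : forall u, D u -> 0 <= B u u.
Implicit Types u v w : V.

Lemma siD u v : D u -> D v -> D (u + v).
Proof. by move=> Du Dv; rewrite -[u]scale1r; exact: DZD. Qed.
Lemma siZ a u : D u -> D (a *: u).
Proof. by move=> Du; rewrite -[_ *: _]addr0; exact: DZD. Qed.
Lemma siB u v : D u -> D v -> D (u - v).
Proof. by move=> Du Dv; rewrite addrC -scaleN1r; exact: DZD. Qed.
Lemma si_sum (I : Type) (r : seq I) (P : pred I) (F : I -> V) :
  (forall i, D (F i)) -> D (\sum_(i <- r | P i) F i).
Proof. by move=> DF; apply: big_ind => //; exact: siD. Qed.

Lemma form0l w : D w -> B 0 w = 0.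
Proof. by move=> Dw; have := BZD (-1) D0 D0 Dw; rewrite scaler0 addr0; lra. Qed.
Lemma formDl u v w : D u -> D v -> D w -> B (u + v) w = B u w + B v w.
Proof. by move=> Du Dv Dw; rewrite -[u in LHS]scale1r BZD// mul1r. Qed.
Lemma formZl a u w : D u -> D w -> B (a *: u) w = a * B u w.
Proof. by move=> Du Dw; rewrite -[_ *: _]addr0 BZD// form0l// addr0. Qed.
Lemma formBl u v w : D u -> D v -> D w -> B (u - v) w = B u w - B v w.
Proof. by move=> Du Dv Dw; rewrite addrC -scaleN1r BZD//; ring. Qed.
Lemma formDr u v w : D u -> D v -> D w -> B w (u + v) = B w u + B w v.
Proof. by move=> ? ? ?; rewrite Bsym formDl// !(Bsym w). Qed.
Lemma formZr a u w : D u -> D w -> B w (a *: u) = a * B w u.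
Proof. by move=> ? ?; rewrite Bsym formZl// (Bsym w). Qed.
Lemma formBr u v w : D u -> D v -> D w -> B w (u - v) = B w u - B w v.
Proof. by move=> ? ? ?; rewrite Bsym formBl// !(Bsym w). Qed.
Lemma form_suml (I : Type) (r : seq I) (F : I -> V) w :
  (forall i, D (F i)) -> D w ->
  B (\sum_(i <- r) F i) w = \sum_(i <- r) B (F i) w.
Proof.
move=> DF Dw; elim: r => [|i r IH]; first by rewrite !big_nil form0l.
by rewrite !big_cons formDl// ?IH//; exact: si_sum.
Qed.

Lemma form_sqrB u v : D u -> D v -> B (u - v) (u - v) = B u u - 2 * B u v + B v v.
Proof.
by move=> Du Dv; rewrite formBl ?formBr ?(Bsym v u)//; [ring|exact: siB].
Qed.

Lemma Cauchy_Schwarz_sqr u v : D u -> D v -> B u v ^+ 2 <= B u u * B v v.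
Proof.
move=> Du Dv.
have key t : 0 <= B u u - 2 * t * B u v + t ^+ 2 * B v v.
  have := Bge0 (siB Du (siZ t Dv)).
  rewrite form_sqrB ?formZr ?formZl//; try exact: siZ.
  by move/le_trans; apply; rewrite le_eqVlt; apply/orP; left; apply/eqP; ring.
(* For a null [v] the nonnegative quadratic [key] is affine in [t]; if [B u v] were nonzero, the
   chosen [t] would give it the value -1. *)
have [v0|vn0] := eqVneq (B v v) 0.
  have [->|uv0] := eqVneq (B u v) 0; first by rewrite v0 expr0n/= mulr0.
  have := key ((B u u + 1) / (2 * B u v)); rewrite v0 mulr0 addr0.
  rewrite (_ : 2 * _ * _ = B u u + 1); last by field.
  by lra.
have vp : 0 < B v v by rewrite lt_neqAle eq_sym vn0 Bge0.
(* This [t] minimizes the quadratic. *)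
have := key (B u v / B v v).
rewrite (_ : _ + _ = (B u u * B v v - B u v ^+ 2) / B v v); last by field.
by rewrite pmulr_lge0 ?invr_gt0// subr_ge0.
Qed.

Definition seminorm u : R := Num.sqrt (B u u).
Local Notation N := seminorm.

Lemma seminorm_ge0 u : 0 <= N u. Proof. exact: sqrtr_ge0. Qed.
Lemma seminorm_sqr u : D u -> N u ^+ 2 = B u u.
Proof. by move=> Du; rewrite sqr_sqrtr// Bge0. Qed.
Lemma seminorm_eq0 u : D u -> (N u == 0) = (B u u == 0).
Proof. by move=> Du; rewrite sqrtr_eq0 eq_le Bge0// andbT. Qed.
Lemma Cauchy_Schwarz u v : D u -> D v -> `|B u v| <= N u * N v.
Proof.
move=> Du Dv; rewrite -ler_sqr ?nnegrE ?mulr_ge0 ?seminorm_ge0//.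
by rewrite real_normK ?num_real// exprMn !seminorm_sqr//; exact: Cauchy_Schwarz_sqr.
Qed.
Lemma seminormD u v : D u -> D v -> N (u + v) <= N u + N v.
Proof.
move=> Du Dv; rewrite -ler_sqr ?nnegrE ?addr_ge0 ?seminorm_ge0//.
rewrite seminorm_sqr; last exact: siD.
rewrite formDl ?formDr ?(Bsym v u)//; last exact: siD.
rewrite sqrrD !seminorm_sqr// mulr2n.
have := Cauchy_Schwarz Du Dv; have := ler_norm (B u v); lra.
Qed.
Lemma seminormZ a u : D u -> N (a *: u) = `|a| * N u.
Proof.
move=> Du; rewrite /N formZl ?formZr//; last exact: siZ.
by rewrite mulrA -expr2 sqrtrM ?sqr_ge0// sqrtr_sqr.
Qed.
Lemma seminormBC u v : D u -> D v -> N (u - v) = N (v - u).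
Proof.
move=> Du Dv; rewrite -[LHS]mul1r -normr1 -normrN -seminormZ; last exact: siB.
by rewrite scaleN1r opprB.
Qed.
Lemma seminormB_tri u v w : D u -> D v -> D w -> N (u - w) <= N (u - v) + N (v - w).
Proof.
move=> Du Dv Dw; rewrite (_ : u - w = (u - v) + (v - w)); last by rewrite subrKA.
by apply: seminormD; exact: siB.
Qed.

(** Continuity from Cauchy-Schwarz, for an arbitrary filter because it serves both for ultrafilter
    limits and for ordinary sequences. The bound uses [N w + 1] since [N w] may vanish. *)
Lemma form_cvg (T : Type) (U : set_system T) {FU : Filter U} (g : T -> V) y w :
  (forall t, D (g t)) -> D y -> D w -> N (g t - y) @[t --> U] --> 0 ->
  B (g t) w @[t --> U] --> B y w.
Proof.
move=> Dg Dy Dw gy; apply/cvgrPdist_le => e e0.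
have Nw1 : 0 < N w + 1 by rewrite ltr_wpDl ?seminorm_ge0.
move/cvgrPdist_le : gy => /(_ (e / (N w + 1))).
rewrite divr_gt0// => /(_ isT); apply: filterS => t.
rewrite sub0r normrN ger0_norm ?seminorm_ge0// ler_pdivlMr// => He.
rewrite distrC -formBl//; apply: le_trans (Cauchy_Schwarz _ _) _ => //.
  exact: siB.
apply: le_trans He; apply: ler_wpM2l; first exact: seminorm_ge0.
by rewrite lerDl.
Qed.

(** * Compact symmetric operators: maximizing sequences and the expansion theorem *)

Section SpectralTheorem.
Variable K : V -> V.
Hypothesis KD : forall u, D u -> D (K u).
Hypothesis Ksym : forall u v, D u -> D v -> B (K u) v = B u (K v).
Hypothesis Kbnd : exists2 C : R, 0 <= C & forall u, D u -> N (K u) <= C * N u.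
(** Compactness in terms of ultrafilters, which replaces the extraction of subsequences. *)
Hypothesis Kcpt : forall g : nat -> V, (forall n, D (g n) /\ N (g n) <= 1) ->
  forall U : set_system nat, UltraFilter U ->
  exists2 y, D y & N (K (g n) - y) @[n --> U] --> 0.
Variable a : nat -> V.
Hypothesis Da : forall n, D (a n).
(** The weak form of [a n] being an eigenvector; it is what makes the orthogonal complement stable
    under [K]. *)
Hypothesis Ka : forall n, exists k : R, forall u, D u -> B (K u) (a n) = k * B u (a n).
(** The abstract form of maximality: [K y = k y] up to a null vector, with [y] orthogonal to the
    family, forces [y] to be null. *)
Hypothesis no_eigen : forall (y : V) (k : R), D y -> k != 0 -> (forall n, B y (a n) = 0) ->
  B (K y - k *: y) (K y - k *: y) = 0 -> B y y = 0.

Let M u := D u /\ forall n, B u (a n) = 0.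

Let MZ c u : M u -> M (c *: u).
Proof.
move=> [Du Mu]; split; first exact: siZ.
by move=> n; rewrite formZl// Mu mulr0.
Qed.
Let MK u : M u -> M (K u).
Proof.
move=> [Du Mu]; split; first exact: KD.
by move=> n; have [k ->//] := Ka n; rewrite Mu mulr0.
Qed.

(* A nonzero y of M with K (K y) = k^2 y has K y = - k y, or else K y + k y is an eigenvector for k. *)
Let square_eigen y (k : R) : M y -> 0 < k ->
  (forall w, D w -> B (K (K y)) w = k ^+ 2 * B y w) -> B y y = 0.
Proof.
move=> My k0 Kky; have Dy := My.1.
have DKy := KD Dy.
have [Nz|Nz] := eqVneq (N (K y + k *: y)) 0.
  apply: (@no_eigen y (- k)) => //; first by rewrite oppr_eq0 gt_eqF.
    exact: My.2.
  rewrite scaleNr opprK; apply/eqP; rewrite -seminorm_eq0 ?Nz//.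
  by apply: siD => //; exact: siZ.
have Dz : D (K y + k *: y) by apply: siD => //; exact: siZ.
suff z0 : B (K y + k *: y) (K y + k *: y) = 0 by move: Nz; rewrite seminorm_eq0// z0 eqxx.
apply: (@no_eigen _ k) => //; first by rewrite gt_eqF.
  move=> n; rewrite formDl//; last exact: siZ.
  by rewrite (MK My).2 formZl// My.2 mulr0 addr0.
set z := K y + k *: y.
have DKz := KD Dz.
have Dzk := siZ k Dz.
suff H w : D w -> B (K z - k *: z) w = 0 by apply: H; exact: siB.
move=> Dw; have DKw := KD Dw.
rewrite formBl// Ksym// formZl// /z !formDl//; try exact: siZ.
rewrite !formZl// -[B (K y) (K w)]Ksym// Kky// -[B y (K w)]Ksym//; ring.
Qed.

(** [K] is not assumed linear. Symmetry moves [K] to the other argument, which frees one factor [c]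
    at a time. *)
Let KZ c h : D h -> N (K (c *: h)) = `|c| * N (K h).
Proof.
move=> Dh; have Dch := siZ c Dh.
have [DK DKc] := (KD Dh, KD Dch).
rewrite /N Ksym ?formZl//; try exact: KD.
rewrite -Ksym// Bsym Ksym ?formZl//; try exact: KD.
by rewrite -Ksym// mulrA -expr2 sqrtrM ?sqr_ge0// sqrtr_sqr.
Qed.

(* A sequence [u] in the unit ball of [M] with [N (K (u n))] tending to the
   supremum [k] satisfies [K (K (u n)) - k^2 u n -> 0]; an ultrafilter limit [y] of [K (u n)]
   then has [K (K y) = k^2 y]. *)
Lemma orthogonal_null g : M g -> B (K g) (K g) = 0.
Proof.
move=> Mg; have Dg := Mg.1.
apply/eqP; apply: contrapT => /negP Kg0.
have [C C0 KC] := Kbnd.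
pose S := [set N (K h) | h in [set h | M h /\ N h <= 1]].
have inS h : M h -> N h <= 1 -> S (N (K h)) by move=> ? ?; exists h.
have ubS : has_ubound S.
  exists C => _ [h [[Dh Mh] h1] <-]; apply: le_trans (KC _ Dh) _.
  by rewrite ler_piMr.
pose k := sup S.
have NKg0 : 0 < N (K g).
  by rewrite lt_neqAle seminorm_ge0 andbT eq_sym seminorm_eq0//; exact: KD.
have Sk h : M h -> N (K h) <= k * N h.
  move=> Mh; have Dh := Mh.1; have [h0|hn0] := eqVneq (N h) 0.
    by rewrite h0 mulr0; apply: le_trans (KC _ Dh) _; rewrite h0 mulr0.
  have hp : 0 < N h by rewrite lt_neqAle eq_sym hn0 seminorm_ge0.
  rewrite -ler_pdivrMr// mulrC -[(N h)^-1]ger0_norm ?invr_ge0 ?seminorm_ge0// -KZ//.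
  apply: ub_le_sup => //; apply: (inS _ (MZ _ Mh)).
  by rewrite seminormZ// ger0_norm ?invr_ge0 ?seminorm_ge0// mulVf.
have k0 : 0 < k.
  have := lt_le_trans NKg0 (Sk _ Mg); rewrite pmulr_lgt0// lt_neqAle seminorm_ge0 andbT eq_sym.
  apply/eqP => g0; have := Sk _ Mg; rewrite g0 mulr0 leNgt.
  by move=> /negP; apply.
have supS : has_sup S.
  split => //; exists (N (K 0)); apply: inS; last by rewrite /N form0l ?sqrtr0.
  by split=> // n; rewrite form0l.
have /choice[u Hu] n : exists h, [/\ M h, N h <= 1 & k - n.+1%:R^-1 < N (K h)].
  have [|_ [h [Mh h1] <-] kh] := @sup_adherent _ S n.+1%:R^-1 _ supS; first by rewrite invr_gt0.
  by exists h.
have Mu n : M (u n) by case: (Hu n).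
have Du n : D (u n) by case: (Mu n).
have u1 n : N (u n) <= 1 by case: (Hu n).
have DKu n := KD (Du n).
have Kuk n : N (K (u n)) <= k by apply: ub_le_sup => //; apply: inS (u1 n).
have ucvg : N (K (u n)) @[n --> \oo] --> k.
  apply: (@squeeze_cvgr _ _ _ _ (fun n => k - n.+1%:R^-1) (fun=> k)).
  - by apply: nearW => n; rewrite Kuk andbT ltW//; case: (Hu n).
  - rewrite -[X in _ --> X]subr0; apply: cvgB; first exact: cvg_cst.
    exact: cvg_harmonic.
  - exact: cvg_cst.
have [U [UU /= subU]] := ultraFilterLemma (@eventually_filter).
have UP : ProperFilter U by exact: ultra_proper.
have ucvgU : N (K (u n)) @[n --> U] --> k by move=> X /ucvg; exact: subU.
have [//|y Dy uy] := Kcpt (g := u) _ UU.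
have My : M y.
  split=> // n; apply: (@cvg_unique _ (@Rhausdorff R) (B (K (u m)) (a n) @[m --> U])).
    exact: form_cvg.
  have -> : (fun m => B (K (u m)) (a n)) = fun=> 0 by apply/funext => m; rewrite (MK (Mu m)).2.
  exact: cvg_cst.
(* The norms [N (K (u n))] tend to [k], so the limit [y] is not null; this is contradicted below. *)
have ky : k <= N y.
  have H : N (K (u n) - y) + N y @[n --> U] --> N y.
    by rewrite -[X in _ --> X]add0r; apply: cvgD => //; exact: cvg_cst.
  apply: (ler_cvg_to ucvgU H).
  apply: nearW => n; rewrite -[X in N X <= _](subrK y).
  by apply: seminormD => //; exact: siB.
suff : B y y = 0.
  by move=> y0; move: ky; rewrite /N y0 sqrtr0 leNgt k0.
apply: (square_eigen My k0) => w Dw.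
have [DKw DKKw] := (KD Dw, KD (KD Dw)).
have DKy := KD Dy.
rewrite !Ksym//.
(* The same quantity has a second limit: moving one [K] to the left turns it into
   [B (K (K (u m))) (K w)], where [K (K (u m))] may be replaced by [k ^+ 2 *: u m] up to the
   remainder [r m]. *)
have HL : B (K (u m)) (K (K w)) @[m --> U] --> B y (K (K w)) by exact: form_cvg.
suff HR : B (K (u m)) (K (K w)) @[m --> U] --> k ^+ 2 * B y w.
  exact: (cvg_unique (@Rhausdorff R) HL HR).
pose r m := K (K (u m)) - k ^+ 2 *: u m.
have DKKu m := KD (DKu m).
have Dr m : D (r m) by apply: siB => //; exact: siZ.
have -> : (fun m => B (K (u m)) (K (K w))) =
    (fun m => B (r m) (K w) + k ^+ 2 * B (K (u m)) w).
  apply/funext => m; rewrite -Ksym// /r formBl ?formZl//; last exact: siZ.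
  by rewrite -[B (u m) (K w)]Ksym//; ring.
rewrite -[X in _ --> X]add0r; apply: cvgD; last first.
  by apply: cvgMr; exact: form_cvg.
(* Expanding the square of [N (r m)] and using [N (K (K (u m))) <= k ^+ 2] and [N (u m) <= 1] gives
   the quantity under the root, which tends to 0 because [N (K (u m))] tends to [k]. *)
pose b m := Num.sqrt (2 * k ^+ 4 - 2 * k ^+ 2 * N (K (u m)) ^+ 2) * N (K w).
have b0 : b m @[m --> U] --> 0.
  rewrite -[X in _ --> X](mul0r (N (K w))); apply: cvgMl.
  rewrite -sqrtr0; apply: (@continuous_cvg _ _ _ _ _ _ (fun x : R => Num.sqrt x)).
    exact: sqrt_continuous.
  rewrite [X in _ --> X](_ : _ = 2 * k ^+ 4 - 2 * k ^+ 2 * k ^+ 2); last by ring.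
  apply: cvgB; first exact: cvg_cst.
  by apply: cvgMr; exact: cvgM.
apply/cvgr0Pnorm_le => e e0; move/cvgr0Pnorm_le : b0 => /(_ _ e0).
apply: filterS => m; apply: le_trans; apply: le_trans (Cauchy_Schwarz (Dr m) DKw) _.
apply: le_trans (ler_norm _); apply: ler_wpM2r; first exact: seminorm_ge0.
rewrite ler_wsqrtr// /r form_sqrB//; last exact: siZ.
have DuZ := siZ (k ^+ 2) (Du m).
rewrite !formZr ?formZl//.
have -> : B (K (K (u m))) (u m) = N (K (u m)) ^+ 2 by rewrite seminorm_sqr// Ksym.
have H1 : B (K (K (u m))) (K (K (u m))) <= k ^+ 4.
  rewrite -seminorm_sqr// (_ : k ^+ 4 = (k ^+ 2) ^+ 2); last by rewrite -exprM.
  rewrite ler_sqr ?nnegrE ?seminorm_ge0 ?sqr_ge0//.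
  apply: le_trans (Sk _ (MK (Mu m))) _; rewrite expr2 ler_wpM2l// ltW//.
have H2 : B (u m) (u m) <= 1.
  by rewrite -seminorm_sqr// expr_le1// seminorm_ge0.
have H3 : k ^+ 2 * (k ^+ 2 * B (u m) (u m)) <= k ^+ 4.
  rewrite mulrA -exprD; rewrite ler_piMr// exprn_ge0// ltW//.
lra.
Qed.

Hypothesis Kinj : forall u, D u -> B (K u) (K u) = 0 -> B u u = 0.
Hypothesis complete_seq : forall g : nat -> V, (forall n, D (g n)) ->
  (forall e : R, 0 < e -> exists m, forall i j, (m <= i)%N -> (m <= j)%N ->
     N (g i - g j) <= e) ->
  exists2 y, D y & N (g n - y) @[n --> \oo] --> 0.
Hypothesis orthonormal_a : forall i j, B (a i) (a j) = (i == j)%:R.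

Theorem eigen_expansion F : D F ->
  N (F - \sum_(n < m) B F (a n) *: a n) @[m --> \oo] --> 0.
Proof.
move=> DF; pose s m := \sum_(n < m) B F (a n) *: a n.
have DcZ n : D (B F (a n) *: a n) by exact: siZ.
have Ds m : D (s m) by apply: si_sum.
have sa m n : B (s m) (a n) = if (n < m)%N then B F (a n) else 0.
  rewrite form_suml//.
  under eq_bigr => i _ do rewrite formZl// orthonormal_a.
  case: ifPn => nm.
    rewrite (bigD1 (Ordinal nm))//= eqxx mulr1 big1 ?addr0// => i ni.
    rewrite (_ : (i == n :> nat) = false) ?mulr0//; apply/negbTE; move: ni.
    by apply: contra => /eqP ni; apply/eqP; apply: val_inj.
  rewrite big1// => i _; rewrite (_ : (i == n :> nat) = false) ?mulr0//.
  by apply/negbTE; apply: contra nm => /eqP <-.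
have sS m : s m.+1 = s m + B F (a m) *: a m by rewrite /s big_ord_recr.
pose c m := \sum_(0 <= n < m) B F (a n) ^+ 2.
(* Pythagoras: a block of the expansion has the square norm by which the sum [c] of squared
   coefficients grows, so convergence of [c] makes [s] a Cauchy sequence. *)
have ss m n : (m <= n)%N -> B (s n - s m) (s n - s m) = c n - c m.
  move=> /subnK <-; elim: (n - m)%N => [|p IH].
    by rewrite add0n !subrr form0l.
  rewrite addSn sS addrAC.
  have DI : D (s (p + m)%N - s m) by exact: siB.
  have DI' := siD DI (DcZ (p + m)%N).
  rewrite formDl//.
  have DI2 : D (s (p + m)%N) by [].
  have DI3 : D (B F (a (p + m)%N) *: a (p + m)%N) by [].
  set x := s (p + m)%N - s m in DI DI' IH *; set b := B F (a (p + m)%N).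
  have xa : B x (a (p + m)%N) = 0.
    by rewrite /x formBl// !sa ltnn ltnNge leq_addl/= subrr.
  rewrite !(formDr DI DI3)// IH (Bsym (b *: _) x) !formZr// formZl// xa orthonormal_a eqxx.
  by rewrite /c big_nat_recr//= -/b; ring.
have sF m : B (F - s m) (F - s m) = B F F - c m.
  elim: m => [|m IH]; first by rewrite /s /c big_ord0 big_nil !subr0.
  have DI : D (F - s m) by exact: siB.
  rewrite sS opprD addrA form_sqrB// formZl ?formZr// IH formBl// sa ltnn orthonormal_a eqxx /c big_nat_recr//=.
  by ring.
have cle m : c m <= B F F by rewrite -subr_ge0 -sF; apply: Bge0; exact: siB.
have cndecr : nondecreasing_seq c.
  by apply/nondecreasing_seqP => n; rewrite /c big_nat_recr//= lerDl sqr_ge0.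
have ccvg : cvgn c by apply: nondecreasing_is_cvgn => //; exists (B F F) => _ [n _ <-].
have [//|e e0|y Dy sy] := @complete_seq s.
  have /cvgrPdist_le/(_ (e ^+ 2 / 2)) := ccvg.
  rewrite divr_gt0 ?exprn_gt0// => /(_ isT) [m _ mP]; exists m => i j mi mj.
  wlog ij : i j mi mj / (j <= i)%N => [H|].
    by case/orP: (leq_total j i) => ij; [|rewrite seminormBC//]; apply: H.
  rewrite /seminorm ss// -(ger0_norm (ltW e0)) -sqrtr_sqr; apply: ler_wsqrtr.
  have := mP i mi; have := mP j mj; rewrite !ler_norml/=; lra.
have DFy : D (F - y) by exact: siB.
(* Once [m] exceeds [n], the coefficient of [s m] along [a n] is that of [F], so the limit [y] has
   the same coefficients as [F]. *)
have MFy : M (F - y).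
  split=> // n; rewrite formBl//; apply/eqP; rewrite subr_eq0; apply/eqP.
  have HL : B (s m) (a n) @[m --> \oo] --> B y (a n) by exact: form_cvg.
  suff HR : B (s m) (a n) @[m --> \oo] --> B F (a n).
    exact: (cvg_unique (@Rhausdorff R) HR HL).
  by apply: cvg_near_cst; exists n.+1 => // m /= nm; rewrite sa nm.
have Fy0 : N (F - y) = 0 by rewrite /N Kinj ?sqrtr0//; exact: orthogonal_null.
apply: (@squeeze_cvgr _ _ _ _ (fun=> 0) (fun m => N (s m - y))) => //; last exact: cvg_cst.
apply: nearW => m; rewrite seminorm_ge0/=.
apply: le_trans (seminormB_tri DF Dy (Ds m)) _.
by rewrite Fy0 add0r seminormBC.
Qed.
End SpectralTheorem.
End SemiInner.

(** * Integrable and square integrable functions on an interval *)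

Section Interval.
Context {R : realType} (a b : R) (ab : a < b).
Local Notation mu := (@lebesgue_measure R).
Local Notation J := `[a, b]%classic.
Implicit Types f g h : R -> R.

Definition L1i f := mu.-integrable J (EFin \o f).
Definition prim f x := \int[mu]_(t in `[a, x]) f t.
Local Notation I := prim.

Lemma measJ : measurable (J : set (measurableTypeR R)). Proof. exact: measurable_itv. Qed.
Hint Resolve measJ : core.
Lemma muJ_fin : (mu J < +oo)%E.
Proof. by rewrite lebesgue_measure_itv/= lte_fin ab -EFinB ltry. Qed.

Lemma L1_measurable f : L1i f -> measurable_fun J f.
Proof. by move/measurable_int/measurable_EFinP. Qed.
Lemma L1_eq f g : (forall x, J x -> f x = g x) -> L1i f -> L1i g.
Proof.
move=> fg; apply: eq_integrable => // x; rewrite inE => xJ /=; by rewrite fg.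
Qed.
Lemma L1D f g : L1i f -> L1i g -> L1i (fun x => f x + g x).
Proof. by move=> f1 g1; have := integrableD measJ f1 g1; exact: eq_integrable. Qed.
Lemma L1Z k f : L1i f -> L1i (fun x => k * f x).
Proof. by move=> f1; have := integrableZl measJ k f1; exact: eq_integrable. Qed.
Lemma L1B f g : L1i f -> L1i g -> L1i (fun x => f x - g x).
Proof. by move=> f1 g1; have := integrableB measJ f1 g1; exact: eq_integrable. Qed.
Lemma L1_abs f : L1i f -> L1i (fun x => `|f x|).
Proof. exact: integrable_norm. Qed.
Lemma L1_bounded f M : measurable_fun J f -> (forall x, J x -> `|f x| <= M) -> L1i f.
Proof.
move=> mf fM; apply: measurable_bounded_integrable => //; first exact: muJ_fin.
exists M; split; first exact: num_real.
by move=> t Mt x Jx; apply: le_trans (fM x Jx) _; exact: ltW.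
Qed.
Lemma L1_cst c : L1i (fun=> c).
Proof. by apply: (@L1_bounded _ `|c|) => //; exact: measurable_cst. Qed.
Lemma L1M f h M : L1i f -> measurable_fun J h -> (forall x, J x -> `|h x| <= M) ->
  L1i (fun x => h x * f x).
Proof.
move=> f1 mh hM; have := @integrableMl _ _ _ mu J measJ (EFin \o f) h f1 mh.
have H : [bounded h x | x in J].
  exists M; split; first exact: num_real.
  by move=> t Mt x Jx; apply: le_trans (hM x Jx) _; exact: ltW.
by move=> /(_ H); apply: L1_eq => x Jx /=; rewrite mulrC.
Qed.
Lemma L1_le f g : measurable_fun J f -> (forall x, J x -> `|f x| <= g x) -> L1i g -> L1i f.
Proof.
move=> mf fg; apply: le_integrable => //; first exact/measurable_EFinP.
by move=> x Jx /=; rewrite lee_fin; apply: le_trans (fg x Jx) _; exact: ler_norm.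
Qed.
Lemma L1S f x : x <= b -> L1i f -> mu.-integrable `[a, x] (EFin \o f).
Proof.
move=> xb; apply: integrableS => //; exact: subset_itvl.
Qed.
Hint Resolve L1S : core.

Lemma subJ x t : x <= b -> `[a, x]%classic t -> J t.
Proof. by move=> xb /=; rewrite !in_itv/= => /andP[-> /le_trans]; apply. Qed.

Lemma prim_a f : I f a = 0.
Proof. by rewrite /I set_itv1 Rintegral_set1. Qed.
Lemma eq_prim f g x : x <= b -> (forall t, J t -> f t = g t) -> I f x = I g x.
Proof.
move=> xb fg; apply: eq_Rintegral => t; rewrite inE => tx; apply: fg.
exact: subJ tx.
Qed.
Lemma primD f g x : x <= b -> L1i f -> L1i g -> I (fun t => f t + g t) x = I f x + I g x.
Proof. by move=> xb f1 g1; rewrite /I RintegralD//; exact: L1S. Qed.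
Lemma primB f g x : x <= b -> L1i f -> L1i g -> I (fun t => f t - g t) x = I f x - I g x.
Proof. by move=> xb f1 g1; rewrite /I RintegralB//; exact: L1S. Qed.
Lemma primZ k f x : x <= b -> L1i f -> I (fun t => k * f t) x = k * I f x.
Proof. by move=> xb f1; rewrite /I RintegralZl//; exact: L1S. Qed.
Lemma le_prim f g x : x <= b -> L1i f -> L1i g -> (forall t, J t -> f t <= g t) ->
  I f x <= I g x.
Proof.
move=> xb f1 g1 fg; apply: le_Rintegral => //; [exact: L1S..|] => t tx.
by apply: fg; exact: subJ tx.
Qed.
Lemma prim_ge0 f x : x <= b -> (forall t, J t -> 0 <= f t) -> 0 <= I f x.
Proof. by move=> xb f0; apply: Rintegral_ge0 => t /(subJ xb) /f0. Qed.
Lemma prim_abs f x : x <= b -> L1i f -> `|I f x| <= I (fun t => `|f t|) x.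
Proof. by move=> xb f1; apply: le_normr_Rintegral => //; exact: L1S. Qed.

Lemma prim_sub f x y : L1i f -> a <= x -> x <= y -> y <= b ->
  I f y - I f x = \int[mu]_(t in `]x, y]) f t.
Proof.
move=> f1 ax xy yb; rewrite /I Rintegral_itvB//; first exact: L1S.
Qed.
Lemma prim_cst c x : a <= x -> I (fun=> c) x = c * (x - a).
Proof.
move=> ax; rewrite /I Rintegral_cst//= lebesgue_measure_itv/= lte_fin.
case: ltP => [//|xa]; have -> : x = a by apply/eqP; rewrite eq_le xa ax.
by rewrite subrr !mulr0.
Qed.
Lemma prim_le f x y : L1i f -> a <= x -> x <= y -> y <= b -> (forall t, J t -> 0 <= f t) ->
  I f x <= I f y.
Proof.
move=> f1 ax xy yb f0; rewrite -subr_ge0 prim_sub//; apply: Rintegral_ge0 => t /=.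
rewrite in_itv/= => /andP[xt ty]; apply: f0; rewrite /= in_itv/= (le_trans ty yb) andbT.
by rewrite (le_trans ax)// ltW.
Qed.
Lemma prim_lip f M x y : L1i f -> (forall t, J t -> `|f t| <= M) ->
  J x -> J y -> `|I f x - I f y| <= M * `|x - y|.
Proof.
move=> f1 fM; wlog xy : x y / y <= x.
  move=> H Jx Jy; have [|/ltW yx] := leP y x; first by move/H; apply.
  by rewrite distrC (distrC x); exact: H.
rewrite /= !in_itv/= => /andP[ax xb] /andP[ay yb].
have aM : M * x <= M * x by [].
rewrite prim_sub// [`|x - y|]ger0_norm ?subr_ge0//.
have sub : `]y, x]%classic `<=` J.
  by apply: subset_itv; rewrite bnd_simp.
have fi : mu.-integrable `]y, x] (EFin \o f) by apply: integrableS f1.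
apply: le_trans (le_normr_Rintegral _ _) _ => //.
apply: (@le_trans _ _ (\int[mu]_(t in `]y, x]) (cst M t))).
  apply: le_Rintegral => //.
  - exact: integrable_norm.
  - by apply: integrableS (L1_cst M).
  - by move=> t /sub /fM.
rewrite Rintegral_cst//= lebesgue_measure_itv/= lte_fin.
case: ltP => [//|xy']; have -> : x = y by apply/eqP; rewrite eq_le xy xy'.
by rewrite subrr !mulr0.
Qed.

Lemma prim_continuous f : L1i f -> {within J, continuous (I f)}.
Proof. by move=> f1; apply: parameterized_integral_continuous => //; exact: ltW. Qed.
Lemma continuousJ_measurable f : {within J, continuous f} -> measurable_fun J f.
Proof. by move=> cf; exact: subspace_continuous_measurable_fun. Qed.
Lemma prim_bounded f x : L1i f -> J x -> `|I f x| <= I (fun t => `|f t|) b.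
Proof.
move=> f1 /=; rewrite in_itv/= => /andP[ax xb]; apply: le_trans (prim_abs xb f1) _.
by apply: prim_le => //; exact: L1_abs.
Qed.
Lemma prim_measurable f : L1i f -> measurable_fun J (I f).
Proof. by move=> f1; apply: continuousJ_measurable; exact: prim_continuous. Qed.
Lemma prim_L1 f : L1i f -> L1i (I f).
Proof.
move=> f1; apply: (L1_bounded (prim_measurable f1)); first by move=> x; exact: prim_bounded.
Qed.
Lemma bounded_continuousJ f : {within J, continuous f} -> exists M, forall x, J x -> `|f x| <= M.
Proof.
move=> cf.
have : compact (f @` J) by apply: continuous_compact => //; exact: segment_compact.
move=> /compact_bounded[M [_ HM]]; exists (M + 1) => x Jx.
by apply: (HM (M + 1)); [rewrite ltrDl|exists x].
Qed.

(** * Integration by parts for integrable derivatives *)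

Section ByParts.
Variables (f g : R -> R).
Hypotheses (f1 : L1i f) (g1 : L1i g).
Let T := measurableTypeR R.
Let k (z : T * T) : \bar R :=
  (if (z.1 : R) <= z.2 then (f \_ J) z.1 * (g \_ J) z.2 else 0)%:E.

Let mfJ h : L1i h -> measurable_fun setT (h \_ J).
Proof. by move=> /L1_measurable mh; apply/(measurable_restrictT _ measJ). Qed.

Let mk : measurable_fun [set: T * T] k.
Proof.
apply/measurable_EFinP; apply: measurable_fun_ifT.
- apply: measurable_fun_ler; [exact: measurable_fst|exact: measurable_snd].
- apply: measurable_funM.
    by apply: (measurableT_comp (mfJ f1)); exact: measurable_fst.
  by apply: (measurableT_comp (mfJ g1)); exact: measurable_snd.
- exact: measurable_cst.
Qed.

Let intJ h : L1i h -> mu.-integrable setT (EFin \o (h \_ J)).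
Proof.
move=> h1; rewrite -restrict_EFin; apply/integrable_restrict => //; by rewrite setTI.
Qed.

(** The kernel is dominated by the product of the absolute values of [f] and [g], whose double
    integral is the product of two finite integrals. *)
Let ik : (mu \x mu)%E.-integrable setT k.
Proof.
apply/integrable12ltyP => //.
pose G := (\int[mu]_y `|((g \_ J) y)%:E|)%E.
have G0 : (0 <= G)%E by apply: integral_ge0.
have Gf : (G < +oo)%E by have /integrableP[_] := intJ g1.
have mg : measurable_fun setT (fun y => `|((g \_ J) y)%:E|%E).
  by apply: measurableT_comp => //; apply/measurable_EFinP; exact: mfJ.
have mf : measurable_fun setT (fun y => `|((f \_ J) y)%:E|%E).
  by apply: measurableT_comp => //; apply/measurable_EFinP; exact: mfJ.
have le1 x : (\int[mu]_y `|k (x, y)| <= `|((f \_ J) x)%:E| * G)%E.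
  rewrite /G -ge0_integralZl//.
  apply: ge0_le_integral => //.
  - apply: measurableT_comp => //.
    exact: (measurable_fun_pair2 (f := k)).
  - by apply: measurable_funeM.
  - move=> y _; rewrite /k/=; case: ifP => _; last by rewrite normr0 mule_ge0.
    by rewrite normrM EFinM.
apply: (@le_lt_trans _ _ (\int[mu]_x (`|((f \_ J) x)%:E| * G))%E).
  apply: ge0_le_integral => //.
  - by move=> x _; apply: integral_ge0.
  - have mak : measurable_fun [set: T * T] (abse \o k) by exact: measurableT_comp.
    have := @measurable_fun_fubini_tonelli_F _ _ _ _ _ mu (abse \o k) mak.
    by apply => x /=.
  - under eq_fun do rewrite muleC; exact: measurable_funeM.
rewrite ge0_integralZr//.
have /integrableP[_ Ff] := intJ f1.
by apply: lte_mul_pinfty => //; [exact: integral_ge0|rewrite ge0_fin_numE//; exact: integral_ge0].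
Qed.

(** Both sides are the integral of [f x * g y] over the triangle [a <= x <= y <= b], with the inner
    integration in [y] on the left and in [x] on the right. *)
Lemma prim_by_parts0 :
  \int[mu]_(x in J) (f x * (I g b - I g x)) = \int[mu]_(x in J) (g x * I f x).
Proof.
rewrite /Rintegral; congr fine.
rewrite [LHS]integral_mkcond [RHS]integral_mkcond.
transitivity (\int[mu]_x \int[mu]_y k (x, y))%E.
  apply: eq_integral => x _; rewrite restrict_EFin/= /patch.
  case: ifPn => xJ.
    have := set_mem xJ; rewrite /= in_itv/= => /andP[ax xb].
    have gi : mu.-integrable `[x, b] (EFin \o g).
      by apply: integrableS g1 => //; apply: subset_itvr; rewrite bnd_simp.
    transitivity (\int[mu]_(y in `[x, b]) (f x * g y)%:E)%E.
      rewrite prim_sub// Rintegral_itv_obnd_cbnd; last first.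
        by apply: integrableS g1 => //; apply: subset_itvr; rewrite bnd_simp.
      rewrite -RintegralZl// /Rintegral fineK//.
      apply: integrable_fin_num => //; exact: (integrableZl _ (f x) gi).
    rewrite integral_mkcond; apply: eq_integral => y _.
    rewrite restrict_EFin/= /k/= /patch xJ /=.
    case: leP => xy.
      rewrite mem_setE in_itv/= xy/= mem_setE in_itv/= (le_trans ax xy)/=.
      by case: ifP => //; rewrite mulr0.
    by rewrite mem_setE in_itv/= leNgt xy.
  under eq_integral do rewrite /k/= /patch (negbTE xJ) mul0r if_same.
  by rewrite integral0.
rewrite Fubini//; apply: eq_integral => y _; rewrite restrict_EFin/= /patch.
case: ifPn => yJ.
  have := set_mem yJ; rewrite /= in_itv/= => /andP[ay yb].
  transitivity (\int[mu]_(x in `[a, y]) (g y * f x)%:E)%E; last first.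
    rewrite /I -RintegralZl//; last exact: L1S.
    rewrite /Rintegral fineK//.
    apply: integrable_fin_num => //; exact: (integrableZl _ (g y) (L1S yb f1)).
  rewrite [RHS]integral_mkcond; apply: eq_integral => x _.
  rewrite restrict_EFin/= /k/= /patch yJ /=.
  case: leP => xy; rewrite !mem_setE !in_itv/=.
    by rewrite xy (le_trans xy yb) !andbT; case: ifP => _; rewrite ?mul0r// mulrC.
  by rewrite [x <= y]leNgt xy andbF.
under eq_integral do rewrite /k/= /patch (negbTE yJ) mulr0 if_same.
by rewrite integral0.
Qed.

End ByParts.

(** The product rule for [A + I f] and [B + I g], in a form that assumes no pointwise derivative; it
    is the source of Green's formula. *)
Lemma prim_by_parts f g A B : L1i f -> L1i g ->
  I (fun x => f x * (B + I g x) + (A + I f x) * g x) b =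
  (A + I f b) * (B + I g b) - A * B.
Proof.
move=> f1 g1.
have fm h k : L1i h -> L1i k -> L1i (fun x => h x * I k x).
  move=> h1 k1; have := L1M h1 (prim_measurable k1) (fun x => @prim_bounded _ x k1).
  by apply: L1_eq => x _; rewrite mulrC.
have i1 := fm _ _ f1 g1; have i2 := fm _ _ g1 f1.
have /= := prim_by_parts0 f1 g1; rewrite -![Rintegral mu _ _]/(I _ b) => H.
have H' : I g b * I f b - I (fun x => f x * I g x) b = I (fun x => g x * I f x) b.
  rewrite -H -primZ// -primB//; last exact: L1Z.
  by apply: eq_prim => // t _; ring.
transitivity (I (fun x => (B * f x + f x * I g x) + (A * g x + g x * I f x)) b).
  by apply: eq_prim => // t _; ring.
rewrite !primD// ?primZ//; try exact: L1D; try exact: L1Z.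
  by rewrite -H'; ring.
  by apply: L1D => //; exact: L1Z.
by apply: L1D => //; exact: L1Z.
Qed.

End Interval.

(** * Square integrable functions: null functions and completeness *)

Section SquareIntegrable.
Context {R : realType} (a b : R) (ab : a < b).
Local Notation mu := (@lebesgue_measure R).
Local Notation J := `[a, b]%classic.
Local Notation I := (prim a).
Local Notation L1i := (L1i a b).
Implicit Types f g h : R -> R.

Lemma ae_imp (P Q : R -> Prop) : (forall x, P x -> Q x) ->
  {ae mu, forall x, P x} -> {ae mu, forall x, Q x}.
Proof. by move=> PQ; apply: (@filterS _ _ (ae_filter_ringOfSetsType mu)). Qed.
Lemma ae_and (P Q : R -> Prop) :
  {ae mu, forall x, P x} -> {ae mu, forall x, Q x} -> {ae mu, forall x, P x /\ Q x}.
Proof. exact: (@filterI _ _ (ae_filter_ringOfSetsType mu)). Qed.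

Lemma prim_EFin f : L1i f -> (\int[mu]_(x in J) (f x)%:E)%E = (I f b)%:E.
Proof.
by move=> f1; rewrite /prim /Rintegral fineK//; apply: integrable_fin_num.
Qed.

Lemma L1_ge0P f : measurable_fun J f -> (forall x, J x -> 0 <= f x) ->
  (\int[mu]_(x in J) (f x)%:E < +oo)%E -> L1i f.
Proof.
move=> mf f0 fy; apply/integrableP; split; first exact/measurable_EFinP.
congr (_ < _)%E : fy; apply: eq_integral => x; rewrite inE => Jx /=.
by rewrite ger0_norm// f0.
Qed.

Definition L2i f := measurable_fun J f /\ L1i (fun x => f x ^+ 2).

Lemma L2M f g : L2i f -> L2i g -> L1i (fun x => f x * g x).
Proof.
move=> [mf f2] [mg g2]; apply: (L1_le (g := fun x => 2^-1 * (f x ^+ 2 + g x ^+ 2))).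
- exact: measurable_funM.
- move=> x _; rewrite normrM.
  have := sqr_ge0 (`|f x| - `|g x|); rewrite sqrrB !real_normK ?num_real//; lra.
- by apply: L1Z; apply: L1D.
Qed.
Lemma L2ZD k f g : L2i f -> L2i g -> L2i (fun x => k * f x + g x).
Proof.
move=> f2 g2; split.
  apply: measurable_funD; last by case: g2.
  by apply: measurable_funM; [exact: measurable_cst|case: f2].
have h1 : L1i (fun x => k ^+ 2 * f x ^+ 2 + (2 * k * (f x * g x) + g x ^+ 2)).
  apply: L1D; first by apply: L1Z; case: f2.
  by apply: L1D; [apply: L1Z; exact: L2M|case: g2].
by apply: L1_eq h1 => x _; ring.
Qed.
Lemma L2_bounded f M : measurable_fun J f -> (forall x, J x -> `|f x| <= M) -> L2i f.
Proof.
move=> mf fM; split=> //; apply: (L1_bounded ab (M := M ^+ 2)); first exact: measurable_funX.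
move=> x Jx; rewrite normrX ler_sqr ?nnegrE ?fM//.
by apply: le_trans (fM x Jx).
Qed.
Lemma L2_cst c : L2i (fun=> c).
Proof. by apply: (@L2_bounded _ `|c|) => //; exact: measurable_cst. Qed.
Lemma L2_L1 f : L2i f -> L1i f.
Proof.
move=> f2; have := L2M f2 (L2_cst 1); by apply: L1_eq => x _; rewrite mulr1.
Qed.
Lemma L2_continuous f : {within J, continuous f} -> L2i f.
Proof.
move=> cf; have [M fM] := bounded_continuousJ cf.
by apply: L2_bounded fM; exact: continuousJ_measurable.
Qed.
Lemma L2_eq f g : (forall x, J x -> f x = g x) -> L2i f -> L2i g.
Proof.
move=> fg [mf f2]; split; last by apply: L1_eq f2 => x Jx; rewrite fg.
by apply: eq_measurable_fun mf => x; rewrite inE => Jx; rewrite fg.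
Qed.
Lemma L2M_bounded h f M : L2i f -> measurable_fun J h -> (forall x, J x -> `|h x| <= M) ->
  L2i (fun x => h x * f x).
Proof.
move=> [mf f2] mh hM; split; first exact: measurable_funM.
have h2 : forall x, J x -> `|h x ^+ 2| <= M ^+ 2.
  move=> x Jx; rewrite normrX ler_sqr ?nnegrE ?hM//; exact: le_trans (hM x Jx).
have := L1M f2 (measurable_funX 2 mh) h2; apply: L1_eq => x _.
by rewrite exprMn.
Qed.

(* The Cauchy-Schwarz bound of the L1 norm by the L2 norm, in the linear form
   obtained from 2 |f| <= t f^2 + 1/t. *)
Lemma prim_abs_le f t : 0 < t -> L2i f ->
  2 * I (fun x => `|f x|) b <= t * I (fun x => f x ^+ 2) b + t^-1 * (b - a).
Proof.
move=> t0 f2; have f1 := L2_L1 f2.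
have -> : t^-1 * (b - a) = I (fun=> t^-1) b by rewrite prim_cst// ltW.
have A1 := L1_abs f1; have S1 := f2.2; have c1 := L1_cst ab t^-1.
rewrite -(primZ 2 (lexx b) A1) -(primZ t (lexx b) S1) -(primD (lexx b) (L1Z t S1) c1).
apply: le_prim => //; [exact: L1Z|by apply: L1D => //; exact: L1Z|].
move=> x _; rewrite -subr_ge0 (_ : _ - _ = t * (`|f x| - t^-1) ^+ 2).
  by rewrite mulr_ge0 ?sqr_ge0// ltW.
by rewrite sqrrB real_normK ?num_real// mulr2n; field; rewrite gt_eqF.
Qed.

Lemma eq_prim_ae f g x : x <= b -> measurable_fun J f -> measurable_fun J g ->
  {ae mu, forall x, J x -> f x = g x} -> I f x = I g x.
Proof.
move=> xb mf mg fg; rewrite /prim /Rintegral; congr fine.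
have sub : `[a, x]%classic `<=` J by move=> t; exact: subJ.
apply: ae_eq_integral => //.
- by apply/measurable_EFinP; apply: measurable_funS mf.
- by apply/measurable_EFinP; apply: measurable_funS mg.
- by move: fg; apply: ae_imp => t /= H /sub /H ->.
Qed.

Lemma prim_sqr0_continuous f : {within J, continuous f} ->
  I (fun x => f x ^+ 2) b = 0 -> forall x, J x -> f x = 0.
Proof.
move=> cf If0 x Jx; apply/eqP; apply: contrapT => /negP fx0.
have c0 : 0 < `|f x| / 2 by rewrite divr_gt0 ?normr_gt0.
move/subspace_continuousP : (cf) => /(_ x Jx) /cvgrPdist_lt /(_ _ c0).
rewrite near_withinE => /nbhs_ballP[e /= e0 He].
have /andP[ax xb] : a <= x <= b by move: Jx; rewrite /= in_itv.
(* The interval is clipped to [J] because [x] may be an end point; halving [e] keeps []u, v]] inside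
   the ball where [f] stays above half of its value at [x]. *)
pose u := Num.max a (x - e / 2); pose v := Num.min b (x + e / 2).
have e20 : 0 < e / 2 by rewrite divr_gt0.
have uv : u < v.
  by rewrite gt_max !lt_min ab/=; apply/and3P; split; lra.
have au : a <= u by rewrite le_max lexx.
have vb : v <= b by rewrite ge_min lexx.
have f2 := (L2_continuous cf).2.
have sub : `]u, v]%classic `<=` J.
  by apply: subset_itv; rewrite bnd_simp.
have fuv : (`|f x| / 2) ^+ 2 * (v - u) <= \int[mu]_(t in `]u, v]) (f t ^+ 2).
  apply: (@le_trans _ _ (\int[mu]_(t in `]u, v]) (cst ((`|f x| / 2) ^+ 2) t))).
    by rewrite Rintegral_cst//= lebesgue_measure_itv/= lte_fin uv.
  apply: le_Rintegral => //.
  - by apply: integrableS (L1_cst ab ((`|f x| / 2) ^+ 2)).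
  - by apply: integrableS f2.
  move=> t /= tuv; rewrite -[leRHS]real_normK ?num_real//.
  rewrite ler_sqr ?nnegrE ?(ltW c0) ?normr_ge0//.
  have /He : ball x e t.
    rewrite /ball/= ltr_norml; move: tuv; rewrite in_itv/= => /andP[].
    by rewrite gt_max le_min => /andP[_ H1] /andP[_ H2]; apply/andP; split; lra.
  move=> /(_ (sub _ tuv)) H; have := ler_normB (f x) (f t).
  have := ler_normD (f x - f t) (f t); rewrite subrK; lra.
have Ige0 y : y <= b -> 0 <= I (fun x => f x ^+ 2) y.
  by move=> yb; apply: (prim_ge0 yb) => s _; exact: sqr_ge0.
have : 0 < (`|f x| / 2) ^+ 2 * (v - u) by rewrite mulr_gt0 ?exprn_gt0// subr_gt0.
rewrite ltNge => /negP; apply; apply: le_trans fuv _.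
rewrite -(prim_sub f2 au (ltW uv) vb).
have := Ige0 u (ltW (lt_le_trans uv vb)).
have := prim_le f2 (le_trans au (ltW uv)) vb (lexx b) (fun t _ => sqr_ge0 (f t)).
rewrite If0; lra.
Qed.

Lemma ae_neq (c : R) : {ae mu, forall x, x != c}.
Proof.
exists [set c]; split; [exact: measurable_set1|exact: lebesgue_measure_set1|].
by move=> x /= /negP; rewrite negbK => /eqP.
Qed.

(** Almost every point is an interior Lebesgue point, where [f] is the derivative of its primitive,
    here locally 0. *)
Lemma prim0_ae f : L1i f -> (forall x, J x -> I f x = 0) ->
  {ae mu, forall x, J x -> f x = 0}.
Proof.
move=> f1 If0.
have := lebesgue_differentiation (integrable_locally_restrict (measJ a b) f1).
move=> /(ae_and (ae_and (ae_neq a) (ae_neq b))); apply: ae_imp => x [[xna xnb] lx] Jx.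
have /andP[ax xb] : a < x < b.
  by move: Jx; rewrite /= in_itv/= !lt_neqAle xnb eq_sym xna.
have i1 : mu.-integrable `[a, b] (EFin \o (f \_ J)).
  apply: (@L1_eq _ a b f) => // t Jt; by rewrite patchE mem_set.
have axe : (a%:E < x%:E)%E by rewrite lte_fin.
have [_] := @FTC1_lebesgue_pt _ _ (BLeft a) _ _ xb i1 axe lx.
rewrite patchE mem_set// => <-.
rewrite derive1E (@near_eq_derive _ _ _ _ (cst 0)) ?derive_cst//.
near=> y.
have ay : a < y by near: y; exact: lt_nbhsr.
have yb : y < b by near: y; exact: lt_nbhsl.
have Jy : J y by rewrite /= in_itv/= !ltW.
rewrite -[RHS](If0 y Jy); apply: eq_Rintegral => t; rewrite inE => aty.
by rewrite patchE mem_set//; apply: subJ aty; exact: ltW.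
Unshelve. all: by end_near. Qed.

(** A rapidly Cauchy subsequence has integrable total variation in its index, hence converges almost
    everywhere; Fatou's lemma then carries the Cauchy bound over to the limit. *)
Theorem Riesz_Fischer (f : nat -> R -> R) : (forall n, L2i (f n)) ->
  (forall e : R, 0 < e -> exists m, forall i j, (m <= i)%N -> (m <= j)%N ->
    I (fun x => (f i x - f j x) ^+ 2) b <= e) ->
  exists2 g, L2i g & forall e : R, 0 < e -> exists m, forall i, (m <= i)%N ->
    I (fun x => (f i x - g x) ^+ 2) b <= e.
Proof.
move=> f2 fC.
have fB i j : L2i (fun x => f i x - f j x).
  by apply: L2_eq (L2ZD (-1) (f2 j) (f2 i)) => x _; rewrite mulN1r addrC.
have /choice[m mP] k : exists m, forall i j, (m <= i)%N -> (m <= j)%N ->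
    I (fun x => (f i x - f j x) ^+ 2) b <= 4^-1 ^+ k.
  by apply: fC; rewrite exprn_gt0.
(* Cumulative sums make the indices monotone and at least [m k]; the successor makes them also at
   least [k]. *)
pose n k := (\sum_(j < k.+1) (m j).+1)%N.
have nm k : (m k <= n k)%N by rewrite /n big_ord_recr/=; apply: leq_trans (leq_addl _ _).
have n_ge k : (k <= n k)%N.
  apply: (@leq_trans (\sum_(j < k.+1) 1)%N); first by rewrite sum_nat_const card_ord muln1.
  exact: leq_sum.
have nS k : (n k <= n k.+1)%N by rewrite [n k.+1]/n big_ord_recr/= leq_addr.
pose d k x := `|f (n k.+1) x - f (n k) x|.
have d1 k : L1i (d k) by apply: L1_abs; apply: L2_L1.
have md k : measurable_fun J (d k) := L1_measurable (d1 k).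
pose C := 1 + (b - a).
have Id k : 2 * I (d k) b <= C * 2^-1 ^+ k.
  (* With [t = 2 ^+ k] the square norm [4^-1 ^+ k] and the term in [t^-1] both become of order
     [2^-1 ^+ k]. *)
  have t0 : (0 : R) < 2 ^+ k by rewrite exprn_gt0.
  apply: le_trans (prim_abs_le t0 (fB _ _)) _.
  rewrite exprVn /C mulrDl mul1r [_^-1 * (b - a)]mulrC lerD2r.
  apply: le_trans (ler_wpM2l (ltW t0) (mP k _ _ _ _)) _; rewrite ?nm//.
    by apply: leq_trans (nS k).
  rewrite (_ : (4^-1 : R) = 2^-1 * 2^-1); last by field.
  by rewrite exprMn mulrA exprVn mulfV ?mul1r// gt_eqF.
pose S x := (\sum_(0 <= k <oo) (d k x)%:E)%E.
have S0 x : (0 <= S x)%E by apply: nneseries_ge0 => k _ _; rewrite lee_fin normr_ge0.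
have mS : measurable_fun J S.
  by apply: ge0_emeasurable_sum => // k; [move=> x _ _; rewrite lee_fin normr_ge0|move=> _; exact/measurable_EFinP].
have iS : mu.-integrable J S.
  apply/integrableP; split => //.
  under eq_integral do rewrite gee0_abs//.
  have mdE k : measurable_fun J (fun x => (d k x)%:E) by exact/measurable_EFinP.
  have dE0 k x : J x -> (0 <= (d k x)%:E)%E by move=> _; rewrite lee_fin normr_ge0.
  rewrite /S (integral_nneseries mu (measJ a b) mdE dE0).
  apply: (@le_lt_trans _ _ C%:E); last exact: ltry.
  apply: lime_le; first by apply: is_cvg_nneseries => k _ _; apply: integral_ge0 => x _; rewrite lee_fin normr_ge0.
  apply: nearW => N; under eq_bigr do rewrite prim_EFin//.
  rewrite sumEFin lee_fin.
  have : \sum_(0 <= k < N) I (d k) b <= C - C * 2^-1 ^+ N.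
    elim: N => [|N IH]; first by rewrite big_nil expr0 mulr1 subrr.
    rewrite big_nat_recr//= exprS; have := Id N; lra.
  have : 0 <= C * 2^-1 ^+ N by rewrite mulr_ge0 ?exprn_ge0// /C; have := ab; lra.
  lra.
(* The upper limit is measurable without knowing where the subsequence converges, and agrees with
   the limit wherever it does. *)
pose g x := fine (limn_esup (fun k => (f (n k) x)%:E)).
have mg : measurable_fun J g.
  apply: (measurableT_comp (f := fine)) => //.
  by apply: measurable_fun_limn_esup => k; apply/measurable_EFinP; case: (f2 (n k)).
have fg : {ae mu, forall x, J x -> f (n k) x @[k --> \oo] --> g x}.
  have := integrable_ae (measJ a b) iS; apply: ae_imp => x /[apply].
  rewrite ge0_fin_numE// => Sx.
  have : cvgn (series (fun k => f (n k.+1) x - f (n k) x)).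
    apply: normed_cvg; apply: nondecreasing_is_cvgn.
      by apply: nondecreasing_series => k _ _; exact: normr_ge0.
    exists (fine (S x)) => _ [N _ <-].
    rewrite -lee_fin fineK ?ge0_fin_numE// /series/= -sumEFin.
    by apply: nneseries_lim_ge => k _; rewrite lee_fin normr_ge0.
  have -> : series (fun k => f (n k.+1) x - f (n k) x) = (fun k => f (n k) x - f (n 0%N) x).
    by apply/funext => N; rewrite /series/= telescope_sumr.
  move=> H.
  have {}H : cvgn (fun k => f (n k) x).
    have -> : (fun k => f (n k) x) = (fun k => (f (n k) x - f (n 0%N) x) + f (n 0%N) x).
      by apply/funext => k; rewrite subrK.
    by apply: is_cvgD => //; exact: is_cvg_cst.
  have H2 : (f (n k) x)%:E @[k --> \oo] --> (limn (fun k => f (n k) x))%:E.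
    by apply/cvg_EFin; [exact: nearW|].
  by rewrite /g (cvg_limn_einf_sup H2).2.
(* Fatou's lemma along the subsequence, with [i] fixed. *)
have key (e : R) i : 0 < e ->
    (exists m, forall k, (m <= k)%N -> I (fun x => (f i x - f k x) ^+ 2) b <= e) ->
    (\int[mu]_(x in J) ((f i x - g x) ^+ 2)%:E <= e%:E)%E.
  move=> e0 [N NP].
  pose u k x := ((f i x - f (n k) x) ^+ 2)%:E.
  have mu_ k : measurable_fun J (u k) by apply/measurable_EFinP; apply: measurable_funX; case: (fB i (n k)).
  rewrite (@ge0_ae_eq_integral _ _ _ mu J _ (fun x => limn_einf (u^~ x))) //.
  - apply: le_trans (fatou mu (measJ a b) mu_ _) _.
      by move=> k x _; rewrite lee_fin sqr_ge0.
    apply: le_trans (limn_einf_sup _) _; rewrite limn_esup_lim.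
    apply: lime_le; first exact: is_cvg_esups.
    exists N => // k /= Nk; apply: ge_ereal_sup => _ [p /= kp <-].
    rewrite prim_EFin; last by case: (fB i (n p)).
    rewrite lee_fin; apply: NP; apply: leq_trans Nk _; apply: leq_trans kp _.
    exact: n_ge.
  - apply/measurable_EFinP; apply: measurable_funX; apply: measurable_funB => //; by case: (f2 i).
  - have -> : (fun x => limn_einf (u^~ x)) = (fun x => - limn_esup (fun k => - u k x))%E.
      apply/funext => x; rewrite -limn_einfN; congr limn_einf; apply/funext => k /=; by rewrite opprK.
    apply: measurableT_comp => //; apply: measurable_fun_limn_esup => k.
    by apply: (measurableT_comp (f := -%E)) => //; exact: mu_.
  - by move=> x _; rewrite lee_fin sqr_ge0.
  - move=> x _; rewrite limn_einf_lim; apply: lime_ge; first exact: is_cvg_einfs.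
    by apply: nearW => k; apply: le_ereal_inf_tmp => _ [p _ <-]; rewrite lee_fin sqr_ge0.
  - move: fg; apply: ae_imp => x /[apply] H.
    suff H2 : u k x @[k --> \oo] --> ((f i x - g x) ^+ 2)%:E.
      by rewrite (cvg_limn_einf_sup H2).1.
    apply/cvg_EFin; [exact: nearW|]; rewrite /u/=.
    by apply: (@cvgM _ _ _ _ (fun k => f i x - f (n k) x) (fun k => f i x - f (n k) x)); apply: cvgB => //; exact: cvg_cst.
exists g.
  (* [key] shows that [f N - g] is square integrable for one [N], hence so is [g]. *)
  have [N NP] := fC 1 ltr01; have D2 : L2i (fun x => f N x - g x).
    split; first by apply: measurable_funB => //; case: (f2 N).
    apply: L1_ge0P.
    - by apply: measurable_funX; apply: measurable_funB => //; case: (f2 N).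
    - by move=> x _; exact: sqr_ge0.
    - apply: (@le_lt_trans _ _ 1%:E); last exact: ltry.
      by apply: key => //; exists N => k Nk; exact: NP.
  by apply: L2_eq (L2ZD (-1) D2 (f2 N)) => x _; ring.
move=> e e0; have [N NP] := fC e e0; exists N => i Ni.
have H : (\int[mu]_(x in J) ((f i x - g x) ^+ 2)%:E <= e%:E)%E.
  by apply: key => //; exists N => k Nk; exact: NP.
have i1 : L1i (fun x => (f i x - g x) ^+ 2).
  apply: L1_ge0P.
  - by apply: measurable_funX; apply: measurable_funB => //; case: (f2 i).
  - by move=> x _; exact: sqr_ge0.
  - by apply: le_lt_trans H _; exact: ltry.
by rewrite -lee_fin -prim_EFin.
Qed.

End SquareIntegrable.

(** * The Volterra equation of a linear second order equation *)

Section RealSequences.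
Context {R : realType}.

Lemma geometric_small (k : R) x : (forall n, x <= k * 2^-1 ^+ n) -> x <= 0.
Proof.
move=> H; have g0 : k * 2^-1 ^+ n @[n --> \oo] --> k * 0.
  apply: cvgMr; apply: cvg_expr; rewrite ger0_norm; lra.
rewrite mulr0 in g0; apply: (ler_cvg_to (cvg_cst x : (x @[_ --> \oo] --> x)) g0).
exact: nearW.
Qed.

(** The intervals of radius [2 * c * 2^-1 ^+ n] about [u n] are nested; the supremum of their left
    ends lies in all of them, which gives the limit together with its rate. *)
Lemma geometric_cauchy (u : nat -> R) c :
  (forall n, `|u n.+1 - u n| <= c * 2^-1 ^+ n) ->
  exists l, forall n, `|l - u n| <= 2 * c * 2^-1 ^+ n.
Proof.
move=> H.
pose v n := u n - 2 * c * 2^-1 ^+ n; pose w n := u n + 2 * c * 2^-1 ^+ n.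
have c0 : 0 <= c by have := H 0%N; rewrite expr0 mulr1; apply: le_trans.
have e0 n : 0 <= (2^-1 : R) ^+ n by rewrite exprn_ge0.
have vS n : v n <= v n.+1.
  by have := H n; rewrite /v exprS ler_norml => /andP[]; lra.
have wS n : w n.+1 <= w n.
  by have := H n; rewrite /w exprS ler_norml => /andP[]; lra.
have /nondecreasing_seqP vm := vS; have /nonincreasing_seqP wm := wS.
have vw i j : v i <= w j.
  apply: (@le_trans _ _ (v (maxn i j))).
    by apply: vm; exact: leq_maxl.
  apply: (@le_trans _ _ (w (maxn i j))).
    by rewrite /v /w; have := mulr_ge0 c0 (e0 (maxn i j)); lra.
  by apply: wm; exact: leq_maxr.
have ubv j : ubound (range v) (w j) by move=> _ [i _ <-].
exists (sup (range v)) => n; rewrite ler_norml.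
have h1 : v n <= sup (range v) by apply: ub_le_sup; [exists (w 0%N)|exists n].
have h2 : sup (range v) <= w n by apply: ge_sup => //; exists (v 0%N); exists 0%N.
by move: h1 h2; rewrite /v /w => h1 h2; apply/andP; split; lra.
Qed.
End RealSequences.

Section Volterra.
Context {R : realType} (a b : R) (ab : a < b).
Local Notation J := `[a, b]%classic.
Local Notation I := (prim a).
Local Notation L1i := (L1i a b).
Implicit Types f g y u v : R -> R.

Lemma continuous_L1 f : {within J, continuous f} -> L1i f.
Proof. by move=> /(L2_continuous ab)/(L2_L1 ab). Qed.

Lemma continuous_expRZ k : continuous (fun t => expR (k * (t - a))).
Proof.
move=> t; apply: (@continuous_comp _ _ _ (fun t => k * (t - a)) expR); last exact: continuous_expR.
apply: cvgMr; apply: cvgB; [exact: cvg_id|exact: cvg_cst].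
Qed.

Lemma prim_expR (k x : R) : 0 < k -> J x ->
  I (fun t => expR (k * (t - a))) x <= expR (k * (x - a)) / k.
Proof.
move=> k0; rewrite /= in_itv/= le_eqVlt => /andP[/predU1P[<-|ax] xb].
  by rewrite prim_a divr_ge0 ?expR_ge0// ltW.
pose F t := expR (k * (t - a)) / k.
have dF (t : R) : is_derive t (1 : R) F (expR (k * (t - a))).
  have -> : F = k^-1 \*: (expR \o (k \*: (id - cst a))).
    by apply/funext => u; rewrite /F/= mulrC.
  apply: is_derive_eq; rewrite subr0 /= mulrC -[k *: 1]/(k * 1) mulr1 -[_ *: _]/(k^-1 * (k * _)).
  by rewrite mulrA mulVf ?mul1r// gt_eqF.
have cE := @continuous_expRZ k.
have := @continuous_FTC2 R (fun t => expR (k * (t - a))) F a x ax.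
rewrite /prim /Rintegral => ->.
- rewrite /= /F subrr mulr0 expR0 lerBlDr lerDl divr_ge0// ltW//.
- by apply: continuous_subspaceT.
- split.
  + by move=> t _; have [] := dF t.
  + apply: cvg_at_right_filter; apply: differentiable_continuous; apply/derivable1_diffP; by have [] := dF a.
  + apply: cvg_at_left_filter; apply: differentiable_continuous; apply/derivable1_diffP; by have [] := dF x.
- by move=> t _; rewrite derive1E; have [_ ->] := dF t.
Qed.

Variables (r : R -> R) (L : R).
Hypotheses (mr : measurable_fun J r) (rL : forall x, J x -> `|r x| <= L).
Let k := 1 + L.
(** Bielecki's weight. The first order system has Lipschitz constant at most [k], and integrating
    [E] gains a factor [1 / (2 * k)], so in the sup norm weighted by [E] the Volterra operator
    contracts by 1/2 whatever the length of the interval. *)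
Let E x := expR (2 * k * (x - a)).

Let L0 : 0 <= L.
Proof. by apply: le_trans (rL (_ : J a)) => //; rewrite /= in_itv/= lexx ltW. Qed.
Let E1 x : a <= x -> 1 <= E x.
Proof.
move=> ax; apply: le_trans (expR_ge1Dx _); rewrite lerDl !mulr_ge0 ?subr_ge0//.
by rewrite /k addr_ge0.
Qed.
Let Eb x : J x -> E x <= E b.
Proof.
rewrite /= in_itv/= => /andP[_ xb]; rewrite ler_expR ler_wpM2l ?lerD2r//.
by rewrite mulr_ge0// /k addr_ge0.
Qed.
Let L1E : L1i E.
Proof.
by apply: continuous_L1; apply: continuous_subspaceT => x; exact: continuous_expRZ.
Qed.

Let L1r u : L1i u -> L1i (fun t => r t * u t).
Proof. by move=> u1; exact: L1M mr rL. Qed.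

Let weighted_step u v c : 0 <= c -> L1i u -> L1i v ->
  (forall x, J x -> `|u x| + `|v x| <= c * E x) ->
  forall x, J x -> `|I v x| + `|I (fun t => r t * u t) x| <= c / 2 * E x.
Proof.
move=> c0 u1 v1 H x Jx; have xb : x <= b by move: Jx; rewrite /= in_itv/= => /andP[].
have k0 : 0 < k by rewrite /k ltr_wpDr.
apply: le_trans (lerD (prim_abs xb v1) (prim_abs xb (L1r u1))) _.
rewrite -(primD xb (L1_abs v1) (L1_abs (L1r u1))).
apply: (@le_trans _ _ (I (fun t => (k * c) * E t) x)).
  apply: (le_prim xb); first exact: (L1D (L1_abs v1) (L1_abs (L1r u1))).
    exact: L1Z.
  move=> t Jt; rewrite normrM -mulrA.
  apply: le_trans (ler_wpM2l (ltW k0) (H t Jt)); rewrite /k.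
  have := ler_wpM2r (normr_ge0 (u t)) (rL Jt); have := mulr_ge0 L0 (normr_ge0 (v t)).
  have := normr_ge0 (u t); rewrite mulrDl mul1r mulrDr; lra.
rewrite (primZ _ xb L1E).
have kE : I E x <= E x / (2 * k) by apply: prim_expR => //; rewrite mulr_gt0.
apply: le_trans (ler_wpM2l _ kE) _; first by rewrite mulr_ge0// ltW.
by rewrite le_eqVlt; apply/orP; left; apply/eqP; field; rewrite gt_eqF.
Qed.

(** Continuity makes the weighted supremum finite; the contraction bounds it by [c] plus half of
    itself, hence by [2 * c]. *)
Lemma Gronwall u v c : {within J, continuous u} -> {within J, continuous v} ->
  (forall x, J x -> `|u x| + `|v x| <= c + (`|I v x| + `|I (fun t => r t * u t) x|)) ->
  forall x, J x -> `|u x| + `|v x| <= 2 * c * E b.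
Proof.
move=> cu cv H.
have Ja : J a by rewrite /= in_itv/= lexx ltW.
have c0 : 0 <= c.
  have := H a Ja; rewrite !prim_a normr0 addr0 addr0; apply: le_trans.
  by rewrite addr_ge0.
have [Mu uM] := bounded_continuousJ cu; have [Mv vM] := bounded_continuousJ cv.
pose S := [set (`|u x| + `|v x|) / E x | x in J].
have Epos x : 0 < E x by exact: expR_gt0.
have inS x : J x -> S ((`|u x| + `|v x|) / E x) by exists x.
have ubS : has_ubound S.
  exists (Mu + Mv) => _ [x Jx <-]; rewrite ler_pdivrMr//.
  have ax : a <= x by move: Jx; rewrite /= in_itv/= => /andP[].
  have uv0 : 0 <= Mu + Mv by apply: le_trans (lerD (uM x Jx) (vM x Jx)); rewrite addr_ge0.
  apply: le_trans (lerD (uM x Jx) (vM x Jx)) _.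
  by rewrite ler_peMr// E1.
have Sx x : J x -> `|u x| + `|v x| <= sup S * E x.
  by move=> Jx; rewrite -ler_pdivrMr//; apply: ub_le_sup => //; exact: inS.
have S0 : 0 <= sup S.
  by have := le_trans (addr_ge0 (normr_ge0 _) (normr_ge0 _)) (Sx a Ja); rewrite pmulr_lge0.
have supS : sup S <= c + sup S / 2.
  apply: ge_sup; first by exists ((`|u a| + `|v a|) / E a); exact: inS.
  move=> _ [x Jx <-]; rewrite ler_pdivrMr//.
  apply: le_trans (H x Jx) _; rewrite mulrDl; apply: lerD.
    by rewrite ler_peMr// E1//; move: Jx; rewrite /= in_itv/= => /andP[].
  by apply: weighted_step => //; exact: continuous_L1.
move=> x Jx; apply: le_trans (Sx x Jx) _.
apply: ler_pM => //; [exact: ltW|lra|exact: Eb].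
Qed.

(** The initial value problem [y'' = r y + g], [y(a) = A], [y'(a) = B] as an integral system; [y1]
    plays the derivative of [y]. *)
Definition solves g A B y y1 :=
  [/\ {within J, continuous y}, {within J, continuous y1},
      forall x, J x -> y x = A + I y1 x
    & forall x, J x -> y1 x = B + I (fun t => r t * y t + g t) x].

Lemma solves_le g A B y y1 : L1i g -> solves g A B y y1 ->
  forall x, J x -> `|y x| + `|y1 x| <= 2 * (`|A| + `|B| + I (fun t => `|g t|) b) * E b.
Proof.
move=> g1 [cy cy1 yE y1E]; apply: Gronwall => // x Jx.
have y1L := continuous_L1 cy1; have yL := continuous_L1 cy.
have xb : x <= b by move: Jx; rewrite /= in_itv/= => /andP[].
have gx := prim_bounded g1 Jx.
rewrite {1}yE// {1}y1E// (primD xb (L1r yL) g1).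
have := ler_normD A (I y1 x).
have := ler_normD B (I (fun t => r t * y t) x + I g x).
have := ler_normD (I (fun t => r t * y t) x) (I g x).
by lra.
Qed.

Lemma solves_ZD k' g A B y y1 g' A' B' z z1 : L1i g -> L1i g' ->
  solves g A B y y1 -> solves g' A' B' z z1 ->
  solves (fun t => k' * g t + g' t) (k' * A + A') (k' * B + B')
    (fun t => k' * y t + z t) (fun t => k' * y1 t + z1 t).
Proof.
move=> g1 g1' [cy cy1 yE y1E] [cz cz1 zE z1E].
have cZD (u v : R -> R) : {within J, continuous u} -> {within J, continuous v} ->
    {within J, continuous (fun t => k' * u t + v t)}.
  by move=> cu cv x; apply: cvgD; [apply: cvgMr; exact: cu|exact: cv].
split; [exact: cZD|exact: cZD|move=> x Jx..];
  have xb : x <= b by move: Jx; rewrite /= in_itv/= => /andP[].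
- have y11 := continuous_L1 cy1; have z11 := continuous_L1 cz1.
  by rewrite (primD xb (L1Z k' y11) z11) (primZ _ xb y11) yE// zE//; ring.
- have yg : L1i (fun t => r t * y t + g t) by apply: L1D => //; apply: L1r; exact: continuous_L1.
  have zg : L1i (fun t => r t * z t + g' t) by apply: L1D => //; apply: L1r; exact: continuous_L1.
  have -> : (fun t => r t * (k' * y t + z t) + (k' * g t + g' t)) =
      (fun t => k' * (r t * y t + g t) + (r t * z t + g' t)) by apply/funext => t; ring.
  by rewrite (primD xb (L1Z k' yg) zg) (primZ _ xb yg) y1E// z1E//; ring.
Qed.

(** Picard iteration: consecutive iterates differ by at most [c * 2^-1 ^+ n] in the weighted
    norm. *)
Lemma solves_exists g A B : L1i g -> exists y y1, solves g A B y y1.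
Proof.
move=> g1.
pose next (z : (R -> R) * (R -> R)) : (R -> R) * (R -> R) :=
  ((fun x => A + I z.2 x), (fun x => B + I (fun t => r t * z.1 t + g t) x)).
pose z n := iter n next (fun=> 0, fun=> 0).
pose y n := (z n).1; pose w n := (z n).2.
have Lzero : L1i (fun=> 0) by exact: (L1_cst ab 0).
have Lcst c f : L1i f -> L1i (fun x => c + I f x).
  by move=> f1; apply: L1D; [exact: L1_cst|exact: prim_L1].
have L1yw n : L1i (y n) /\ L1i (w n).
  elim: n => [//|n [y1 w1]]; split; apply: Lcst => //.
  by apply: L1D => //; exact: L1r.
have Ly n : L1i (y n) by case: (L1yw n).
have Lw n : L1i (w n) by case: (L1yw n).
have Lry n : L1i (fun t => r t * y n t + g t) by apply: L1D => //; exact: L1r.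
pose c := `|A| + `|B| + I (fun t => `|g t|) b.
have c0 : 0 <= c by rewrite !addr_ge0//; apply: prim_ge0.
have d n x : J x -> `|y n.+1 x - y n x| + `|w n.+1 x - w n x| <= c * 2^-1 ^+ n * E x.
  elim: n x => [|n IH] x Jx.
    rewrite expr0 mulr1 /y /w /= !subr0.
    have -> : I (fun=> 0) x = 0.
      by rewrite prim_cst ?mul0r//; move: Jx; rewrite /= in_itv/= => /andP[].
    have -> : I (fun t => r t * 0 + g t) x = I g x.
      by apply: eq_Rintegral => t _; rewrite mulr0 add0r.
    have cE : c <= c * E x.
      by rewrite ler_peMr// E1//; move: Jx; rewrite /= in_itv/= => /andP[].
    apply: le_trans cE; rewrite /c addr0 -addrA lerD2l.
    apply: le_trans (ler_normD _ _) _; rewrite lerD2l; exact: prim_bounded.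
  have xb : x <= b by move: Jx; rewrite /= in_itv/= => /andP[].
  have -> : y n.+2 x - y n.+1 x = I (fun t => w n.+1 t - w n t) x.
    by rewrite (primB xb (Lw n.+1) (Lw n)) -[y n.+2 x]/(A + I (w n.+1) x) -[y n.+1 x]/(A + I (w n) x); ring.
  have -> : w n.+2 x - w n.+1 x = I (fun t => r t * (y n.+1 t - y n t)) x.
    rewrite -[w n.+2 x]/(B + I (fun t => r t * y n.+1 t + g t) x) -[w n.+1 x]/(B + I (fun t => r t * y n t + g t) x).
    have -> : (fun t => r t * (y n.+1 t - y n t)) = (fun t => (r t * y n.+1 t + g t) - (r t * y n t + g t)).
      by apply/funext => t; ring.
    by rewrite (primB xb (Lry n.+1) (Lry n)); ring.
  rewrite exprSr mulrA; apply: weighted_step => //.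
  - by rewrite mulr_ge0// exprn_ge0.
  - exact: L1B.
  - exact: L1B.
have d1 n x : J x -> `|y n.+1 x - y n x| <= c * E b * 2^-1 ^+ n.
  move=> Jx; apply: (@le_trans _ _ (c * 2^-1 ^+ n * E x)).
    by apply: le_trans (d n x Jx); rewrite lerDl.
  by rewrite mulrAC ler_wpM2r ?exprn_ge0// ler_wpM2l// Eb.
have d2 n x : J x -> `|w n.+1 x - w n x| <= c * E b * 2^-1 ^+ n.
  move=> Jx; apply: (@le_trans _ _ (c * 2^-1 ^+ n * E x)).
    by apply: le_trans (d n x Jx); rewrite lerDr.
  by rewrite mulrAC ler_wpM2r ?exprn_ge0// ler_wpM2l// Eb.
pose M n := 2 * (c * E b) * 2^-1 ^+ n.
(* The limit is taken pointwise with an explicit rate; it is integrable because it is measurable and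
   at bounded distance from the first iterate. *)
have limE (u : nat -> R -> R) : (forall n x, J x -> `|u n.+1 x - u n x| <= c * E b * 2^-1 ^+ n) ->
    (forall n, L1i (u n)) ->
    exists2 ul, L1i ul & forall n x, J x -> `|ul x - u n x| <= M n.
  move=> du u1.
  have /choice[ul ulP] x : exists l, J x -> forall n, `|l - u n x| <= M n.
    have [Jx|nJx] := pselect (J x); last by exists 0.
    by have [l lP] := geometric_cauchy (fun n => du n x Jx); exists l.
  exists ul => [|n x Jx]; last exact: ulP.
  have mul : measurable_fun J ul.
    apply: (@measurable_fun_cvg _ _ _ _ u) => [n|x Jx]; first exact: L1_measurable.
    apply/cvgrPdist_le => e e0.
    have : M n @[n --> \oo] --> 2 * (c * E b) * 0.
      by apply: cvgMr; apply: cvg_expr; rewrite ger0_norm; lra.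
    rewrite mulr0 => /cvgr0Pnorm_le /(_ e e0); apply: filterS => n.
    apply: le_trans; apply: le_trans (ulP x Jx n) _; exact: ler_norm.
  have : L1i (fun x => (ul x - u 0%N x) + u 0%N x).
    apply: L1D => //; apply: (L1_bounded ab (M := M 0%N)).
      by apply: measurable_funB => //; exact: L1_measurable.
    by move=> x Jx; exact: ulP.
  by apply: L1_eq => x _; rewrite subrK.
have [yl yl1 ylP] := limE _ d1 Ly.
have [wl wl1 wlP] := limE _ d2 Lw.
have M0 n : 0 <= M n by rewrite /M !mulr_ge0 ?exprn_ge0// ltW// expR_gt0.
(* Each integral equation will hold because its defect is bounded by a multiple of [M n] for every
   [n]. *)
have small (s C : R) : (forall n, `|s| <= C * M n) -> s = 0.
  move=> H; apply/eqP; rewrite -normr_le0; apply: (@geometric_small _ (C * (2 * (c * E b)))) => n.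
  by rewrite -mulrA; exact: H.
have primM f C n x : L1i f -> J x -> (forall t, J t -> `|f t| <= C * M n) -> `|I f x| <= C * (b - a) * M n.
  move=> f1 Jx fM; have xb : x <= b by move: Jx; rewrite /= in_itv/= => /andP[].
  apply: le_trans (prim_bounded f1 Jx) _.
  rewrite mulrAC -(prim_cst _ (ltW ab)); apply: le_prim => //; first exact: L1_abs.
  exact: L1_cst.
have MS n : M n.+1 <= M n.
  by rewrite /M exprS; have := M0 n; rewrite /M; lra.
have eq1 x : J x -> yl x = A + I wl x.
  move=> Jx; apply/eqP; rewrite -subr_eq0; apply/eqP.
  apply: (small _ (1 + 1 * (b - a))) => n.
  have xb : x <= b by move: Jx; rewrite /= in_itv/= => /andP[].
  have -> : yl x - (A + I wl x) = (yl x - y n.+1 x) - I (fun t => wl t - w n t) x.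
    by rewrite (primB xb wl1 (Lw n)) -[y n.+1 x]/(A + I (w n) x); ring.
  apply: le_trans (ler_normB _ _) _; rewrite [leRHS]mulrDl mul1r; apply: lerD.
    by apply: le_trans (ylP n.+1 x Jx) _.
  by apply: primM => //; [exact: L1B|move=> t Jt; rewrite mul1r; exact: wlP].
have eq2 x : J x -> wl x = B + I (fun t => r t * yl t + g t) x.
  move=> Jx; apply/eqP; rewrite -subr_eq0; apply/eqP.
  apply: (small _ (1 + L * (b - a))) => n.
  have xb : x <= b by move: Jx; rewrite /= in_itv/= => /andP[].
  have -> : wl x - (B + I (fun t => r t * yl t + g t) x) =
      (wl x - w n.+1 x) - I (fun t => r t * (yl t - y n t)) x.
    have -> : (fun t => r t * (yl t - y n t)) = (fun t => (r t * yl t + g t) - (r t * y n t + g t)).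
      by apply/funext => t; ring.
    have Lryl : L1i (fun t => r t * yl t + g t) by apply: L1D => //; exact: L1r.
    rewrite (primB xb Lryl (Lry n)).
    by rewrite -[w n.+1 x]/(B + I (fun t => r t * y n t + g t) x); ring.
  apply: le_trans (ler_normB _ _) _; rewrite [leRHS]mulrDl mul1r; apply: lerD.
    by apply: le_trans (wlP n.+1 x Jx) _.
  apply: primM => //; first by apply: L1r; exact: L1B.
  by move=> t Jt; rewrite normrM ler_pM// ?rL// ylP.
(* So far the limits are only integrable; their continuity is read off the equations they
   satisfy. *)
have cprim c' f h : L1i f -> (forall x, J x -> h x = c' + I f x) -> {within J, continuous h}.
  move=> f1 hE; apply: (@subspace_eq_continuous _ _ _ (fun x => c' + I f x) h).
    by move=> x /set_mem Jx; rewrite /from_subspace/= hE.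
  by move=> x; apply: cvgD; [exact: cvg_cst|exact: prim_continuous].
exists yl, wl; split=> //.
- exact: cprim wl1 eq1.
- by apply: cprim eq2; apply: L1D => //; exact: L1r.
Qed.

End Volterra.

(** * The real problem without transmission conditions *)

Section RealProblem.
Context {R : realType} (a b : R) (ab : a < b).
Local Notation mu := (@lebesgue_measure R).
Local Notation J := `[a, b]%classic.
Local Notation I := (prim a).
Local Notation L1i := (L1i a b).
Local Notation L2i := (L2i a b).
Variables (q : R -> R) (Q : R).
Hypotheses (mq : measurable_fun J q) (qQ : forall x, J x -> `|q x| <= Q).
Variables (al1 al2 be1 be2 bp1 bp2 : R).
Hypothesis al_neq0 : (al1 != 0) || (al2 != 0).
Let rho := bp1 * be2 - be1 * bp2.
Hypothesis rho_gt0 : 0 < rho.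

Definition realH : lmodType R := ((R -> R) * R)%type.
Implicit Types X Y Z : realH.
Definition in_realH X := L2i X.1.
Definition eform X Y : R := I (fun x => X.1 x * Y.1 x) b + X.2 * Y.2 / rho.

Let Ja : J a. Proof. by rewrite /= in_itv/= lexx ltW. Qed.
Let Jb : J b. Proof. by rewrite /= in_itv/= lexx ltW. Qed.

Lemma in_realH0 : in_realH 0. Proof. exact: (L2_cst ab 0). Qed.
Lemma in_realHZD k X Y : in_realH X -> in_realH Y -> in_realH (k *: X + Y).
Proof. exact: L2ZD. Qed.
Lemma eform_sym X Y : eform X Y = eform Y X.
Proof.
rewrite /eform; congr (_ + _); last by rewrite mulrAC mulrC mulrA.
by apply: eq_Rintegral => t _; rewrite mulrC.
Qed.
Lemma eform_ZD k X Y Z : in_realH X -> in_realH Y -> in_realH Z ->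
  eform (k *: X + Y) Z = k * eform X Z + eform Y Z.
Proof.
move=> X2 Y2 Z2; rewrite /eform/=.
have -> : I (fun x => (k * X.1 x + Y.1 x) * Z.1 x) b =
    k * I (fun x => X.1 x * Z.1 x) b + I (fun x => Y.1 x * Z.1 x) b.
  have XZ := L2M X2 Z2; have YZ := L2M Y2 Z2.
  rewrite -(primZ _ (lexx b) XZ) -(primD (lexx b) (L1Z k XZ) YZ).
  by apply: eq_Rintegral => t _; ring.
by rewrite -[k *: X.2]/(k * X.2); field; rewrite gt_eqF.
Qed.
Lemma in_realHZ k X : in_realH X -> in_realH (k *: X).
Proof. by move=> X2; have := in_realHZD k X2 in_realH0; rewrite addr0. Qed.
Lemma eform_Z k X Z : in_realH X -> in_realH Z -> eform (k *: X) Z = k * eform X Z.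
Proof.
move=> X2 Z2; rewrite -[_ *: _]addr0 eform_ZD//; last exact: in_realH0.
have := eform_ZD (-1) in_realH0 in_realH0 Z2; rewrite scaler0 addr0; lra.
Qed.
Lemma eform_ge0 X : in_realH X -> 0 <= eform X X.
Proof.
move=> _; apply: addr_ge0; last by rewrite divr_ge0 ?(ltW rho_gt0)// -expr2 sqr_ge0.
by apply: prim_ge0 => // t _; rewrite -expr2 sqr_ge0.
Qed.
Lemma eform_fst X : I (fun x => X.1 x ^+ 2) b <= eform X X.
Proof. by rewrite lerDl divr_ge0 ?(ltW rho_gt0)// -expr2 sqr_ge0. Qed.
Lemma eform_snd X : X.2 ^+ 2 / rho <= eform X X.
Proof.
by rewrite /eform -[X.2 * X.2]expr2 lerDr; apply: prim_ge0 => // t _; rewrite -expr2 sqr_ge0.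
Qed.

(* [Arel X Z] is [A X = Z] for the operator [A] of the problem without transmission conditions. *)
Definition Arel X Z := exists y1, [/\
  solves a b q (fun t => - Z.1 t) (X.1 a) (y1 a) X.1 y1,
  al1 * X.1 a + al2 * y1 a = 0,
  X.2 = bp1 * X.1 b - bp2 * y1 b &
  Z.2 = - (be1 * X.1 b - be2 * y1 b)].

Lemma Arel_in_realH X Z : Arel X Z -> in_realH X.
Proof. by move=> [y1 [[cy _ _ _] _ _ _]]; exact: L2_continuous. Qed.

(** Green's formula leaves the Wronskian at both ends. At [a] it vanishes, two solutions of the same
    nontrivial boundary condition being proportional there; at [b] the scalar components contribute
    the determinant [rho] times the opposite of it, which the weight [1 / rho] cancels. *)
Lemma Arel_sym X Z X' Z' : in_realH Z -> in_realH Z' -> Arel X Z -> Arel X' Z' ->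
  eform Z X' = eform X Z'.
Proof.
move=> Z2 Z2' AX AX'; have X2 := Arel_in_realH AX; have X2' := Arel_in_realH AX'.
case: AX => y1 [[cy cy1 yE y1E] ya X2E Z2E].
case: AX' => z1 [[cz cz1 zE z1E] za X2E' Z2E'].
set y : R -> R := X.1 in cy yE y1E ya X2E Z2E X2 *; set z : R -> R := X'.1 in cz zE z1E za X2E' Z2E' X2' *.
have y11 := continuous_L1 ab cy1; have z11 := continuous_L1 ab cz1.
have Lq (u : R -> R) Z0 : in_realH Z0 -> {within J, continuous u} -> L1i (fun t => q t * u t + - Z0.1 t).
  move=> Z02 cu; apply: L1D; first exact: (L1M (continuous_L1 ab cu) mq qQ).
  have := L1Z (-1) (L2_L1 ab Z02); by apply: L1_eq => t _; rewrite mulN1r.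
have qy := Lq _ _ Z2 cy; have qz := Lq _ _ Z2' cz.
have P1 := prim_by_parts ab (y a) (z1 a) y11 qz.
have P2 := prim_by_parts ab (z a) (y1 a) z11 qy.
have yz1 := L2M X2 (L2_continuous ab cz1).
have {}P1 : I (fun t => y1 t * z1 t + y t * (q t * z t + - Z'.1 t)) b = y b * z1 b - y a * z1 a.
  rewrite [in RHS]yE// z1E// -P1; apply: eq_prim => // t Jt.
  by rewrite -(z1E t Jt) -(yE t Jt).
have {}P2 : I (fun t => z1 t * y1 t + z t * (q t * y t + - Z.1 t)) b = z b * y1 b - z a * y1 a.
  rewrite [in RHS]zE// y1E// -P2; apply: eq_prim => // t Jt.
  by rewrite -(y1E t Jt) -(zE t Jt).
have mM (u v : R -> R) : {within J, continuous u} -> L1i v -> L1i (fun t => u t * v t).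
  move=> cu v1; have [M uM] := bounded_continuousJ cu.
  exact: (L1M v1 (continuousJ_measurable cu) uM).
have T1 : L1i (fun t => y1 t * z1 t + y t * (q t * z t + - Z'.1 t)).
  by apply: L1D; exact: mM.
have T2 : L1i (fun t => z1 t * y1 t + z t * (q t * y t + - Z.1 t)).
  by apply: L1D; exact: mM.
have zZ := L2M Z2 X2'; have yZ' := L2M X2 Z2'.
have H : I (fun t => Z.1 t * z t) b - I (fun t => y t * Z'.1 t) b =
    (y b * z1 b - y a * z1 a) - (z b * y1 b - z a * y1 a).
  rewrite -P1 -P2 -(primB (lexx b) T1 T2) -(primB (lexx b) zZ yZ').
  by apply: eq_Rintegral => t _; rewrite -/y -/z; ring.
have Ha : y a * z1 a - z a * y1 a = 0.
  case/orP: al_neq0 => /mulfI; apply; rewrite mulr0.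
    have -> : al1 * (y a * z1 a - z a * y1 a) = (al1 * y a + al2 * y1 a) * z1 a - (al1 * z a + al2 * z1 a) * y1 a by ring.
    by rewrite ya za; ring.
  have -> : al2 * (y a * z1 a - z a * y1 a) = (al1 * z a + al2 * z1 a) * y a - (al1 * y a + al2 * y1 a) * z a by ring.
  by rewrite ya za; ring.
rewrite /eform X2E X2E' Z2E Z2E' -/y -/z.
have -> : I (fun t => Z.1 t * z t) b = I (fun t => y t * Z'.1 t) b +
    ((y b * z1 b - z b * y1 b) - (y a * z1 a - z a * y1 a)).
  by apply/eqP; rewrite -subr_eq0 -[X in _ == X](subrr (I (fun t => Z.1 t * z t) b - I (fun t => y t * Z'.1 t) b)) {2}H; apply/eqP; ring.
by rewrite Ha /rho; field; rewrite gt_eqF.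
Qed.

Definition enorm X := Num.sqrt (eform X X).
Lemma enorm_ge0 X : 0 <= enorm X. Proof. exact: sqrtr_ge0. Qed.
Lemma enorm_sqr X : in_realH X -> enorm X ^+ 2 = eform X X.
Proof. by move=> X2; rewrite sqr_sqrtr// eform_ge0. Qed.

(** [prim_abs_le] with [t] the inverse of [enorm X], or, if the norm vanishes, with [t = 2 ^+ n] for
    every [n]. *)
Lemma prim_abs_enorm X : in_realH X -> I (fun t => `|X.1 t|) b <= (1 + (b - a)) * enorm X.
Proof.
move=> X2; have [e0|en0] := eqVneq (enorm X) 0.
  rewrite e0 mulr0; apply: (@geometric_small _ (b - a)) => n.
  have t0 : (0 : R) < 2 ^+ n by rewrite exprn_gt0.
  have := prim_abs_le ab t0 X2.
  have := eform_fst X; rewrite -enorm_sqr// e0 expr0n/= => H.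
  have : 2 ^+ n * I (fun x => X.1 x ^+ 2) b <= 0 by rewrite pmulr_rle0.
  rewrite exprVn mulrC.
  have : 0 <= (2 ^+ n)^-1 * (b - a) by rewrite mulr_ge0 ?invr_ge0 ?(ltW t0)// subr_ge0 ltW.
  lra.
have ep : 0 < enorm X by rewrite lt_neqAle eq_sym en0 enorm_ge0.
have ip : 0 < (enorm X)^-1 by rewrite invr_gt0.
have := prim_abs_le ab ip X2; rewrite invrK.
have : (enorm X)^-1 * I (fun x => X.1 x ^+ 2) b <= enorm X.
  by rewrite mulrC ler_pdivrMr// -expr2 enorm_sqr//; exact: eform_fst.
have := mulr_ge0 (ltW ep) (_ : 0 <= b - a); rewrite subr_ge0 ltW// => /(_ isT).
have := ltW ep; lra.
Qed.

Lemma snd_le_enorm X : in_realH X -> `|X.2| <= (1 + rho) * enorm X.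
Proof.
move=> X2; rewrite -ler_sqr ?nnegrE ?mulr_ge0 ?enorm_ge0//; last by rewrite addr_ge0// ltW.
rewrite real_normK ?num_real// exprMn enorm_sqr//.
have := eform_snd X; rewrite ler_pdivrMr// => /le_trans; apply.
rewrite mulrC ler_wpM2r ?eform_ge0//; have := rho_gt0; have := sqr_ge0 rho; nra.
Qed.

Let r0 s x := q x - s.
Let mr0 s : measurable_fun J (r0 s).
Proof. by apply: measurable_funB => //; exact: measurable_cst. Qed.
Let r0Q s x : J x -> `|r0 s x| <= Q + `|s|.
Proof. by move=> Jx; apply: le_trans (ler_normB _ _) _; rewrite lerD2r qQ. Qed.

(** The shooting solutions: the initial data [al2], [- al1] satisfy the left boundary condition and
    do not both vanish. *)
Let phi_exists : exists p : R -> (R -> R) * (R -> R),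
  forall s, solves a b (r0 s) (fun=> 0) al2 (- al1) (p s).1 (p s).2.
Proof.
suff /choice[p pP] : forall s, exists p : (R -> R) * (R -> R),
    solves a b (r0 s) (fun=> 0) al2 (- al1) p.1 p.2 by exists p.
move=> s; have [y [y1 yP]] := solves_exists ab (mr0 s) (@r0Q s) al2 (- al1) (L1_cst ab 0).
by exists (y, y1).
Qed.

(** With the parameter moved to the right side, solutions for different [s] have the same
    coefficient [q] and can be subtracted. *)
Lemma solves_shift s g A B y y1 :
  solves a b (r0 s) g A B y y1 -> solves a b q (fun t => g t - s * y t) A B y y1.
Proof.
move=> [cy cy1 yE y1E]; split=> // x Jx; rewrite y1E//; congr (_ + _).
by apply: eq_Rintegral => t _; rewrite /r0; ring.
Qed.

(* The residual of the right boundary condition of (A - s) X = Z, up to sign. *)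
Let bres s (y y1 : R -> R) := - (be1 + s * bp1) * y b + (be2 + s * bp2) * y1 b.

(** If [y] vanishes, so do all integrals of [y1]; hence [y1] is 0 almost everywhere, and everywhere
    by continuity. *)
Let solves_null r A B y y1 : (forall x, J x -> y x = 0) ->
  solves a b r (fun=> 0) A B y y1 -> A = 0 /\ B = 0.
Proof.
move=> y0 [cy cy1 yE y1E].
have A0 : A = 0 by have := yE a Ja; rewrite prim_a addr0 y0.
have y11 := continuous_L1 ab cy1.
have y1ae : {ae mu, forall x, J x -> y1 x = 0}.
  by apply: (prim0_ae y11) => x Jx; have := yE x Jx; rewrite y0// A0 add0r.
have y10 : forall x, J x -> y1 x = 0.
  apply: (prim_sqr0_continuous ab cy1).
  transitivity (I (fun=> 0) b); last by rewrite prim_cst ?mul0r// ltW.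
  apply: (eq_prim_ae (lexx b)).
  - by apply: measurable_funX; exact: continuousJ_measurable.
  - exact: measurable_cst.
  - by apply: ae_imp y1ae => x /[apply] ->; rewrite expr0n.
by have := y1E a Ja; rewrite prim_a addr0 y10.
Qed.

Let solves_a r g A B y y1 : solves a b r g A B y y1 -> y a = A /\ y1 a = B.
Proof. by move=> [_ _ yE y1E]; split; rewrite (yE, y1E)// prim_a addr0. Qed.

(* If every s were an eigenvalue, the eigenfunctions for s and 0 would be orthogonal,
   although they are close for small s. *)
Let regular_point : exists s y y1,
  solves a b (r0 s) (fun=> 0) al2 (- al1) y y1 /\ bres s y y1 != 0.
Proof.
have [p pP] := phi_exists.
apply: contrapT => nex.
have p0 s : bres s (p s).1 (p s).2 = 0.
  by apply/eqP; apply: contrapT => /negP ps; apply: nex; exists s, (p s).1, (p s).2.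
have L0 := L1_cst ab (0 : R).
pose X s : realH := ((p s).1, bp1 * (p s).1 b - bp2 * (p s).2 b).
have XA s : Arel (X s) (s *: X s).
  have [pa pa1] := solves_a (pP s).
  exists (p s).2; rewrite /= pa pa1; split=> //.
  - have [cy cy1 yE y1E] := solves_shift (pP s); split=> // x Jx; rewrite y1E//; congr (_ + _).
    by apply: eq_Rintegral => t _; rewrite sub0r.
  - by ring.
  - rewrite -[s *: _]/(s * _); have := p0 s; rewrite /bres; lra.
have X2 s : in_realH (X s) := Arel_in_realH (XA s).
have ortho s : s != 0 -> eform (X s) (X 0) = 0.
  move=> s0; have := Arel_sym (in_realHZ s (X2 s)) (in_realHZ 0 (X2 0)) (XA s) (XA 0).
  rewrite eform_Z// [RHS]eform_sym eform_Z// mul0r => /eqP.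
  by rewrite mulf_eq0 (negbTE s0) => /eqP.
have X00 : eform (X 0) (X 0) <= 0.
  (* The Gronwall bound for the shooting solutions, uniform over [|s| <= 1], where the coefficient
     is at most [Q + 1]. *)
  pose M := 2 * (`|al2| + `|- al1|) * expR (2 * (1 + (Q + 1)) * (b - a)).
  have pM s x : `|s| <= 1 -> J x -> `|(p s).1 x| <= M.
    move=> s1 Jx; have r1 t : J t -> `|r0 s t| <= Q + 1.
      by move=> Jt; apply: le_trans (r0Q s Jt) _; rewrite lerD2l.
    have := solves_le ab (mr0 s) r1 L0 (pP s) Jx.
    rewrite (normr0 R) (prim_cst 0 (ltW ab)) mul0r.
    by rewrite addr0; apply: le_trans; rewrite lerDl.
  pose C := 2 * (M * (b - a)) * expR (2 * (1 + Q) * (b - a)).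
  (* The difference of the solutions for 0 and [s] has coefficient [q], zero initial data and right
     side [s] times the solution for [s], so Gronwall makes it of order [s]. *)
  have close s x : 0 <= s -> s <= 1 -> J x ->
      `|(p 0).1 x - (p s).1 x| + `|(p 0).2 x - (p s).2 x| <= s * C.
    move=> s0 s1 Jx; have [H0 Hs] := (solves_shift (pP 0), solves_shift (pP s)).
    have [c0 _ _ _] := pP 0; have [cs _ _ _] := pP s.
    have ps1 := continuous_L1 ab cs; have p01 := continuous_L1 ab c0.
    have L1s : L1i (fun t => 0 - s * (p s).1 t) by apply: L1B => //; exact: L1Z.
    have L10 : L1i (fun t => 0 - 0 * (p 0).1 t) by apply: L1B => //; exact: L1Z.
    have H := solves_ZD ab mq qQ (-1) L1s L10 Hs H0.
    have Lg : L1i (fun t => -1 * (0 - s * (p s).1 t) + (0 - 0 * (p 0).1 t)).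
      by apply: L1D => //; exact: L1Z.
    have := solves_le ab mq qQ Lg H Jx.
    have -> : -1 * al2 + al2 = 0 by ring.
    have -> : -1 * - al1 + - al1 = 0 by ring.
    have cE (u v : R) : -1 * u + v = v - u by ring.
    rewrite !cE normr0 !add0r => /le_trans; apply.
    apply: (@le_trans _ _ (2 * (s * M * (b - a)) * expR (2 * (1 + Q) * (b - a)))); last first.
      by rewrite le_eqVlt; apply/orP; left; apply/eqP; rewrite /C; ring.
    rewrite ler_wpM2r ?expR_ge0// ler_wpM2l// -(prim_cst (s * M) (ltW ab)).
    apply: (le_prim (lexx b)).
    - exact: L1_abs.
    - exact: L1_cst.
    - move=> t Jt; rewrite cE !sub0r mul0r oppr0 sub0r opprK normrM ger0_norm//.
      by rewrite ler_wpM2l// pM// ger0_norm.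
  have C0 : 0 <= C by have := close 1 a ler01 (lexx 1) Ja; rewrite mul1r; apply: le_trans; rewrite addr_ge0.
  pose D := C * I (fun t => `|(p 0).1 t|) b + (`|bp1| + `|bp2|) * C * `|(X 0).2| / rho.
  apply: (@geometric_small _ D) => n.
  set s : R := 2^-1 ^+ n.
  have s_gt0 : 0 < s by rewrite exprn_gt0.
  have s1 : s <= 1 by rewrite exprn_ile1//; lra.
  (* Orthogonality allows [X s] to be subtracted for free; what remains is of order
     [s = 2^-1 ^+ n]. *)
  have -> : eform (X 0) (X 0) = eform (-1 *: X s + X 0) (X 0).
    rewrite (eform_ZD (-1) (X2 s) (X2 0) (X2 0)) (ortho s); first by rewrite mulr0 add0r.
    by rewrite gt_eqF.
  have [c0 _ _ _] := pP 0; have p01 := continuous_L1 ab c0.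
  rewrite /eform/= [leRHS]mulrDl; apply: lerD.
    apply: le_trans (ler_norm _) _.
    have L2d : L2i (fun t => -1 *: (p s).1 t + (p 0).1 t) by exact: (in_realHZD (-1) (X2 s) (X2 0)).
    apply: le_trans (prim_abs (lexx b) (L2M L2d (X2 0))) _.
    rewrite mulrAC -(primZ _ (lexx b) (L1_abs p01)); apply: le_prim => //.
    - by apply: L1_abs; apply: L2M => //; exact: X2.
    - by apply: L1Z; exact: L1_abs.
    move=> t Jt; rewrite normrM ler_wpM2r// scaleN1r addrC mulrC.
    by apply: le_trans (close s t (ltW s_gt0) s1 Jt); rewrite lerDl.
  rewrite [leRHS]mulrAC ler_wpM2r ?invr_ge0 ?(ltW rho_gt0)//.
  rewrite [leRHS]mulrAC; apply: le_trans (ler_norm _) _; rewrite normrM ler_wpM2r//.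
  have := close s b (ltW s_gt0) s1 Jb.
  set u := (p 0).1 b - (p s).1 b; set v := (p 0).2 b - (p s).2 b => uv.
  rewrite [X in `|X|](_ : _ = bp1 * u - bp2 * v); last by rewrite scaleN1r /u /v; ring.
  apply: le_trans (ler_normB _ _) _; rewrite !normrM.
  have hu : `|u| <= s * C by apply: le_trans uv; rewrite lerDl.
  have hv : `|v| <= s * C by apply: le_trans uv; rewrite lerDr.
  rewrite -mulrA [C * s]mulrC mulrDl; apply: lerD; exact: ler_wpM2l.
have y0 x : J x -> (p 0).1 x = 0.
  have [cy _ _ _] := pP 0; apply: (prim_sqr0_continuous ab cy).
  apply/eqP; rewrite eq_le; apply/andP; split; first by apply: le_trans (eform_fst (X 0)) X00.
  by apply: prim_ge0 => // t _; exact: sqr_ge0.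
have [al20 /eqP] := solves_null y0 (pP 0).
by rewrite oppr_eq0 => al10; move: al_neq0; rewrite al10 al20 eqxx.
Qed.

(** [K Z] solves [(A - s) X = Z]: a particular solution with zero initial data plus a multiple of
    the shooting solution, which corrects the right boundary condition because [s] is not an
    eigenvalue. [K] is picked by choice, so only these properties of it are available later. *)
Theorem resolvent_exists : exists s C (K : realH -> realH), 0 <= C /\ forall Z, in_realH Z ->
  [/\ Arel (K Z) (Z + s *: K Z),
      forall x, J x -> `|(K Z).1 x| <= C * enorm Z,
      forall x x', J x -> J x' -> `|(K Z).1 x - (K Z).1 x'| <= C * enorm Z * `|x - x'|
    & `|(K Z).2| <= C * enorm Z].
Proof.
have [s [f [f1 [fP w0]]]] := regular_point.
set w := bres s f f1 in w0.
pose ex := expR (2 * (1 + (Q + `|s|)) * (b - a)).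
have ex0 : 0 <= ex := expR_ge0 _.
have L0 := L1_cst ab (0 : R).
have ba0 : 0 <= b - a by rewrite subr_ge0 ltW.
have [cf cf1 _ _] := fP.
have [Mf fM] := bounded_continuousJ cf; have [Mf1 f1M] := bounded_continuousJ cf1.
have Mf0 : 0 <= Mf := le_trans (normr_ge0 _) (fM a Ja).
have Mf10 : 0 <= Mf1 := le_trans (normr_ge0 _) (f1M a Ja).
(* [C1] bounds the particular solution, [C2] the boundary residual, [C3] the multiplier [c], [C4]
   the corrected solution with its derivative, and [C5] also the scalar component, each relative to
   [enorm Z]. *)
pose C1 := 2 * (1 + (b - a)) * ex.
have C10 : 0 <= C1 by rewrite !mulr_ge0// addr_ge0.
pose C2 := `|be1 + s * bp1| + `|be2 + s * bp2|.
have C20 : 0 <= C2 by rewrite addr_ge0.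
pose C3 := (1 + rho + C2 * C1) / `|w|.
have C30 : 0 <= C3.
  by apply: divr_ge0 => //; apply: addr_ge0; [rewrite addr_ge0// ltW|exact: mulr_ge0].
pose C4 := C3 * (Mf + Mf1) + C1.
have C40 : 0 <= C4 by rewrite addr_ge0// mulr_ge0// addr_ge0.
pose C5 := C4 + (`|bp1| + `|bp2|) * C4.
have C45 : C4 <= C5 by rewrite lerDl mulr_ge0// addr_ge0.
suff /choice[K KP] Z : exists X, in_realH Z ->
  [/\ Arel X (Z + s *: X),
      forall x, J x -> `|X.1 x| <= C5 * enorm Z,
      forall x x', J x -> J x' -> `|X.1 x - X.1 x'| <= C5 * enorm Z * `|x - x'|
    & `|X.2| <= C5 * enorm Z].
  by exists s, C5, K; split=> //; exact: le_trans C45.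
have [Z2|] := pselect (in_realH Z); last by exists 0.
have n0 := enorm_ge0 Z.
have Z1 := L2_L1 ab Z2.
have Z1N : L1i (fun t => - Z.1 t).
  by have := L1Z (-1) Z1; apply: L1_eq => t _; rewrite mulN1r.
have [y [y1 yP]] := solves_exists ab (mr0 s) (@r0Q s) 0 0 Z1N.
have yb x : J x -> `|y x| + `|y1 x| <= C1 * enorm Z.
  move=> Jx; have := solves_le ab (mr0 s) (@r0Q s) Z1N yP Jx.
  move/le_trans; apply; rewrite normr0 !add0r -/ex /C1 [leRHS]mulrAC ler_wpM2r//.
  rewrite -mulrA ler_wpM2l//.
  have -> : I (fun t => `|- Z.1 t|) b = I (fun t => `|Z.1 t|) b.
    by apply: eq_Rintegral => t _; rewrite normrN.
  exact: prim_abs_enorm.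
have bresb : `|bres s y y1| <= C2 * C1 * enorm Z.
  apply: le_trans (ler_normD _ _) _; rewrite !normrM normrN -mulrA mulrDl.
  have := yb b Jb => H; apply: lerD; apply: ler_wpM2l => //; apply: le_trans H.
    by rewrite lerDl.
  by rewrite lerDr.
(* The residual is linear, so this [c] makes that of [c * f + y] equal to [Z.2], which is the scalar
   part of the equation. *)
pose c := (Z.2 - bres s y y1) / w.
have cb : `|c| <= C3 * enorm Z.
  rewrite normrM normfV /C3 mulrAC ler_wpM2r ?invr_ge0// [leRHS]mulrDl.
  by apply: le_trans (ler_normB _ _) _; apply: lerD => //; exact: snd_le_enorm.
have XP := solves_ZD ab (mr0 s) (@r0Q s) c L0 Z1N fP yP.
set z := (fun t => c * f t + y t) in XP; set z1 := (fun t => c * f1 t + y1 t) in XP.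
have zb x : J x -> `|z x| + `|z1 x| <= C4 * enorm Z.
  move=> Jx; rewrite /z /z1 /C4 [leRHS]mulrDl.
  have h1 : `|c * f x| <= C3 * enorm Z * Mf by rewrite normrM ler_pM// fM.
  have h2 : `|c * f1 x| <= C3 * enorm Z * Mf1 by rewrite normrM ler_pM// f1M.
  have := yb x Jx; have := ler_normD (c * f x) (y x); have := ler_normD (c * f1 x) (y1 x).
  rewrite -[C3 * _ * enorm Z]mulrA [(Mf + _) * _]mulrC mulrA mulrDr; lra.
exists (z, bp1 * z b - bp2 * z1 b) => _; split.
- have [za z1a] := solves_a XP.
  exists z1; rewrite /= za z1a; split=> //.
  + have [cz cz1 zE z1E] := solves_shift XP; split=> // x Jx; rewrite z1E//; congr (_ + _).
    apply: eq_Rintegral => t _; transitivity (q t * z t + - (Z.1 t + s * z t)); [ring|by []].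
  + ring.
  + have : bres s z z1 = Z.2.
      rewrite (_ : bres s z z1 = c * w + bres s y y1); last by rewrite /bres /w /bres /z /z1; ring.
      by rewrite /c divfK// subrK.
    rewrite -[s *: _]/(s * _) /bres => <-; ring.
- move=> x Jx; apply: le_trans (ler_wpM2r n0 C45); apply: le_trans (zb x Jx).
  by rewrite lerDl.
- move=> x x' Jx Jx'; have [_ cz1 zE _] := XP; rewrite /= [z x]zE// [z x']zE//.
  rewrite opprD addrACA subrr add0r.
  apply: (prim_lip ab) => //; first exact: (continuous_L1 ab).
  move=> t Jt; apply: le_trans (ler_wpM2r n0 C45); apply: le_trans (zb t Jt).
  by rewrite lerDr.
- rewrite /=; have := zb b Jb => H; apply: le_trans (ler_normB _ _) _; rewrite !normrM.
  have h1 : `|z b| <= C4 * enorm Z by apply: le_trans H; rewrite lerDl.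
  have h2 : `|z1 b| <= C4 * enorm Z by apply: le_trans H; rewrite lerDr.
  have -> : C5 * enorm Z = C4 * enorm Z + (`|bp1| * (C4 * enorm Z) + `|bp2| * (C4 * enorm Z)).
    by rewrite /C5; ring.
  apply: (@le_trans _ _ (0 + (`|bp1| * (C4 * enorm Z) + `|bp2| * (C4 * enorm Z)))).
    by rewrite add0r; apply: lerD; exact: ler_wpM2l.
  by rewrite lerD2r mulr_ge0.
Qed.

Lemma eform_null X : in_realH X -> eform X X = 0 ->
  {ae mu, forall x, J x -> X.1 x = 0} /\ X.2 = 0.
Proof.
move=> X2 X0; have I0 : I (fun t => X.1 t ^+ 2) b = 0.
  apply/eqP; rewrite eq_le -{1}X0 eform_fst/=; apply: prim_ge0 => // t _; exact: sqr_ge0.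
have [mX XX] := X2; split.
  have : {ae mu, forall x, J x -> X.1 x ^+ 2 = 0}.
    apply: (prim0_ae XX) => x /=; rewrite in_itv/= => /andP[ax xb].
    apply/eqP; rewrite eq_le -{1}I0; apply/andP; split.
      by apply: (prim_le XX) => // t _; exact: sqr_ge0.
    by apply: (prim_ge0 xb) => t _; exact: sqr_ge0.
  by apply: ae_imp => x /[apply] /eqP; rewrite expf_eq0 => /eqP.
have := eform_snd X; rewrite X0 pmulr_lle0 ?invr_gt0// => H.
by apply/eqP; rewrite -[_ == _](expf_eq0 X.2 2) eq_le H sqr_ge0.
Qed.

(** The hypotheses say that [X + i Y] is an eigenvector for [lam + i t]; pairing the first equation
    with [Y] and the second with [X] is the usual proof that [t = 0] unless the vector is null. *)
Lemma Arel_pair_real X Y lam t : Arel X (lam *: X - t *: Y) -> Arel Y (lam *: Y + t *: X) ->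
  t * (eform X X + eform Y Y) = 0.
Proof.
move=> AX AY; have [X2 Y2] := (Arel_in_realH AX, Arel_in_realH AY).
have iZ k Z := @in_realHZ k Z.
have i1 : in_realH (lam *: X - t *: Y) by rewrite -scaleNr; apply: in_realHZD => //; exact: iZ.
have i2 : in_realH (lam *: Y + t *: X) by apply: in_realHZD => //; exact: iZ.
have := Arel_sym i1 i2 AX AY.
rewrite -scaleNr (eform_ZD lam X2 (iZ (- t) _ Y2) Y2) [RHS]eform_sym (eform_ZD lam Y2 (iZ t _ X2) X2).
rewrite !eform_Z// (eform_sym Y X); lra.
Qed.

Lemma eform_complete (g : nat -> realH) : (forall n, in_realH (g n)) ->
  (forall e : R, 0 < e -> exists m, forall i j, (m <= i)%N -> (m <= j)%N ->
    eform (g i - g j) (g i - g j) <= e) ->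
  exists2 Y, in_realH Y & forall e : R, 0 < e -> exists m, forall i, (m <= i)%N ->
    eform (g i - Y) (g i - Y) <= e.
Proof.
move=> g2 gC.
have [n|e e0|f f2 fP] := @Riesz_Fischer R a b ab (fun n => (g n).1).
- exact: g2.
- have [m mP] := gC e e0; exists m => i j mi mj.
  exact: le_trans (eform_fst (g i - g j)) (mP i j mi mj).
have : cvgn (fun n => (g n).2).
  apply/cauchy_cvgP/cauchy_exP => e e0.
  have [|m mP] := gC ((e / 2) ^+ 2 / rho); first by rewrite divr_gt0// exprn_gt0// divr_gt0.
  exists (g m).2; exists m => // n /= mn; rewrite /ball/=.
  have := le_trans (eform_snd (g m - g n)) (mP m n (leqnn m) mn).
  rewrite ler_pM2r ?invr_gt0// -[X in X <= _]real_normK ?num_real//.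
  rewrite ler_sqr ?nnegrE//; last by rewrite divr_ge0// ltW.
  rewrite -[(g m - g n).2]/((g m).2 - (g n).2); lra.
move=> /cvg_ex[c /= cP]; exists (f, c) => // e e0.
have e20 : 0 < e / 2 by rewrite divr_gt0.
have [m mP] := fP _ e20.
pose d := Num.sqrt (e / 2 * rho).
have d0 : 0 < d by rewrite sqrtr_gt0 mulr_gt0.
have dE : d ^+ 2 = e / 2 * rho by rewrite sqr_sqrtr// ltW// mulr_gt0.
have /cvgrPdist_le/(_ _ d0)[m' _ m'P] := cP.
exists (maxn m m') => i; rewrite geq_max => /andP[mi mi'].
rewrite [leRHS](splitr e); apply: lerD; first exact: mP.
rewrite ler_pdivrMr// -expr2 -dE -real_normK ?num_real// ler_sqr ?nnegrE ?(ltW d0)//.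
by rewrite -normrN opprB; exact: m'P.
Qed.

(* A pair is an element of the complex space, given by its real and imaginary parts. *)
Definition pairH : lmodType R := (realH * realH)%type.
Implicit Types W : pairH.
Definition in_pairH W := in_realH W.1 /\ in_realH W.2.
Definition vform W W' := eform W.1 W'.1 + eform W.2 W'.2.

Lemma in_pairH_0 : in_pairH 0. Proof. by split; exact: in_realH0. Qed.
Lemma in_pairH_ZD k W W' : in_pairH W -> in_pairH W' -> in_pairH (k *: W + W').
Proof. by move=> [? ?] [? ?]; split; exact: in_realHZD. Qed.
Lemma vform_sym W W' : vform W W' = vform W' W.
Proof. by rewrite /vform eform_sym [eform W.2 _]eform_sym. Qed.
Lemma vform_ZD k W W' W'' : in_pairH W -> in_pairH W' -> in_pairH W'' ->
  vform (k *: W + W') W'' = k * vform W W'' + vform W' W''.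
Proof.
move=> [? ?] [? ?] [? ?]; rewrite /vform/= !eform_ZD//; ring.
Qed.
Lemma vform_ge0 W : in_pairH W -> 0 <= vform W W.
Proof. by move=> [? ?]; apply: addr_ge0; exact: eform_ge0. Qed.

Lemma vform_cvg_norm (T : Type) (U : set_system T) {FU : Filter U} (g : T -> pairH) :
  eform (g t).1 (g t).1 @[t --> U] --> 0 -> eform (g t).2 (g t).2 @[t --> U] --> 0 ->
  seminorm vform (g t) @[t --> U] --> 0.
Proof.
move=> g1 g2; rewrite -sqrtr0.
apply: (@continuous_cvg _ _ _ _ _ (fun t => vform (g t) (g t)) (fun x : R => Num.sqrt x)).
  exact: sqrt_continuous.
by rewrite -[X in _ --> X]addr0; exact: cvgD.
Qed.

Lemma vform_complete (g : nat -> pairH) : (forall n, in_pairH (g n)) ->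
  (forall e : R, 0 < e -> exists m, forall i j, (m <= i)%N -> (m <= j)%N ->
    seminorm vform (g i - g j) <= e) ->
  exists2 y, in_pairH y & seminorm vform (g n - y) @[n --> \oo] --> 0.
Proof.
move=> gV gC.
have gB i j : in_pairH (g i - g j) by rewrite addrC -scaleN1r; exact: in_pairH_ZD.
have H (e : R) : 0 < e -> exists m, forall i j, (m <= i)%N -> (m <= j)%N ->
    vform (g i - g j) (g i - g j) <= e.
  move=> e0; have [|m mP] := gC (Num.sqrt e); first by rewrite sqrtr_gt0.
  exists m => i j mi mj; have := mP i j mi mj.
  by rewrite /seminorm ler_sqrt// ltW.
have le1 W : in_pairH W -> eform W.1 W.1 <= vform W W.
  by move=> [_ W2]; rewrite lerDl eform_ge0.
have le2 W : in_pairH W -> eform W.2 W.2 <= vform W W.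
  by move=> [W1 _]; rewrite lerDr eform_ge0.
have [n|e e0|Y1 Y12 Y1P] := @eform_complete (fun n => (g n).1).
- by case: (gV n).
- have [m mP] := H e e0; exists m => i j mi mj; exact: le_trans (le1 _ (gB i j)) (mP i j mi mj).
have [n|e e0|Y2 Y22 Y2P] := @eform_complete (fun n => (g n).2).
- by case: (gV n).
- have [m mP] := H e e0; exists m => i j mi mj; exact: le_trans (le2 _ (gB i j)) (mP i j mi mj).
have BE X Y : in_realH X -> in_realH Y -> in_realH (X - Y).
  by move=> X2 Y2_; rewrite addrC -scaleN1r; exact: in_realHZD.
exists (Y1, Y2) => //; apply: vform_cvg_norm => /=.
- apply/cvgr0Pnorm_le => e e0; have [m mP] := Y1P e e0; exists m => // i /= mi.
  by rewrite ger0_norm ?mP// eform_ge0//; apply: BE => //; case: (gV i).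
- apply/cvgr0Pnorm_le => e e0; have [m mP] := Y2P e e0; exists m => // i /= mi.
  by rewrite ger0_norm ?mP// eform_ge0//; apply: BE => //; case: (gV i).
Qed.

(** * Symmetry, injectivity and compactness of the resolvent *)

Section Resolvent.
Variables (s C : R) (K : realH -> realH).
Hypothesis C0 : 0 <= C.
Hypothesis KA : forall Z, in_realH Z -> Arel (K Z) (Z + s *: K Z).
Hypothesis Kle : forall Z, in_realH Z -> forall x, J x -> `|(K Z).1 x| <= C * enorm Z.
Hypothesis Klip : forall Z, in_realH Z -> forall x x', J x -> J x' ->
  `|(K Z).1 x - (K Z).1 x'| <= C * enorm Z * `|x - x'|.
Hypothesis Ksnd : forall Z, in_realH Z -> `|(K Z).2| <= C * enorm Z.

Let KE Z : in_realH Z -> in_realH (K Z). Proof. by move=> Z2; exact: Arel_in_realH (KA Z2). Qed.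
Let KAE Z : in_realH Z -> in_realH (Z + s *: K Z).
Proof. by move=> Z2; rewrite addrC; apply: in_realHZD => //; exact: KE. Qed.

Let K_sym Z Z' : in_realH Z -> in_realH Z' -> eform (K Z) Z' = eform Z (K Z').
Proof.
move=> Z2 Z2'; have := Arel_sym (KAE Z2) (KAE Z2') (KA Z2) (KA Z2').
have [K2 K2'] := (KE Z2, KE Z2').
have HH X Y : in_realH X -> in_realH Y -> eform (X + s *: K X) Y = s * eform (K X) Y + eform X Y.
  by move=> X2 Y2; rewrite addrC eform_ZD//; exact: KE.
rewrite HH// [RHS]eform_sym HH// (eform_sym (K Z') (K Z)) (eform_sym Z' (K Z)); lra.
Qed.

Let K_bnd Z : in_realH Z -> eform (K Z) (K Z) <= ((b - a) + rho^-1) * C ^+ 2 * eform Z Z.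
Proof.
move=> Z2; have K2 := KE Z2.
rewrite -(enorm_sqr Z2) -mulrA -exprMn mulrDl; apply: lerD.
  rewrite mulrC -(prim_cst _ (ltW ab)); apply: (le_prim (lexx b)).
  - exact: L2M.
  - exact: L1_cst.
  move=> t Jt; rewrite -expr2 -real_normK ?num_real// ler_sqr ?nnegrE ?mulr_ge0 ?enorm_ge0//.
  exact: Kle.
rewrite mulrC ler_wpM2l ?invr_ge0 ?(ltW rho_gt0)//.
rewrite -expr2 -real_normK ?num_real// ler_sqr ?nnegrE ?mulr_ge0 ?enorm_ge0//.
exact: Ksnd.
Qed.

(** A null [K Z] vanishes at every point by continuity, and so does its derivative; the equation
    then says that the primitive of [Z.1] is 0, and the right boundary condition that [Z.2] is 0. *)
Let K_inj Z : in_realH Z -> eform (K Z) (K Z) = 0 -> eform Z Z = 0.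
Proof.
move=> Z2 KZ0; have K2 := KE Z2; have [KZae KZ2] := eform_null K2 KZ0.
have [y1 [[cy cy1 yE y1E] _ X2E Z2E]] := KA Z2.
have KZ1 x : J x -> (K Z).1 x = 0.
  apply: (prim_sqr0_continuous ab cy); apply/eqP; rewrite eq_le -{1}KZ0 eform_fst/=.
  by apply: prim_ge0 => // t _; exact: sqr_ge0.
have y11 := continuous_L1 ab cy1.
have y1ae : {ae mu, forall x, J x -> y1 x = 0}.
  by apply: (prim0_ae y11) => x Jx; have := yE x Jx; rewrite !KZ1// add0r.
have y10 x : J x -> y1 x = 0.
  apply: (prim_sqr0_continuous ab cy1).
  transitivity (I (fun=> 0) b); last by rewrite prim_cst ?mul0r// ltW.
  apply: (eq_prim_ae (lexx b)).
  - by apply: measurable_funX; exact: continuousJ_measurable.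
  - exact: measurable_cst.
  - by apply: ae_imp y1ae => z /[apply] ->; rewrite expr0n.
have Z1 := L2_L1 ab Z2.
have Zae : {ae mu, forall x, J x -> Z.1 x = 0}.
  apply: (prim0_ae Z1) => x Jx; have := y1E x Jx; rewrite !y10// add0r.
  have -> : I (fun t => q t * (K Z).1 t + - (Z + s *: K Z).1 t) x = I (fun t => -1 * Z.1 t) x.
    have xb : x <= b by move: Jx; rewrite /= in_itv/= => /andP[].
    apply: (eq_prim xb) => t Jt.
    rewrite -[(Z + s *: K Z).1 t]/(Z.1 t + s * (K Z).1 t) KZ1//; ring.
  have xb : x <= b by move: Jx; rewrite /= in_itv/= => /andP[].
  rewrite (primZ _ xb Z1); lra.
have Z20 : Z.2 = 0.
  move: Z2E; rewrite -[(Z + s *: K Z).2]/(Z.2 + s * (K Z).2) KZ2 mulr0 addr0 => ->.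
  by rewrite KZ1// y10// !mulr0 subrr oppr0.
rewrite /eform Z20 mulr0 mul0r addr0; have [mZ _] := Z2.
transitivity (I (fun=> 0) b); last by rewrite prim_cst ?mul0r// ltW.
apply: (eq_prim_ae (lexx b)).
- exact: measurable_funM.
- exact: measurable_cst.
- by apply: ae_imp Zae => z /[apply] ->; rewrite mulr0.
Qed.

Let ultra_bounded_cvg (U : set_system nat) (u : nat -> R) M : UltraFilter U ->
  (forall n, `|u n| <= M) -> exists l : R, u n @[n --> U] --> l.
Proof.
move=> UU uM; have UP : ProperFilter U by exact: ultra_proper.
have uI : (u n @[n --> U]) `[(- M)%R, M]%classic.
  by apply: nearW => n; rewrite /= in_itv/= -ler_norml.
have [l [_ lc]] := @segment_compact R (- M) M _ (fmap_proper_filter u UP) uI.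
exists l => B nB; have [//|H] := in_ultra_setVsetC (u @^-1` B) UU.
by have [x [/= nBx Bx]] := lc (~` B) B H nB.
Qed.

(** Arzela-Ascoli by ultrafilters: bounded values converge pointwise along [U], the limit inherits
    the Lipschitz constant, and convergence on a finite grid becomes uniform convergence. *)
Let K_cpt (g : nat -> realH) : (forall n, in_realH (g n) /\ enorm (g n) <= 1) ->
  forall U : set_system nat, UltraFilter U ->
  exists2 Y, in_realH Y & eform (K (g n) - Y) (K (g n) - Y) @[n --> U] --> 0.
Proof.
move=> gP U UU; have UP : ProperFilter U by exact: ultra_proper.
have g2 n : in_realH (g n) by case: (gP n).
have gC n : C * enorm (g n) <= C by rewrite ler_piMr//; case: (gP n).
have /choice[l lP] x : exists l : R, J x -> (K (g n)).1 x @[n --> U] --> l.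
  have [Jx|] := pselect (J x); last by exists 0.
  have x_le n : `|(K (g n)).1 x| <= C by apply: le_trans (gC n); exact: Kle.
  by have [l lx] := ultra_bounded_cvg UU x_le; exists l.
have c_le n : `|(K (g n)).2| <= C by apply: le_trans (gC n); exact: Ksnd.
have [c cP] := ultra_bounded_cvg UU c_le.
have glip n x x' : J x -> J x' -> `|(K (g n)).1 x - (K (g n)).1 x'| <= C * `|x - x'|.
  by move=> Jx Jx'; apply: le_trans (Klip (g2 n) Jx Jx') _; rewrite ler_wpM2r.
have llip x x' : J x -> J x' -> `|l x - l x'| <= C * `|x - x'|.
  move=> Jx Jx'; have H : `|(K (g n)).1 x - (K (g n)).1 x'| @[n --> U] --> `|l x - l x'|.
    by apply: cvg_norm; apply: cvgB; exact: lP.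
  by apply: (ler_cvg_to H (cvg_cst (C * `|x - x'|))); apply: nearW => n; exact: glip.
have cl : {within J, continuous l}.
  apply/subspace_continuousP => x Jx; apply/cvgrPdist_le => e e0.
  have C10 : 0 < C + 1 by rewrite ltr_wpDl.
  rewrite near_withinE; apply/nbhs_ballP; exists (e / (C + 1)) => /=; first by rewrite divr_gt0.
  move=> t /=; rewrite /ball/= ltr_pdivlMr// => te Jt; apply: le_trans (llip _ _ Jx Jt) _.
  by apply: le_trans (ltW te); rewrite mulrC ler_wpM2l// lerDl.
exists (l, c); first exact: L2_continuous.
have unif (e : R) : 0 < e -> \forall n \near U, forall x, J x -> `|(K (g n)).1 x - l x| <= e.
  move=> e0; have e30 : 0 < e / 3 by rewrite divr_gt0.
  have ba0 : 0 < b - a by rewrite subr_gt0.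
  have X0 : 0 <= C * (b - a) / (e / 3) by rewrite divr_ge0 ?mulr_ge0// ltW.
  (* [N.+1] is the number of subintervals, large enough for the Lipschitz variation over one step
     [h] to be at most [e / 3]; hence [N.+2] grid points. *)
  have /andP[_ NP] := truncn_itv X0; set N := Num.truncn _ in NP.
  pose h := (b - a) / N.+1%:R; have h0 : 0 < h by rewrite divr_gt0.
  have Ch : C * h <= e / 3.
    by rewrite /h mulrA ler_pdivrMr// [leRHS]mulrC -ler_pdivrMr// ltW.
  pose t (i : 'I_N.+2) := a + i%:R * h.
  have Jt i : J (t i).
    rewrite /= in_itv/= lerDl mulr_ge0 ?(ltW h0)//=.
    rewrite -lerBrDl (_ : b - a = N.+1%:R * h); last by rewrite /h mulrC divfK.
    by rewrite ler_wpM2r ?(ltW h0)// ler_nat -ltnS ltn_ord.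
  have : \forall n \near U, forall i, `|(K (g n)).1 (t i) - l (t i)| <= e / 3.
    apply: filter_forall => i; have /cvgrPdist_le/(_ _ e30) := lP _ (Jt i).
    by apply: filterS => n; rewrite distrC.
  apply: filterS => n H x Jx.
  have /andP[ax xb] : a <= x <= b by move: Jx; rewrite /= in_itv.
  have Y0 : 0 <= (x - a) / h by rewrite divr_ge0 ?subr_ge0// ltW.
  have /andP[iP1 iP2] := truncn_itv Y0.
  (* The grid point just to the left of [x]; for [x = b] it is the last one. *)
  have iN : (Num.truncn ((x - a) / h) < N.+2)%N.
    rewrite ltnS -(ler_nat R); apply: le_trans iP1 _; rewrite ler_pdivrMr//.
    by rewrite /h mulrC divfK// lerD2r.
  have := H (Ordinal iN); set i := Ordinal iN => Hi.
  have xt : `|x - t i| <= h.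
    move: iP1 iP2; rewrite ler_pdivlMr// ltr_pdivrMr// -[Num.truncn _]/(nat_of_ord i) /t.
    rewrite -natr1 mulrDl mul1r ler_norml => H1 H2; apply/andP; split; lra.
  have xte : C * `|x - t i| <= e / 3 by apply: le_trans Ch; exact: ler_wpM2l.
  have g1 := le_trans (glip n _ _ Jx (Jt i)) xte.
  have l1 := le_trans (llip _ _ Jx (Jt i)) xte.
  rewrite (_ : _ - _ = ((K (g n)).1 x - (K (g n)).1 (t i)) +
     (((K (g n)).1 (t i) - l (t i)) - (l x - l (t i)))); last by ring.
  apply: le_trans (ler_normD _ _) _.
  have := ler_normB ((K (g n)).1 (t i) - l (t i)) (l x - l (t i)); lra.
apply/cvgr0Pnorm_le => e e0.
have k0 : 0 < (b - a) + rho^-1 by rewrite addr_gt0 ?subr_gt0// invr_gt0.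
pose d := Num.sqrt (e / ((b - a) + rho^-1)).
have d0 : 0 < d by rewrite sqrtr_gt0 divr_gt0.
have dE : d ^+ 2 = e / ((b - a) + rho^-1) by rewrite sqr_sqrtr// ltW// divr_gt0.
have /cvgrPdist_le/(_ _ d0) := cP.
apply: filterS2 (unif d d0) => n yd cd.
have Y2 : in_realH (l, c) by exact: L2_continuous.
have D2 : in_realH (K (g n) - (l, c)).
  by rewrite addrC -scaleN1r; apply: in_realHZD => //; exact: KE.
rewrite ger0_norm ?eform_ge0//.
rewrite (_ : e = d ^+ 2 * (b - a) + d ^+ 2 / rho); last first.
  by rewrite -mulrDr dE divfK// gt_eqF.
apply: lerD.
  rewrite -(prim_cst _ (ltW ab)); apply: (le_prim (lexx b)).
  - exact: L2M.
  - exact: L1_cst.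
  move=> x Jx; rewrite -expr2 -real_normK ?num_real// ler_sqr ?nnegrE ?(ltW d0)//.
  exact: yd.
rewrite ler_wpM2r ?invr_ge0 ?(ltW rho_gt0)//.
rewrite -expr2 -real_normK ?num_real// ler_sqr ?nnegrE ?(ltW d0)//.
by rewrite -normrN opprB.
Qed.

(** From [A (K y) = y + s K y] and [y = k^-1 K y] almost everywhere. The eigenvector is stated to be
    [K y] because [y] itself is determined only up to null functions and need not satisfy the
    integral equations. *)
Let K_eigen y k : in_realH y -> k != 0 -> eform (K y - k *: y) (K y - k *: y) = 0 ->
  Arel (K y) ((k^-1 + s) *: K y).
Proof.
move=> y2 k0 H; have Ky2 := KE y2.
have D2 : in_realH (K y - k *: y) by rewrite addrC -scaleNr; exact: in_realHZD.
have [Dae D20] := eform_null D2 H.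
have [y1 [[cy cy1 yE y1E] ya X2E Z2E]] := KA y2.
exists y1; split=> //; last first.
  rewrite -Z2E -[((k^-1 + s) *: K y).2]/((k^-1 + s) * (K y).2) -[(y + s *: K y).2]/(y.2 + s * (K y).2).
  rewrite mulrDl; congr (_ + _); move: D20; rewrite -[(K y - k *: y).2]/((K y).2 - k * y.2).
  by move/eqP; rewrite subr_eq0 => /eqP ->; rewrite mulrA mulVf ?mul1r.
split=> // x Jx; rewrite {1}y1E//; congr (_ + _).
have xb : x <= b by move: Jx; rewrite /= in_itv/= => /andP[].
have qK : measurable_fun J (fun t => q t * (K y).1 t) by apply: measurable_funM => //; case: Ky2.
apply: (eq_prim_ae xb).
- apply: measurable_funB => //; by case: (KAE y2).
- apply: measurable_funB => //; by case: (in_realHZ (k^-1 + s) Ky2).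
- apply: ae_imp Dae => t /[apply].
  rewrite -[(K y - k *: y).1 t]/((K y).1 t - k * y.1 t) => /eqP; rewrite subr_eq0 => /eqP yt.
  rewrite -[(y + s *: K y).1 t]/(y.1 t + s * (K y).1 t) -[((k^-1 + s) *: K y).1 t]/((k^-1 + s) * (K y).1 t) yt.
  by field.
Qed.

Let KV W : pairH := (K W.1, K W.2).

Lemma expansion_of_resolvent (e : nat -> pairH) : (forall n, in_pairH (e n)) ->
  (forall i j, vform (e i) (e j) = (i == j)%:R) ->
  (forall n, exists lam W, [/\ Arel W.1 (lam *: W.1), Arel W.2 (lam *: W.2) &
     forall W', in_pairH W' -> vform W' (e n) = vform W' W]) ->
  (forall W lam, Arel W.1 (lam *: W.1) -> Arel W.2 (lam *: W.2) ->
     (forall n, vform W (e n) = 0) -> vform W W = 0) ->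
  forall F, in_pairH F ->
    seminorm vform (F - \sum_(n < N) vform F (e n) *: e n) @[N --> \oo] --> 0.
Proof.
move=> eV eon eeig emax.
have KVV W : in_pairH W -> in_pairH (KV W) by move=> [? ?]; split; exact: KE.
have KVsym W W' : in_pairH W -> in_pairH W' -> vform (KV W) W' = vform W (KV W').
  by move=> [? ?] [? ?]; rewrite /vform !K_sym.
pose M := ((b - a) + rho^-1) * C ^+ 2.
have M0 : 0 <= M.
  by rewrite mulr_ge0 ?sqr_ge0// addr_ge0 ?invr_ge0 ?(ltW rho_gt0)// subr_ge0 ltW.
have KVbnd W : in_pairH W -> seminorm vform (KV W) <= Num.sqrt M * seminorm vform W.
  move=> WV; have [? ?] := WV; rewrite /seminorm -sqrtrM//; apply: ler_wsqrtr.
  by rewrite /vform mulrDr; apply: lerD; exact: K_bnd.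
have KVcpt (g : nat -> pairH) : (forall n, in_pairH (g n) /\ seminorm vform (g n) <= 1) ->
    forall U : set_system nat, UltraFilter U ->
    exists2 y, in_pairH y & seminorm vform (KV (g n) - y) @[n --> U] --> 0.
  move=> gP U UU; have UP : ProperFilter U by exact: ultra_proper.
  have g1 n : in_realH (g n).1 /\ enorm (g n).1 <= 1.
    have [[h1 h2] h3] := gP n; split=> //; apply: le_trans h3; apply: ler_wsqrtr.
    by rewrite lerDl eform_ge0.
  have g2 n : in_realH (g n).2 /\ enorm (g n).2 <= 1.
    have [[h1 h2] h3] := gP n; split=> //; apply: le_trans h3; apply: ler_wsqrtr.
    by rewrite lerDr eform_ge0.
  have [Y1 Y12 Y1P] := K_cpt g1 UU; have [Y2 Y22 Y2P] := K_cpt g2 UU.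
  by exists (Y1, Y2) => //; exact: vform_cvg_norm.
have KVinj W : in_pairH W -> vform (KV W) (KV W) = 0 -> vform W W = 0.
  move=> [W1 W2] H; have [K1 K2] := (eform_ge0 (KE W1), eform_ge0 (KE W2)).
  move: H; rewrite /vform/= => H.
  have e1 : eform (K W.1) (K W.1) = 0 by lra.
  have e2 : eform (K W.2) (K W.2) = 0 by lra.
  by rewrite (K_inj W1 e1) (K_inj W2 e2) addr0.
have eK n : exists k : R, forall W, in_pairH W -> vform (KV W) (e n) = k * vform W (e n).
  have [lam [X [A1 A2 eX]]] := eeig n.
  have [X1 X2] := (Arel_in_realH A1, Arel_in_realH A2).
  (* Symmetry of [A] between [K Z] and the eigenvector [X0]. *)
  have key Z X0 : in_realH Z -> Arel X0 (lam *: X0) -> (lam - s) * eform (K Z) X0 = eform Z X0.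
    move=> Z2 A0; have X0E := Arel_in_realH A0; have KZ2 := KE Z2.
    have := Arel_sym (KAE Z2) (in_realHZ lam X0E) (KA Z2) A0.
    rewrite addrC (eform_ZD s KZ2 Z2 X0E) [RHS]eform_sym eform_Z// (eform_sym X0); lra.
  have keyV W : in_pairH W -> (lam - s) * vform (KV W) (e n) = vform W (e n).
    move=> WV; have [W1 W2] := WV; rewrite !eX//; last exact: KVV.
    by rewrite /vform mulrDr !key.
  exists (lam - s)^-1 => W WV; rewrite -(keyV W WV).
  (* If [lam = s], then [keyV] makes every vector orthogonal to [e n], so both sides are 0. *)
  have [l0|ln0] := eqVneq (lam - s) 0; last by rewrite mulrA mulVf ?mul1r.
  by rewrite -(keyV _ (KVV _ WV)) l0 !mul0r mulr0.
apply: (@eigen_expansion R pairH in_pairH vform in_pairH_0 in_pairH_ZD vform_sym vform_ZD vform_ge0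
  KV KVV KVsym _ KVcpt e eV eK _ KVinj vform_complete eon).
  by exists (Num.sqrt M) => //; exact: sqrtr_ge0.
move=> y k yV k0 ye H; have [y1 y2] := yV.
have KVy := KVV _ yV; have [Ky1 Ky2] := KVy.
have DV : in_pairH (KV y - k *: y) by rewrite addrC -scaleNr; exact: in_pairH_ZD.
have [D1 D2] := DV.
have [H1 H2] : eform (K y.1 - k *: y.1) (K y.1 - k *: y.1) = 0 /\
    eform (K y.2 - k *: y.2) (K y.2 - k *: y.2) = 0.
  have h1 := eform_ge0 D1; have h2 := eform_ge0 D2.
  by move: H h1 h2; rewrite /vform/= => H h1 h2; split; lra.
(* [emax] wants genuine eigenvectors, so it is applied to [K y], and injectivity returns to [y]. *)
apply: KVinj => //; apply: emax.
- exact: (K_eigen y1 k0 H1).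
- exact: (K_eigen y2 k0 H2).
move=> n; have [k' ->//] := eK n; by rewrite ye mulr0.
Qed.

End Resolvent.

Theorem real_expansion (e : nat -> pairH) : (forall n, in_pairH (e n)) ->
  (forall i j, vform (e i) (e j) = (i == j)%:R) ->
  (forall n, exists lam W, [/\ Arel W.1 (lam *: W.1), Arel W.2 (lam *: W.2) &
     forall W', in_pairH W' -> vform W' (e n) = vform W' W]) ->
  (forall W lam, Arel W.1 (lam *: W.1) -> Arel W.2 (lam *: W.2) ->
     (forall n, vform W (e n) = 0) -> vform W W = 0) ->
  forall F, in_pairH F ->
    seminorm vform (F - \sum_(n < N) vform F (e n) *: e n) @[N --> \oo] --> 0.
Proof.
have [s [C [K [C0 KP]]]] := resolvent_exists.
apply: (@expansion_of_resolvent s C K) => // Z Z2; by case: (KP Z Z2).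
Qed.

End RealProblem.

Local Open Scope complex_scope.
Local Open Scope ring_scope.

(** * Removal of the transmission conditions *)

Section OneSidedLimits.
Context {R : realType}.
Implicit Types f F : R -> R.

Lemma within_cvg_right f F (a b : R) : a < b -> {within `[a, b], continuous F} ->
  (forall x, a < x < b -> f x = F x) -> f x @[x --> a^'+] --> F a.
Proof.
move=> ab /(continuous_within_itvP _ ab)[_ Fa _] fF.
apply: cvg_trans Fa; apply: near_eq_cvg; near=> x; rewrite fF//.
by apply/andP; split; near: x; [exact: nbhs_right_gt|exact: nbhs_right_lt].
Unshelve. all: by end_near. Qed.

Lemma within_cvg_left f F (a b : R) : a < b -> {within `[a, b], continuous F} ->
  (forall x, a < x < b -> f x = F x) -> f x @[x --> b^'-] --> F b.
Proof.
move=> ab /(continuous_within_itvP _ ab)[_ _ Fb] fF.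
apply: cvg_trans Fb; apply: near_eq_cvg; near=> x; rewrite fF//.
by apply/andP; split; near: x; [exact: nbhs_left_gt|exact: nbhs_left_lt].
Unshelve. all: by end_near. Qed.

End OneSidedLimits.

(** * The mesh, piecewise continuous functions and the weight *)

Section Mesh.
Context {R : realType} (P : bvp R).
Local Notation mu := (@lebesgue_measure R).
Local Notation n := (npts P).
Local Notation h := (mesh P).
Local Notation J := `[(-1 : R), 1]%classic.
Local Notation L1i := (L1i (-1 : R) 1).
Local Notation L2i := (L2i (-1 : R) 1).
Implicit Types f g F G : R -> R.

Lemma lt_N11 : -1 < 1 :> R. Proof. lra. Qed.

Lemma mesh_ltn i j : (i < j)%N -> (j <= n.+1)%N -> h i < h j.
Proof.
elim: j => // j IH; rewrite ltnS leq_eqVlt => /predU1P[->|ij] jn; first exact: mesh_lt.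
by apply: lt_trans (mesh_lt _) => //; apply: IH => //; exact: ltnW.
Qed.
Lemma mesh_leq i j : (i <= j)%N -> (j <= n.+1)%N -> h i <= h j.
Proof.
by rewrite leq_eqVlt => /predU1P[->//|ij] jn; exact/ltW/mesh_ltn.
Qed.
Lemma mesh_ge i : (i <= n.+1)%N -> -1 <= h i.
Proof. by move=> ?; rewrite -(mesh0 P); exact: mesh_leq. Qed.
Lemma mesh_le i : (i <= n.+1)%N -> h i <= 1.
Proof. by move=> ?; rewrite -(mesh_last P); exact: mesh_leq. Qed.

Lemma mesh_locate k x : (k <= n.+1)%N -> -1 <= x <= h k ->
  (exists2 j, (j <= k)%N & x = h j) \/ exists2 i, (i < k)%N & h i < x < h i.+1.
Proof.
elim: k => [|k IH] kn /andP[x0 xk].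
  by left; exists 0%N => //; apply/eqP; rewrite eq_le xk mesh0.
have [xk'|xk'] := leP x (h k).
  have [|[j jk ->]|[i ik xi]] := IH (ltnW kn); first by rewrite x0.
    by left; exists j => //; rewrite leqW.
  by right; exists i => //; rewrite leqW.
move: xk; rewrite le_eqVlt => /predU1P[->|xk]; first by left; exists k.+1.
by right; exists k => //; rewrite xk' xk.
Qed.

Lemma piece_sub i x : (i <= n)%N -> h i < x < h i.+1 -> J x.
Proof.
move=> ilen /andP[h1 h2]; rewrite /= in_itv/=; apply/andP; split.
  by apply: le_trans (ltW h1); apply: mesh_ge; exact: leqW.
by apply: le_trans (ltW h2) _; exact: mesh_le.
Qed.
Lemma cpiece_sub i : (i <= n)%N -> `[h i, h i.+1]%classic `<=` J.
Proof.
move=> ilen; apply: subset_itv; rewrite bnd_simp; [apply: mesh_ge; exact: leqW|exact: mesh_le].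
Qed.

Definition off_mesh x := forall i, (i <= n.+1)%N -> x != h i.
Lemma ae_off_mesh : {ae mu, forall x, off_mesh x}.
Proof.
suff H k : {ae mu, forall x, forall i, (i < k)%N -> x != h i}.
  by apply: ae_imp (H n.+2) => x Hx i; exact: Hx.
elim: k => [|k IH]; first by apply: (@ae_imp _ (fun x => x != 0)) => //; exact: ae_neq.
move: (ae_and IH (ae_neq (h k))); apply: ae_imp => x [H1 H2] i.
by rewrite ltnS leq_eqVlt => /predU1P[->|/H1].
Qed.
Lemma off_mesh_piece x : off_mesh x -> J x -> exists2 i, (i <= n)%N & h i < x < h i.+1.
Proof.
move=> xo; rewrite /= in_itv/= -{2}(mesh_last P) => xJ.
have [[j jn xj]|[i ilt xi]] := mesh_locate (leqnn n.+1) xJ; last by exists i.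
by have := xo j jn; rewrite xj eqxx.
Qed.

Lemma measurable_pieces f :
  (forall i, (i <= n)%N -> measurable_fun `]h i, h i.+1[%classic f) -> measurable_fun J f.
Proof.
move=> mf.
suff H k : (k <= n.+1)%N -> measurable_fun `[(-1 : R), h k]%classic f.
  by have := H _ (leqnn _); rewrite mesh_last.
elim: k => [_|k IH kn]; first by rewrite mesh0 set_itv1; exact: measurable_fun_set1.
have -> : `[(-1 : R), h k.+1]%classic =
    (`[(-1 : R), h k] `|` `]h k, h k.+1[) `|` [set h k.+1].
  have hk := mesh_lt kn; have hk0 := mesh_ge (ltnW kn).
  apply/seteqP; split => x /=; rewrite !in_itv/=.
    move=> /andP[-> ]; rewrite le_eqVlt => /predU1P[->|xk]; [by right|left].
    by have [|] := leP x (h k); [left|right].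
  move=> [[/andP[-> xk]|/andP[kx xk]]|->].
  - by apply: le_trans xk _; exact: ltW.
  - by rewrite (ltW xk) andbT (le_trans hk0)// ltW.
  - by rewrite lexx andbT (le_trans hk0)// ltW.
apply/measurable_funU; [exact: measurableU|exact: measurable_set1|split; last exact: measurable_fun_set1].
by apply/measurable_funU; [exact: measurable_itv|exact: measurable_itv|split; [exact: (IH (ltnW kn))|exact: mf]].
Qed.

(** Each piece has its own continuous extension, so one-sided limits exist at the mesh points while
    the values there stay arbitrary. *)
Definition pcontinuous f := forall i, (i <= n)%N ->
  exists2 F, {within `[h i, h i.+1], continuous F} & forall x, h i < x < h i.+1 -> f x = F x.

Lemma pcontinuousD f g : pcontinuous f -> pcontinuous g -> pcontinuous (fun x => f x + g x).
Proof.
move=> pf pg i ilen; have [F cF fF] := pf i ilen; have [G cG gG] := pg i ilen.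
exists (fun x => F x + G x) => [x|x xi]; last by rewrite fF// gG.
by apply: cvgD; [exact: cF|exact: cG].
Qed.
Lemma pcontinuousM f g : pcontinuous f -> pcontinuous g -> pcontinuous (fun x => f x * g x).
Proof.
move=> pf pg i ilen; have [F cF fF] := pf i ilen; have [G cG gG] := pg i ilen.
exists (fun x => F x * G x) => [x|x xi]; last by rewrite fF// gG.
by apply: cvgM; [exact: cF|exact: cG].
Qed.
Lemma pcontinuous_cst c : pcontinuous (fun=> c).
Proof. by move=> i _; exists (fun=> c) => // x; exact: cvg_cst. Qed.
Lemma pcontinuous_eq f g : (forall i x, (i <= n)%N -> h i < x < h i.+1 -> f x = g x) ->
  pcontinuous f -> pcontinuous g.
Proof.
move=> fg pf i ilen; have [F cF fF] := pf i ilen; exists F => // x xi.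
by rewrite -fF//; symmetry; exact: (fg i).
Qed.

Lemma pcontinuous_measurable f : pcontinuous f -> measurable_fun J f.
Proof.
move=> pf; apply: measurable_pieces => i ilen; have [F cF fF] := pf i ilen.
apply: (@eq_measurable_fun _ _ _ _ _ F).
  by move=> x; rewrite inE/= in_itv/= => xi; rewrite fF.
apply: (@measurable_funS _ _ _ _ `[h i, h i.+1]%classic) => //.
  by apply: subset_itv; rewrite bnd_simp.
exact: continuousJ_measurable.
Qed.

Lemma pcontinuous_bounded f : pcontinuous f -> exists M, forall x, J x -> `|f x| <= M.
Proof.
move=> pf.
suff H k : (k <= n.+1)%N -> exists M, forall x, -1 <= x <= h k -> `|f x| <= M.
  have [M MP] := H _ (leqnn n.+1); exists M => x; rewrite /= in_itv/= -{2}(mesh_last P); exact: MP.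
elim: k => [_|k IH kn].
  exists `|f (-1)| => x; rewrite mesh0 -eq_le => /eqP <-//.
have [M MP] := IH (ltnW kn); have [F cF fF] := pf k kn.
have [N NP] := bounded_continuousJ cF.
exists (Num.max M (Num.max N `|f (h k.+1)|)) => x /andP[x0 xk].
have [xk'|xk'] := leP x (h k); first by rewrite !le_max MP ?x0//.
move: xk; rewrite le_eqVlt => /predU1P[->|xk]; first by rewrite !le_max lexx !orbT.
by rewrite !le_max fF ?xk' ?xk// NP ?orbT//= in_itv/= !ltW.
Qed.

Lemma pcontinuous_L2 f : pcontinuous f -> L2i f.
Proof.
move=> pf; have [M fM] := pcontinuous_bounded pf.
by apply: (L2_bounded lt_N11 _ fM); exact: pcontinuous_measurable.
Qed.

Let piece_mesh_dom i : (i <= n)%N -> `]h i, h i.+1[%classic `<=` mesh_dom P.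
Proof.
move=> ilen x /= xi; have /andP[h1 h2] : h i < x < h i.+1 by move: xi; rewrite in_itv.
split; first by apply: (piece_sub ilen); rewrite h1.
move=> j /andP[_ jn]; have [ji|ij] := leqP j i.
  by rewrite gt_eqF//; apply: le_lt_trans h1; apply: mesh_leq => //; exact: leqW.
by rewrite lt_eqF//; apply: lt_le_trans h2 _; apply: mesh_leq => //; exact: leqW.
Qed.

Lemma potential_continuous_at i x : (i <= n)%N -> h i < x < h i.+1 ->
  {for x, continuous (potential P)}.
Proof.
move=> ilen xi.
have := continuous_subspaceW (piece_mesh_dom ilen) (potential_continuous (b := P)).
by rewrite continuous_open_subspace//; apply; rewrite inE/= in_itv.
Qed.

(** At interior mesh points the limit is a field of [bvp]; at -1 it comes from continuity within
    [mesh_dom], which contains that point. *)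
Let potential_right i : (i <= n)%N -> exists l : R, potential P x @[x --> (h i)^'+] --> l.
Proof.
case: i => [|i] ilen; last by have /cvg_ex := potential_rlim (b := P) (i := i.+1) ilen.
exists (potential P (-1)).
have /subspace_continuousP/(_ (-1)) := potential_continuous (b := P).
have m1 : mesh_dom P (-1).
  split; first by rewrite in_itv/= lexx/=; lra.
  by move=> j /andP[j0 jn]; rewrite -(mesh0 P) lt_eqF//; apply: mesh_ltn => //; exact: leqW.
move=> /(_ m1) H A /H; rewrite mesh0 /=.
have h01 : -1 < h 1 by rewrite -(mesh0 P); exact: mesh_lt.
apply: filterS2 (lt_nbhsl h01) => x x1 /[swap] x0; apply.
by apply: (piece_mesh_dom (i := 0)) => //=; rewrite in_itv/= mesh0 x0.
Qed.

Let potential_left i : (i <= n)%N -> exists l : R, potential P x @[x --> (h i.+1)^'-] --> l.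
Proof.
move=> ilen; have [iltn|nlei] := ltnP i n.
  by have /cvg_ex := potential_llim (b := P) (i := i.+1) iltn.
have -> : i = n by apply/eqP; rewrite eqn_leq ilen.
exists (potential P 1).
have /subspace_continuousP/(_ 1) := potential_continuous (b := P).
have m1 : mesh_dom P 1.
  split; first by rewrite in_itv/= lexx andbT; lra.
  by move=> j /andP[j0 jn]; rewrite -(mesh_last P) gt_eqF//; apply: mesh_ltn.
move=> /(_ m1) H A /H; rewrite mesh_last /=.
have h01 : h n < 1 by rewrite -(mesh_last P); exact: mesh_lt.
apply: filterS2 (lt_nbhsr h01) => x x1 /[swap] x0; apply.
by apply: (piece_mesh_dom (leqnn n)) => //=; rewrite in_itv/= mesh_last x0 x1.
Qed.

Lemma potential_pcontinuous : pcontinuous (potential P).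
Proof.
move=> i ilen; have [r rP] := potential_right ilen; have [l lP] := potential_left ilen.
have hi := mesh_lt ilen.
exists (fun x => if x == h i then r else if x == h i.+1 then l else potential P x); last first.
  by move=> x /andP[h1 h2]; rewrite gt_eqF// lt_eqF.
apply/continuous_within_itvP => //; split.
- move=> x; rewrite in_itv/= => xi; have /andP[h1 h2] := xi.
  have := potential_continuous_at ilen xi; rewrite /prop_for /continuous_at.
  rewrite gt_eqF// lt_eqF//; apply: cvg_trans; apply: near_eq_cvg; near=> y.
  rewrite gt_eqF; last by near: y; exact: lt_nbhsr.
  by rewrite lt_eqF//; near: y; exact: lt_nbhsl.
- rewrite eqxx; apply: cvg_trans rP; apply: near_eq_cvg; near=> y.
  rewrite gt_eqF; last by near: y; exact: nbhs_right_gt.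
  by rewrite lt_eqF//; near: y; exact: nbhs_right_lt.
- rewrite gt_eqF// eqxx; apply: cvg_trans lP; apply: near_eq_cvg; near=> y.
  rewrite gt_eqF; last by near: y; exact: nbhs_left_gt.
  by rewrite lt_eqF//; near: y; exact: nbhs_left_lt.
Unshelve. all: by end_near. Qed.

(* [wt] is the factor that removes the transmission conditions; its square is the weight in [ip]. *)
Definition wprod i : R := \prod_(1 <= j < i.+1) delta P j.
Definition wt x : R := \prod_(1 <= j < n.+1) (if h j < x then delta P j else 1).

Lemma wprod0 : wprod 0 = 1. Proof. by rewrite /wprod big_geq. Qed.
Lemma wprodS i : wprod i.+1 = wprod i * delta P i.+1.
Proof. by rewrite /wprod big_nat_recr. Qed.
Lemma wprod_neq0 i : (i <= n)%N -> wprod i != 0.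
Proof.
elim: i => [_|i IH ilen]; first by rewrite wprod0 oner_eq0.
by rewrite wprodS mulf_neq0 ?delta_neq0//; exact/IH/ltnW.
Qed.
Lemma wt_piece i x : (i <= n)%N -> h i < x < h i.+1 -> wt x = wprod i.
Proof.
move=> ilen /andP[h1 h2]; rewrite /wt (@big_cat_nat _ _ _ i.+1)//=.
rewrite [X in _ * X]big1_seq ?mulr1.
  rewrite /wprod big_nat_cond [RHS]big_nat_cond; apply: eq_bigr => j; rewrite andbT => /andP[j1 ji].
  by rewrite ifT//; apply: le_lt_trans h1; apply: mesh_leq => //; exact: leqW.
move=> j; rewrite mem_index_iota => /andP[_ /andP[ij jn]].
by rewrite ifF//; apply/negbTE; rewrite -leNgt; apply: le_trans (ltW h2) _; apply: mesh_leq => //; exact: ltnW.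
Qed.
Lemma wt_neq0 x : wt x != 0.
Proof.
rewrite /wt prodf_seq_neq0; apply/allP => j; rewrite mem_index_iota /= => jn; case: ifP => _; last exact: oner_neq0.
exact: delta_neq0.
Qed.
Lemma pcontinuous_wt : pcontinuous wt.
Proof.
by move=> i ilen; exists (fun=> wprod i) => [x|x xi]; [exact: cvg_cst|exact: wt_piece].
Qed.

End Mesh.

(** * Gluing the pieces into one primitive *)

Section Gluing.
Context {R : realType} (P : bvp R).
Local Notation mu := (@lebesgue_measure R).
Local Notation n := (npts P).
Local Notation h := (mesh P).
Local Notation J := `[(-1 : R), 1]%classic.
Local Notation I := (prim (-1 : R)).
Local Notation L1i := (L1i (-1 : R) 1).
Local Notation L2i := (L2i (-1 : R) 1).
Local Notation pcontinuous := (pcontinuous P).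
Local Notation wt := (wt P).
Local Notation wprod := (wprod P).
Implicit Types f g F G : R -> R.
Local Notation N11 := (lt_N11 (R := R)).

Lemma pcontinuous_wtM g : pcontinuous g -> L1i (fun t => wt t * g t).
Proof.
move=> pg; apply: (L2_L1 N11); apply: (pcontinuous_L2 (P := P)).
by apply: pcontinuousM => //; exact: pcontinuous_wt.
Qed.

Lemma piece_FTC i f g F G x : (i <= n)%N ->
  {within `[h i, h i.+1], continuous F} -> {within `[h i, h i.+1], continuous G} ->
  (forall x, h i < x < h i.+1 -> f x = F x) -> (forall x, h i < x < h i.+1 -> g x = G x) ->
  (forall x, h i < x < h i.+1 -> derivable f x 1 /\ derive1 f x = g x) ->
  h i < x <= h i.+1 -> \int[mu]_(t in `[h i, x]) G t = F x - F (h i).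
Proof.
move=> ilen cF cG fF gG df /andP[x1 x2].
have sub : `[h i, x]%classic `<=` `[h i, h i.+1] by apply: subset_itvl; rewrite bnd_simp.
have cFx := continuous_subspaceW sub cF.
have dF t : h i < t < h i.+1 -> derivable F t 1 /\ derive1 F t = G t.
  move=> ti; have [d1 d2] := df t ti; have /andP[t1 t2] := ti.
  have nfF : {near t, f =1 F}.
    near=> s; apply: fF; apply/andP; split; near: s; [exact: lt_nbhsr|exact: lt_nbhsl].
  split; first exact: near_eq_derivable d1.
  by rewrite -gG// -d2 !derive1E; apply/esym/near_eq_derive.
rewrite /Rintegral (@continuous_FTC2 _ G F)//.
- exact: continuous_subspaceW cG.
- split.
  + move=> t; rewrite in_itv/= => /andP[t1 t2]; apply: (proj1 (dF t _)).
    by rewrite t1 (lt_le_trans t2).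
  + by move/(continuous_within_itvP _ x1) : cFx => [].
  + by move/(continuous_within_itvP _ x1) : cFx => [].
- move=> t; rewrite in_itv/= => /andP[t1 t2]; apply: (proj2 (dF t _)).
  by rewrite t1 (lt_le_trans t2).
Unshelve. all: by end_near. Qed.

(** Crossing [h i] multiplies the weight by [delta P i], exactly the ratio of the left limit of [f]
    to its right limit, so [wt * f] has equal one-sided limits there and is the primitive of
    [wt * g] on the whole interval. *)
Lemma glue f g : pcontinuous f -> pcontinuous g ->
  (forall i x, (i <= n)%N -> h i < x < h i.+1 -> derivable f x 1 /\ derive1 f x = g x) ->
  (forall i, (1 <= i <= n)%N ->
     lim (f x @[x --> (h i)^'-]) = delta P i * lim (f x @[x --> (h i)^'+])) ->
  let Y x := lim (f x @[x --> (-1)^'+]) + I (fun t => wt t * g t) x in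
  (forall i x, (i <= n)%N -> h i < x < h i.+1 -> wt x * f x = Y x) /\
  wprod n * lim (f x @[x --> 1^'-]) = Y 1.
Proof.
move=> pf pg df tf Y.
have wg1 := pcontinuous_wtM pg.
(* Propagation from the left end of a piece to any of its points; [S] below passes from one piece to
   the next. *)
have step i F G x : (i <= n)%N ->
    {within `[h i, h i.+1], continuous F} -> {within `[h i, h i.+1], continuous G} ->
    (forall x, h i < x < h i.+1 -> f x = F x) -> (forall x, h i < x < h i.+1 -> g x = G x) ->
    wprod i * F (h i) = Y (h i) -> h i < x <= h i.+1 -> wprod i * F x = Y x.
  move=> ilen cF cG fF gG Fi xi; have /andP[x1 x2] := xi.
  have FT := piece_FTC ilen cF cG fF gG (fun x xi => df i x ilen xi) xi.
  have -> : F x = F (h i) + \int[mu]_(t in `[h i, x]) G t by rewrite FT addrC subrK.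
  have xl1 : x <= 1 by apply: le_trans x2 _; exact: mesh_le.
  have sub : `[h i, x]%classic `<=` J.
    by apply: subset_itv; rewrite bnd_simp// mesh_ge// leqW.
  have subi : `[h i, x]%classic `<=` `[h i, h i.+1] by apply: subset_itvl; rewrite bnd_simp.
  have G1 : mu.-integrable `[h i, x] (EFin \o G).
    apply: continuous_compact_integrable; first exact: segment_compact.
    exact: continuous_subspaceW cG.
  rewrite mulrDr Fi /Y -addrA; congr (_ + _).
  rewrite -RintegralZl//.
  have -> : I (fun t => wt t * g t) x = I (fun t => wt t * g t) (h i) +
    (I (fun t => wt t * g t) x - I (fun t => wt t * g t) (h i)) by rewrite addrC subrK.
  congr (_ + _); rewrite (prim_sub wg1 (mesh_ge (leqW ilen)) (ltW x1) xl1).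
  have wgi : mu.-integrable `]h i, x] (EFin \o (fun t => wt t * g t)).
    by apply: integrableS wg1 => //; apply: subset_trans sub; apply: subset_itvr; rewrite bnd_simp.
  rewrite Rintegral_itv_obnd_cbnd// /Rintegral; congr fine.
  (* [wt] and [g] are known only strictly inside the piece, so the integrands are compared on the
     open interval. *)
  have subo : `]h i, x[%classic `<=` `[h i, x]%classic by apply: subset_itv; rewrite bnd_simp.
  apply: eq_integral_itv_bounded.
  - apply: measurable_funM => //; apply: measurable_funS subo _ => //.
    by apply: measurable_funS (continuousJ_measurable cG).
  - apply: measurable_funS (L1_measurable wg1) => //; exact: subset_trans subo sub.
  - move=> t; rewrite in_itv/= => /andP[t1 t2].
    have ti : h i < t < h i.+1 by rewrite t1 (lt_le_trans t2).
    by rewrite (wt_piece ilen ti) gG.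
have S i : (i <= n)%N -> forall F, {within `[h i, h i.+1], continuous F} ->
    (forall x, h i < x < h i.+1 -> f x = F x) -> wprod i * F (h i) = Y (h i).
  elim: i => [_|i IH ilen] F cF fF.
    have h01 : h 0 < h 1 := mesh_lt (leq0n _).
    have /cvg_lim <- // := within_cvg_right h01 cF fF.
    by rewrite wprod0 mul1r /Y mesh0 prim_a addr0.
  have [G cG gG] := pg i (ltnW ilen); have [F' cF' fF'] := pf i (ltnW ilen).
  have hi := mesh_lt (ltnW ilen); have hi' := mesh_lt ilen.
  rewrite -(step i F' G (h i.+1) (ltnW ilen) cF' cG fF' gG); last 2 first.
    by apply: IH => //; exact: ltnW.
    by rewrite hi lexx.
  have /cvg_lim <- // := within_cvg_right hi' cF fF.
  have /cvg_lim <- // := within_cvg_left hi cF' fF'.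
  by rewrite tf// wprodS mulrA.
split.
  move=> i x ilen xi; have [G cG gG] := pg i ilen; have [F cF fF] := pf i ilen.
  have /andP[x1 x2] := xi.
  by rewrite (wt_piece ilen xi) fF//; apply: (step i F G) => //; [exact: S|rewrite x1 ltW].
have [G cG gG] := pg n (leqnn n); have [F cF fF] := pf n (leqnn n).
have hn := mesh_lt (leqnn n).
rewrite -(mesh_last P); have /cvg_lim -> // := within_cvg_left hn cF fF.
by apply: (step n F G) => //; [exact: S|rewrite hn lexx].
Qed.

End Gluing.

(** * Real and imaginary parts, absolute continuity *)

Section ComplexParts.
Context {R : realType}.
Local Notation cRe := (@complex.Re R).
Local Notation cIm := (@complex.Im R).
Implicit Types z t : R[i].

Lemma cReD z t : cRe (z + t) = cRe z + cRe t. Proof. by case: z t => ? ? [? ?]. Qed.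
Lemma cImD z t : cIm (z + t) = cIm z + cIm t. Proof. by case: z t => ? ? [? ?]. Qed.
Lemma cReN z : cRe (- z) = - cRe z. Proof. by case: z. Qed.
Lemma cImN z : cIm (- z) = - cIm z. Proof. by case: z. Qed.
Lemma cReM z t : cRe (z * t) = cRe z * cRe t - cIm z * cIm t.
Proof. by case: z t => ? ? [? ?]. Qed.
Lemma cImM z t : cIm (z * t) = cRe z * cIm t + cIm z * cRe t.
Proof. by case: z t => ? ? [? ?]. Qed.
Lemma cRec (r : R) : cRe r%:C = r. Proof. by []. Qed.
Lemma cImc (r : R) : cIm r%:C = 0. Proof. by []. Qed.
Lemma cReJ z : cRe (conjc z) = cRe z. Proof. by case: z. Qed.
Lemma cImJ z : cIm (conjc z) = - cIm z. Proof. by case: z. Qed.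
Lemma complex_ext z t : cRe z = cRe t -> cIm z = cIm t -> z = t.
Proof. by case: z t => ? ? [? ?] /= -> ->. Qed.
Definition cparts := (cReD, cImD, cReN, cImN, cReM, cImM, cRec, cImc, cReJ, cImJ).

Lemma Re_le_normc z : `|cRe z| <= ComplexField.Normc.normc z.
Proof. by case: z => x y /=; rewrite -sqrtr_sqr ler_wsqrtr// lerDl sqr_ge0. Qed.
Lemma Im_le_normc z : `|cIm z| <= ComplexField.Normc.normc z.
Proof. by case: z => x y /=; rewrite -sqrtr_sqr ler_wsqrtr// lerDr sqr_ge0. Qed.
Lemma normc_le z : ComplexField.Normc.normc z <= `|cRe z| + `|cIm z|.
Proof.
case: z => x y /=; rewrite -(ger0_norm (addr_ge0 (normr_ge0 x) (normr_ge0 y))) -sqrtr_sqr.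
apply: ler_wsqrtr; rewrite sqrrD !real_normK ?num_real//.
have := mulr_ge0 (normr_ge0 x) (normr_ge0 y); lra.
Qed.
Lemma normc_sqr z : ComplexField.Normc.normc z ^+ 2 = cRe z ^+ 2 + cIm z ^+ 2.
Proof. by case: z => x y /=; rewrite sqr_sqrtr// addr_ge0 ?sqr_ge0. Qed.

Lemma cnormN z : ComplexField.Normc.normc (- z) = ComplexField.Normc.normc z.
Proof. by case: z => x y /=; rewrite !sqrrN. Qed.

Lemma AC_uniform (a b : R) (g : R -> R[i]) : absolutely_continuous a b g ->
  forall e, 0 < e -> exists2 d, 0 < d & forall x y, a <= x <= b -> a <= y <= b ->
    `|x - y| < d -> ComplexField.Normc.normc (g x - g y) < e.
Proof.
move=> ACg e e0; have [d d0 H] := ACg e e0; exists d => // x y xI yI.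
wlog yx : x y xI yI / y <= x.
  move=> W; have [/W|/ltW xy] := leP y x; first exact.
  rewrite distrC => /W -/(_ yI xI xy).
  by rewrite -cnormN opprB.
rewrite ger0_norm ?subr_ge0// => xy.
have := H 1%N (fun=> y) (fun=> x); rewrite !big_ord1; apply=> //.
  move=> _; move: xI yI => /andP[_ ->] /andP[-> _]; by split.
by apply/trivIsetP => i j _ _; rewrite !ord1 eqxx.
Qed.

Lemma AC_continuous (a b : R) (g : R -> R[i]) : absolutely_continuous a b g ->
  {within `[a, b], continuous (fun x => cRe (g x))} /\
  {within `[a, b], continuous (fun x => cIm (g x))}.
Proof.
move=> /AC_uniform H.
split; apply/subspace_continuousP => x; rewrite /= in_itv/= => xI; apply/cvgrPdist_lt => e e0;
  have [d d0 Hd] := H e e0; rewrite near_withinE; apply/nbhs_ballP; exists d => //= y;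
  rewrite /ball/= in_itv/= => xy yI; have := Hd x y xI yI xy; apply: le_lt_trans.
- by rewrite -cReN -cReD; exact: Re_le_normc.
- by rewrite -cImN -cImD; exact: Im_le_normc.
Qed.

Lemma Lipschitz_AC (a b M : R) (g : R -> R[i]) :
  (forall x y, a <= x <= b -> a <= y <= b -> `|cRe (g x) - cRe (g y)| <= M * `|x - y|) ->
  (forall x y, a <= x <= b -> a <= y <= b -> `|cIm (g x) - cIm (g y)| <= M * `|x - y|) ->
  absolutely_continuous a b g.
Proof.
move=> H1 H2 e e0.
(* One [M] for each of the real and imaginary parts, and 1 to keep the constant positive. *)
pose K := 2 * `|M| + 1; have K0 : 0 < K by rewrite ltr_wpDl ?mulr_ge0.
exists (e / K) => [|n s t st _]; first by rewrite divr_gt0.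
rewrite ltr_pdivlMr// => sume; apply: le_lt_trans sume.
rewrite mulr_suml; apply: ler_sum => k _.
have [sa sk tb] := st k.
have sI : a <= s k <= b by rewrite sa (le_trans sk).
have tI : a <= t k <= b by rewrite tb andbT (le_trans sa).
apply: le_trans (normc_le _) _; rewrite !cparts.
have := H1 _ _ tI sI; have := H2 _ _ tI sI; rewrite [`|t k - s k|]ger0_norm ?subr_ge0// /K.
have ts : 0 <= t k - s k by rewrite subr_ge0.
have := ler_wpM2r ts (ler_norm M).
set u := M * _; set v := `|M| * _; move=> h1 h2 h3.
rewrite mulrDr mulr1 mulrCA [_ * `|M|]mulrC -/v; lra.
Qed.
End ComplexParts.

(** * From solutions of the boundary value problem to the real operator *)

Section Solutions.
Context {R : realType} (P : bvp R).
Local Notation mu := (@lebesgue_measure R).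
Local Notation n := (npts P).
Local Notation h := (mesh P).
Local Notation J := `[(-1 : R), 1]%classic.
Local Notation I := (prim (-1 : R)).
Local Notation L1i := (L1i (-1 : R) 1).
Local Notation L2i := (L2i (-1 : R) 1).
Local Notation pcontinuous := (pcontinuous P).
Local Notation wt := (wt P).
Local Notation wprod := (wprod P).
Local Notation q := (potential P).
Local Notation cRe := (@complex.Re R).
Local Notation cIm := (@complex.Im R).
Definition ArelP := Arel (-1) 1 q (alpha1 P) (alpha2 P) (beta1 P) (beta2 P) (betap1 P) (betap2 P).
Local Notation in_realH := (in_realH (-1) 1).
Implicit Types f g k : R -> R.
Local Notation N11 := (lt_N11 (R := R)).

Lemma alpha_or : (alpha1 P != 0) || (alpha2 P != 0).
Proof.
have := alpha_neq0 P; have [->|//] := eqVneq (alpha1 P) 0.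
by have [->|//] := eqVneq (alpha2 P) 0; rewrite normr0 addr0 eqxx.
Qed.

Lemma ae_pieces (p : R -> Prop) : (forall i x, (i <= n)%N -> h i < x < h i.+1 -> p x) ->
  {ae mu, forall x, J x -> p x}.
Proof.
move=> Hp; apply: ae_imp (ae_off_mesh P) => x xo Jx.
by have [i ilen xi] := off_mesh_piece xo Jx; exact: (Hp i).
Qed.

Lemma prim_cst_continuous c f : L1i f -> {within J, continuous (fun x => c + I f x)}.
Proof. by move=> f1 x; apply: cvgD; [exact: cvg_cst|exact: prim_continuous]. Qed.

Definition transm f := forall i, (1 <= i <= n)%N ->
  lim (f x @[x --> (h i)^'-]) = delta P i * lim (f x @[x --> (h i)^'+]).

(** For a real function with [tau f = k], multiplied by the weight. The right side [Z] is left free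
    because those intended are combinations of the vectors [X] obtained here for the real and the
    imaginary part. *)
Lemma Arel_of_solution f f1 k : pcontinuous f -> pcontinuous f1 -> pcontinuous k ->
  (forall i x, (i <= n)%N -> h i < x < h i.+1 -> derivable f x 1 /\ derive1 f x = f1 x) ->
  (forall i x, (i <= n)%N -> h i < x < h i.+1 ->
     derivable f1 x 1 /\ derive1 f1 x = q x * f x - k x) ->
  transm f -> transm f1 ->
  alpha1 P * lim (f x @[x --> (-1)^'+]) + alpha2 P * lim (f1 x @[x --> (-1)^'+]) = 0 ->
  exists X : @realH R, [/\ in_realH X, {ae mu, forall x, J x -> X.1 x = wt x * f x},
    X.2 = wprod n * (betap1 P * lim (f x @[x --> 1^'-]) - betap2 P * lim (f1 x @[x --> 1^'-])) &
    forall Z, in_realH Z -> {ae mu, forall x, J x -> Z.1 x = wt x * k x} ->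
      Z.2 = - (wprod n * (beta1 P * lim (f x @[x --> 1^'-]) - beta2 P * lim (f1 x @[x --> 1^'-]))) ->
      ArelP X Z].
Proof.
move=> pf pf1 pk df df1 tf tf1 bc.
have pg : pcontinuous (fun x => q x * f x - k x).
  apply: (pcontinuous_eq (f := fun x => q x * f x + (-1) * k x)).
    by move=> i x _ _; ring.
  apply: pcontinuousD; apply: pcontinuousM => //; first exact: potential_pcontinuous.
  exact: pcontinuous_cst.
have [fY f_end] := glue pf pf1 df tf; have [f1Y f1_end] := glue pf1 pg df1 tf1.
set Y := (fun x => lim (f x @[x --> (-1)^'+]) + I (fun t => wt t * f1 t) x).
set Y1 := (fun x => lim (f1 x @[x --> (-1)^'+]) + I (fun t => wt t * (q t * f t - k t)) x).
have cY : {within J, continuous Y} by apply: prim_cst_continuous; exact: pcontinuous_wtM.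
have cY1 : {within J, continuous Y1} by apply: prim_cst_continuous; exact: pcontinuous_wtM.
have YE : {ae mu, forall x, J x -> Y x = wt x * f x}.
  by apply: ae_pieces => i x ilen xi; rewrite (fY i).
have Y1E : {ae mu, forall x, J x -> Y1 x = wt x * f1 x}.
  by apply: ae_pieces => i x ilen xi; rewrite (f1Y i).
exists (Y, wprod n * (betap1 P * lim (f x @[x --> 1^'-]) - betap2 P * lim (f1 x @[x --> 1^'-]))).
split=> //=; first exact: (L2_continuous N11 cY).
move=> Z Z2 Zae ZE2.
have Ya : Y (-1) = lim (f x @[x --> (-1)^'+]) by rewrite /Y prim_a addr0.
have Y1a : Y1 (-1) = lim (f1 x @[x --> (-1)^'+]) by rewrite /Y1 prim_a addr0.
exists Y1; split=> /=; rewrite ?Ya ?Y1a//.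
- split=> // x Jx; (have xb : x <= 1 by move: Jx; rewrite /= in_itv/= => /andP[]).
    rewrite /Y; congr (_ + _); apply: (eq_prim_ae xb).
    + apply: L1_measurable; exact: pcontinuous_wtM.
    + exact: continuousJ_measurable.
    + by apply: ae_imp Y1E => t /[apply].
  rewrite /Y1; congr (_ + _); apply: (eq_prim_ae xb).
  + apply: L1_measurable; exact: pcontinuous_wtM.
  + apply: measurable_funB; last by case: Z2.
    apply: measurable_funM; last exact: continuousJ_measurable.
    by apply: (pcontinuous_measurable (P := P)); exact: potential_pcontinuous.
  + apply: ae_imp (ae_and YE Zae) => t [H1 H2] Jt; rewrite H1// H2//; ring.
- by rewrite mulrBr mulrCA [X in _ - X]mulrCA f_end f1_end.
- by rewrite ZE2 mulrBr mulrCA [X in _ - X]mulrCA f_end f1_end.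
Qed.

Lemma extends_AC_pcontinuous (u : R -> R[i]) :
  (forall i, (i <= n)%N -> extends_AC (h i) (h i.+1) u) ->
  pcontinuous (fun x => cRe (u x)) /\ pcontinuous (fun x => cIm (u x)).
Proof.
move=> H; split=> i ilen; have [g ug /AC_continuous[cr ci]] := H i ilen.
- by exists (fun x => cRe (g x)) => // x xi; rewrite ug// in_itv.
- by exists (fun x => cIm (g x)) => // x xi; rewrite ug// in_itv.
Qed.

Lemma pcontinuous_lin f g c d : pcontinuous f -> pcontinuous g ->
  pcontinuous (fun x => c * f x + d * g x).
Proof.
by move=> pf pg; apply: pcontinuousD; apply: pcontinuousM => //; exact: pcontinuous_cst.
Qed.

(* Symmetry of the real operator excludes nonreal eigenvalues. *)
Lemma bvp_solution_Arel l u : bvp_solution P l u -> exists lam : R, exists X Y : @realH R,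
  [/\ ArelP X (lam *: X), ArelP Y (lam *: Y),
    {ae mu, forall x, J x -> X.1 x = wt x * cRe (u x) /\ Y.1 x = wt x * cIm (u x)},
    X.2 = wprod n * cRe (R1p P u) & Y.2 = wprod n * cIm (R1p P u)].
Proof.
move=> [ACu eqn lbc rbc tr].
have [pr pi] := extends_AC_pcontinuous (fun i ilen => let: And3 H _ _ := ACu i ilen in H).
have [pr1 pi1] := extends_AC_pcontinuous (fun i ilen => let: And3 _ _ H := ACu i ilen in H).
have dr i x : (i <= n)%N -> h i < x < h i.+1 ->
    derivable (fun t => cRe (u t)) x 1 /\ derive1 (fun t => cRe (u t)) x = cRe (cderive u x).
  by move=> ilen xi; have [_ /(_ x) H _] := ACu i ilen; have [|] := H; rewrite ?in_itv.
have di i x : (i <= n)%N -> h i < x < h i.+1 ->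
    derivable (fun t => cIm (u t)) x 1 /\ derive1 (fun t => cIm (u t)) x = cIm (cderive u x).
  by move=> ilen xi; have [_ /(_ x) H _] := ACu i ilen; have [|] := H; rewrite ?in_itv.
have d2 i x : (i <= n)%N -> h i < x < h i.+1 -> cderivable (cderive u) x /\
    cderive (cderive u) x = (q x)%:C * u x - l * u x.
  move=> ilen xi; have [|d <-] := eqn i x ilen; first by rewrite in_itv.
  by split=> //; rewrite /tau opprD opprK addrCA subrr addr0.
pose lr := cRe l; pose li := cIm l.
have d2r i x : (i <= n)%N -> h i < x < h i.+1 -> derivable (fun t => cRe (cderive u t)) x 1 /\
    derive1 (fun t => cRe (cderive u t)) x = q x * cRe (u x) - (lr * cRe (u x) + - li * cIm (u x)).
  move=> ilen xi; have [[d _] e] := d2 i x ilen xi; split=> //.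
  have -> : derive1 (fun t => cRe (cderive u t)) x = cRe ((q x)%:C * u x - l * u x) by rewrite -e.
  rewrite !cparts /lr /li; ring.
have d2i i x : (i <= n)%N -> h i < x < h i.+1 -> derivable (fun t => cIm (cderive u t)) x 1 /\
    derive1 (fun t => cIm (cderive u t)) x = q x * cIm (u x) - (lr * cIm (u x) + li * cRe (u x)).
  move=> ilen xi; have [[_ d] e] := d2 i x ilen xi; split=> //.
  have -> : derive1 (fun t => cIm (cderive u t)) x = cIm ((q x)%:C * u x - l * u x) by rewrite -e.
  rewrite !cparts /lr /li; ring.
have tr_r : transm (fun t => cRe (u t)).
  by move=> i ilen; have [/(congr1 cRe) E _] := tr i ilen; move: E; rewrite !cparts mul0r subr0; apply.
have tr_i : transm (fun t => cIm (u t)).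
  by move=> i ilen; have [/(congr1 cIm) E _] := tr i ilen; move: E; rewrite !cparts mul0r addr0; apply.
have tr_r1 : transm (fun t => cRe (cderive u t)).
  by move=> i ilen; have [_ /(congr1 cRe) E] := tr i ilen; move: E; rewrite !cparts mul0r subr0; apply.
have tr_i1 : transm (fun t => cIm (cderive u t)).
  by move=> i ilen; have [_ /(congr1 cIm) E] := tr i ilen; move: E; rewrite !cparts mul0r addr0; apply.
have bc_r : alpha1 P * lim (cRe (u x) @[x --> (-1)^'+]) + alpha2 P * lim (cRe (cderive u x) @[x --> (-1)^'+]) = 0.
  by have := congr1 cRe lbc; rewrite !cparts !mul0r !subr0; apply.
have bc_i : alpha1 P * lim (cIm (u x) @[x --> (-1)^'+]) + alpha2 P * lim (cIm (cderive u x) @[x --> (-1)^'+]) = 0.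
  by have := congr1 cIm lbc; rewrite !cparts !mul0r !addr0; apply.
have [X [X2 Xae XE XA]] := Arel_of_solution pr pr1 (pcontinuous_lin lr (- li) pr pi) dr d2r tr_r tr_r1 bc_r.
have [Y [Y2 Yae YE YA]] := Arel_of_solution pi pi1 (pcontinuous_lin lr li pi pr) di d2i tr_i tr_i1 bc_i.
have XE' : X.2 = wprod n * (betap1 P * cRe (llim u 1) - betap2 P * cRe (llim (cderive u) 1)) := XE.
have YE' : Y.2 = wprod n * (betap1 P * cIm (llim u 1) - betap2 P * cIm (llim (cderive u) 1)) := YE.
have XA' Z : in_realH Z -> {ae mu, forall x, J x -> Z.1 x = wt x * (lr * cRe (u x) + - li * cIm (u x))} ->
    Z.2 = - (wprod n * (beta1 P * cRe (llim u 1) - beta2 P * cRe (llim (cderive u) 1))) ->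
    ArelP X Z by exact: XA.
have YA' Z : in_realH Z -> {ae mu, forall x, J x -> Z.1 x = wt x * (lr * cIm (u x) + li * cRe (u x))} ->
    Z.2 = - (wprod n * (beta1 P * cIm (llim u 1) - beta2 P * cIm (llim (cderive u) 1))) ->
    ArelP Y Z by exact: YA.
have rr := congr1 cRe rbc; have ri := congr1 cIm rbc.
rewrite !cparts in rr ri.
move: XE' YE' XA' YA' rr ri; set ur := cRe (llim u 1); set ui := cIm (llim u 1).
set vr := cRe (llim (cderive u) 1); set vi := cIm (llim (cderive u) 1) => XE' YE' XA' YA' rr ri.
(* Real part of the right boundary condition; [E2] is its imaginary part. Both components are
   coupled as long as [li] may be nonzero. *)
have E1 : (betap1 P * lr + beta1 P) * ur - betap1 P * li * ui
    - ((betap2 P * lr + beta2 P) * vr - betap2 P * li * vi) = 0.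
  have rr' : (betap1 P * lr - 0 * li + beta1 P) * ur - (betap1 P * li + 0 * lr + 0) * ui -
    ((betap2 P * lr - 0 * li + beta2 P) * vr - (betap2 P * li + 0 * lr + 0) * vi) = 0 := rr.
  by rewrite -[RHS]rr'; ring.
have E2 : (betap1 P * lr + beta1 P) * ui + betap1 P * li * ur
    - ((betap2 P * lr + beta2 P) * vi + betap2 P * li * vr) = 0.
  have ri' : (betap1 P * lr - 0 * li + beta1 P) * ui + (betap1 P * li + 0 * lr + 0) * ur -
    ((betap2 P * lr - 0 * li + beta2 P) * vi + (betap2 P * li + 0 * lr + 0) * vr) = 0 := ri.
  by rewrite -[RHS]ri'; ring.
have X2E : lr * X.2 - li * Y.2 = - (wprod n * (beta1 P * ur - beta2 P * vr)).
  rewrite XE' YE'; apply/eqP; rewrite -subr_eq0; apply/eqP.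
  by rewrite -[RHS](mulr0 (wprod n)) -E1; ring.
have Y2E : lr * Y.2 + li * X.2 = - (wprod n * (beta1 P * ui - beta2 P * vi)).
  rewrite XE' YE'; apply/eqP; rewrite -subr_eq0; apply/eqP.
  by rewrite -[RHS](mulr0 (wprod n)) -E2; ring.
have AX : ArelP X (lr *: X - li *: Y).
  apply: XA' => //.
  - by rewrite -scaleNr; apply: in_realHZD => //; exact: in_realHZ.
  - apply: ae_imp (ae_and Xae Yae) => x [H1 H2] Jx.
    rewrite -[(lr *: X - li *: Y).1 x]/(lr * X.1 x - li * Y.1 x) H1// H2//; ring.
have AY : ArelP Y (lr *: Y + li *: X).
  apply: YA' => //.
  - by apply: in_realHZD => //; exact: in_realHZ.
  - apply: ae_imp (ae_and Xae Yae) => x [H1 H2] Jx.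
    rewrite -[(lr *: Y + li *: X).1 x]/(lr * Y.1 x + li * X.1 x) H1// H2//; ring.
have R1pr : cRe (R1p P u) = betap1 P * cRe (llim u 1) - betap2 P * cRe (llim (cderive u) 1).
  by rewrite !cparts !mul0r !subr0.
have R1pi : cIm (R1p P u) = betap1 P * cIm (llim u 1) - betap2 P * cIm (llim (cderive u) 1).
  by rewrite !cparts !mul0r !addr0.
have uXY : {ae mu, forall x, J x -> X.1 x = wt x * cRe (u x) /\ Y.1 x = wt x * cIm (u x)}.
  by apply: ae_imp (ae_and Xae Yae) => x [H1 H2] Jx; rewrite H1// H2.
have mq : measurable_fun J q by apply: (pcontinuous_measurable (P := P)); exact: potential_pcontinuous.
have [Q qQ] := pcontinuous_bounded (@potential_pcontinuous _ P).
have := Arel_pair_real N11 mq qQ alpha_or (rho_gt0 P) AX AY => /eqP.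
(* Either the eigenvalue is real, or [X] and [Y] are both null; then the coupling terms vanish
   almost everywhere and the real part [lr] serves as eigenvalue. *)
rewrite mulf_eq0 => /orP[/eqP li0|/eqP e0].
  rewrite li0 !scale0r ?subr0 ?addr0 in AX AY.
  by exists lr, X, Y; split=> //; rewrite ?R1pr ?R1pi.
have [eX eY] := (eform_ge0 (rho_gt0 P) X2, eform_ge0 (rho_gt0 P) Y2).
have [Xae0 X20] : {ae mu, forall x, J x -> X.1 x = 0} /\ X.2 = 0.
  by apply: (eform_null (rho_gt0 P)) => //; move: e0 eX eY; rewrite /rho; lra.
have [Yae0 Y20] : {ae mu, forall x, J x -> Y.1 x = 0} /\ Y.2 = 0.
  by apply: (eform_null (rho_gt0 P)) => //; move: e0 eX eY; rewrite /rho; lra.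
exists lr, X, Y; split=> //; rewrite ?R1pr ?R1pi//.
- apply: XA'; first exact: in_realHZ.
    apply: ae_imp (ae_and (ae_and Xae Yae) Yae0) => x [[H1 H2] H3] Jx.
    rewrite -[(lr *: X).1 x]/(lr * X.1 x) H1//; have := H3 Jx; rewrite H2// => wi.
    by rewrite mulrDr [wt x * (- li * _)]mulrCA wi; ring.
  by rewrite -X2E Y20 mulr0 subr0.
- apply: YA'; first exact: in_realHZ.
    apply: ae_imp (ae_and (ae_and Xae Yae) Xae0) => x [[H1 H2] H3] Jx.
    rewrite -[(lr *: Y).1 x]/(lr * Y.1 x) H2//; have := H3 Jx; rewrite H1// => wi.
    by rewrite mulrDr [wt x * (li * _)]mulrCA wi; ring.
  by rewrite -Y2E X20 mulr0 addr0.
Qed.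

End Solutions.

(** * Transfer between the Hilbert space H and pairs of real functions *)

Section Transform.
Context {R : realType} (P : bvp R).
Local Notation mu := (@lebesgue_measure R).
Local Notation n := (npts P).
Local Notation h := (mesh P).
Local Notation J := `[(-1 : R), 1]%classic.
Local Notation I := (prim (-1 : R)).
Local Notation L1i := (L1i (-1 : R) 1).
Local Notation L2i := (L2i (-1 : R) 1).
Local Notation pcontinuous := (pcontinuous P).
Local Notation wt := (wt P).
Local Notation wprod := (wprod P).
Local Notation cRe := (@complex.Re R).
Local Notation cIm := (@complex.Im R).
Local Notation in_realH := (in_realH (-1) 1).
Local Notation in_pairH := (in_pairH (-1) 1).
Local Notation eformP := (eform (-1) 1 (beta1 P) (beta2 P) (betap1 P) (betap2 P)).
Local Notation vformP := (vform (-1) 1 (beta1 P) (beta2 P) (betap1 P) (betap2 P)).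
Local Notation N11 := (lt_N11 (R := R)).
Implicit Types (F G : Hspace (R := R)) (W : @pairH R) (g : R -> R).

Lemma wt_bounded : exists M, forall x, J x -> `|wt x| <= M.
Proof. by apply: (pcontinuous_bounded (P := P)); exact: pcontinuous_wt. Qed.
Lemma wt_measurable : measurable_fun J wt.
Proof. by apply: (pcontinuous_measurable (P := P)); exact: pcontinuous_wt. Qed.
Lemma L2_wtM g : L2i g -> L2i (fun x => wt x * g x).
Proof. by move=> g2; have [M wM] := wt_bounded; exact: L2M_bounded g2 wt_measurable wM. Qed.

Lemma L2P (u : R -> R[i]) : L2 `](-1), 1[ u <->
  L2i (fun x => cRe (u x)) /\ L2i (fun x => cIm (u x)).
Proof.
have mJ (f : R -> R) : measurable_fun `](-1 : R), 1[ f <-> measurable_fun J f.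
  split; last by apply: measurable_funS => //; apply: subset_itv; rewrite bnd_simp.
  exact: (@measurable_fun_itv_cc R (-1) 1 false true f).
have E (f : R -> R) : measurable_fun J f ->
    (\int[mu]_(x in `](-1)%R, 1%R[) (f x)%:E = \int[mu]_(x in J) (f x)%:E)%E.
  move=> mf; rewrite [RHS]integral_itv_bndoo//; apply/measurable_EFinP; exact/mJ.
have mN (f g : R -> R) : measurable_fun J f -> measurable_fun J g ->
    measurable_fun J (fun x => f x ^+ 2 + g x ^+ 2).
  by move=> mf mg; apply: measurable_funD; exact: measurable_funX.
have nE : (fun x => ComplexField.Normc.normc (u x) ^+ 2) = (fun x => cRe (u x) ^+ 2 + cIm (u x) ^+ 2).
  by apply/funext => x; rewrite normc_sqr.
have EI : (\int[mu]_(x in `](-1)%R, 1%R[) (ComplexField.Normc.normc (u x) ^+ 2)%:E)%E =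
  (\int[mu]_(x in `](-1)%R, 1%R[) (cRe (u x) ^+ 2 + cIm (u x) ^+ 2)%:E)%E.
  by apply: eq_integral => x _; rewrite normc_sqr.
split.
  move=> [[/mJ mr /mJ mi]]; rewrite EI E; last exact: mN.
  move=> fin; have s1 : L1i (fun x => cRe (u x) ^+ 2 + cIm (u x) ^+ 2).
    by apply: L1_ge0P => //; [exact: mN|move=> x _; rewrite addr_ge0 ?sqr_ge0].
  split; split=> //; apply: L1_le s1; try exact: measurable_funX.
  - by move=> x _; rewrite ger0_norm ?sqr_ge0// lerDl sqr_ge0.
  - by move=> x _; rewrite ger0_norm ?sqr_ge0// lerDr sqr_ge0.
move=> [[mr r2] [mi i2]]; split; first by split; exact/mJ.
rewrite EI E; last exact: mN.
by rewrite (prim_EFin (L1D r2 i2)) ltry.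
Qed.

Definition Tr F : @pairH R :=
  ((fun x => wt x * cRe (F.1 x), wprod n * cRe F.2), (fun x => wt x * cIm (F.1 x), wprod n * cIm F.2)).
(** Multiplication by [i]. *)
Definition Jrot W : @pairH R := (- W.2, W.1).

Lemma in_pairH_Jrot W : in_pairH W -> in_pairH (Jrot W).
Proof.
move=> [W1 W2]; split=> //; have := @in_realHZ _ _ _ N11 (-1) _ W2; by rewrite scaleN1r.
Qed.
Lemma in_pairH_Tr F : inH F -> in_pairH (Tr F).
Proof. by move=> /L2P[r2 i2]; split; exact: L2_wtM. Qed.

Lemma eform_Nl X Y : in_realH X -> in_realH Y -> eformP (- X) Y = - eformP X Y.
Proof.
by move=> X2 Y2; rewrite -scaleN1r (eform_Z N11 (rho_gt0 P)) ?mulN1r.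
Qed.
Lemma eform_Nr X Y : in_realH X -> in_realH Y -> eformP X (- Y) = - eformP X Y.
Proof. by move=> X2 Y2; rewrite eform_sym eform_Nl// eform_sym. Qed.
Lemma vform_Jrot W W' : in_pairH W -> in_pairH W' -> vformP (Jrot W) W' = - vformP W (Jrot W').
Proof.
move=> [? ?] [? ?]; rewrite /vform/= eform_Nl// eform_Nr//; ring.
Qed.
Lemma vform_JrotJ W W' : in_pairH W -> in_pairH W' -> vformP (Jrot W) (Jrot W') = vformP W W'.
Proof.
move=> WV WV'; have [? ?] := WV; have [? ?] := WV'.
rewrite vform_Jrot//; last exact: in_pairH_Jrot.
by rewrite /vform /Jrot /= !eform_Nr//; ring.
Qed.
Lemma vform_Jrot_self W : in_pairH W -> vformP W (Jrot W) = 0.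
Proof.
by move=> [? ?]; rewrite /vform/= eform_Nr// (eform_sym _ _ _ _ _ _ W.2); ring.
Qed.

(** On each piece the square of [wt] is the product of the squared [delta P j] that weights this
    piece in [ip]. *)
Lemma sum_pieces g : L1i g ->
  \sum_(1 <= i < n.+2) (\prod_(1 <= j < i) delta P j ^+ 2) *
    \int[mu]_(x in `[h i.-1, h i]) g x = I (fun x => wt x * (wt x * g x)) 1.
Proof.
move=> g1; have wg1 : L1i (fun x => wt x * (wt x * g x)).
  have [M wM] := wt_bounded; apply: (L1M _ wt_measurable wM).
  exact: (L1M g1 wt_measurable wM).
rewrite big_add1/=.
suff H k : (k <= n.+1)%N -> \sum_(0 <= i < k) (\prod_(1 <= j < i.+1) delta P j ^+ 2) *
    \int[mu]_(x in `[h i, h i.+1]) g x = I (fun x => wt x * (wt x * g x)) (h k).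
  by rewrite H// mesh_last.
elim: k => [_|k IH kn]; first by rewrite big_nil mesh0 prim_a.
have hk := mesh_lt kn.
rewrite big_nat_recr//= IH; last exact: ltnW.
have -> : I (fun t => wt t * (wt t * g t)) (h k.+1) = I (fun t => wt t * (wt t * g t)) (h k) +
  (I (fun t => wt t * (wt t * g t)) (h k.+1) - I (fun t => wt t * (wt t * g t)) (h k)) by rewrite addrC subrK.
congr (_ + _); rewrite (prim_sub wg1 (mesh_ge (ltnW kn)) (ltW hk) (mesh_le kn)).
have subc := @cpiece_sub _ P k kn.
have wgi : mu.-integrable `]h k, h k.+1] (EFin \o (fun t => wt t * (wt t * g t))).
  by apply: integrableS wg1 => //; apply: subset_trans subc; apply: subset_itvr; rewrite bnd_simp.
have gi : mu.-integrable `[h k, h k.+1] (EFin \o g) by apply: integrableS g1.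
rewrite Rintegral_itv_obnd_cbnd// prodrXl -RintegralZl// /Rintegral; congr fine.
have subo : `]h k, h k.+1[%classic `<=` J.
  by apply: subset_trans subc; apply: subset_itv; rewrite bnd_simp.
apply: eq_integral_itv_bounded.
- apply: measurable_funM => //; apply: measurable_funS (L1_measurable g1) => //.
- exact: measurable_funS (L1_measurable wg1).
- move=> t; rewrite in_itv/= => ti.
  by rewrite (wt_piece kn ti) expr2 /wprod mulrA.
Qed.

Lemma cRe_sum (s : seq nat) (f : nat -> R[i]) : cRe (\sum_(i <- s) f i) = \sum_(i <- s) cRe (f i).
Proof. exact: (big_morph _ cReD erefl). Qed.
Lemma cIm_sum (s : seq nat) (f : nat -> R[i]) : cIm (\sum_(i <- s) f i) = \sum_(i <- s) cIm (f i).
Proof. exact: (big_morph _ cImD erefl). Qed.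

Lemma ip_Re F G : inH F -> inH G -> cRe (ip P F G) = vformP (Tr F) (Tr G).
Proof.
move=> FH GH; have /L2P[Fr Fi] := FH; have /L2P[Gr Gi] := GH.
have rr := L2M Fr Gr; have ii := L2M Fi Gi.
pose g x := cRe (F.1 x) * cRe (G.1 x) + cIm (F.1 x) * cIm (G.1 x).
rewrite cReD cRe_sum.
rewrite [X in X + _](_ : _ = \sum_(1 <= i < n.+2) (\prod_(1 <= j < i) delta P j ^+ 2) *
    \int[mu]_(x in `[h i.-1, h i]) g x); last first.
  apply: eq_bigr => i _; rewrite cReM cRec cImc mul0r subr0; congr (_ * _).
  by apply: eq_Rintegral => x _; rewrite cReM cReJ cImJ /g; ring.
rewrite sum_pieces; last exact: L1D.
have -> : I (fun x => wt x * (wt x * g x)) 1 =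
    I (fun x => (wt x * cRe (F.1 x)) * (wt x * cRe (G.1 x))) 1 +
    I (fun x => (wt x * cIm (F.1 x)) * (wt x * cIm (G.1 x))) 1.
  rewrite -(primD (lexx 1) (L2M (L2_wtM Fr) (L2_wtM Gr)) (L2M (L2_wtM Fi) (L2_wtM Gi))).
  by apply: eq_Rintegral => x _; rewrite /g; ring.
rewrite cReM cRec cImc mul0r subr0 cReM cReJ cImJ prodrXl -/(wprod n) /vform /eform/= /rho.
by field; rewrite gt_eqF//; exact: rho_gt0.
Qed.

(** The product is antilinear in its second argument, so its imaginary part is the real part of the
    product of [F] with [i G]. *)
Lemma ip_Im F G : inH F -> inH G -> cIm (ip P F G) = vformP (Tr F) (Jrot (Tr G)).
Proof.
move=> FH GH; have /L2P[Fr Fi] := FH; have /L2P[Gr Gi] := GH.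
have ri := L2M Fr Gi; have ir := L2M Fi Gr.
pose g x := cIm (F.1 x) * cRe (G.1 x) - cRe (F.1 x) * cIm (G.1 x).
rewrite cImD cIm_sum.
rewrite [X in X + _](_ : _ = \sum_(1 <= i < n.+2) (\prod_(1 <= j < i) delta P j ^+ 2) *
    \int[mu]_(x in `[h i.-1, h i]) g x); last first.
  apply: eq_bigr => i _; rewrite cImM cRec cImc mul0r addr0; congr (_ * _).
  by apply: eq_Rintegral => x _; rewrite cImM cReJ cImJ /g; ring.
rewrite sum_pieces; last exact: L1B.
have -> : I (fun x => wt x * (wt x * g x)) 1 =
    I (fun x => (wt x * cIm (F.1 x)) * (wt x * cRe (G.1 x))) 1 -
    I (fun x => (wt x * cRe (F.1 x)) * (wt x * cIm (G.1 x))) 1.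
  rewrite -(primB (lexx 1) (L2M (L2_wtM Fi) (L2_wtM Gr)) (L2M (L2_wtM Fr) (L2_wtM Gi))).
  by apply: eq_Rintegral => x _; rewrite /g; ring.
rewrite cImM cRec cImc mul0r addr0 cImM cReJ cImJ prodrXl -/(wprod n) /vform.
have [T1 T2] := in_pairH_Tr FH; have [S1 S2] := in_pairH_Tr GH.
rewrite {1}/Jrot /= eform_Nr// /eform/= /rho.
by field; rewrite gt_eqF//; exact: rho_gt0.
Qed.

Lemma ip_vform F G : inH F -> inH G -> ip P F G = vformP (Tr F) (Tr G) +i* vformP (Tr F) (Jrot (Tr G)).
Proof. by move=> FH GH; apply: complex_ext; [exact: ip_Re|exact: ip_Im]. Qed.

Lemma Hnorm_seminorm F : inH F -> Hnorm P F = seminorm vformP (Tr F).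
Proof. by move=> FH; rewrite /Hnorm ip_Re. Qed.

Lemma TrD F G : Tr (F + G) = Tr F + Tr G.
Proof.
congr ((_, _), (_, _)).
- by apply/funext => x; rewrite -[(F + G).1 x]/(F.1 x + G.1 x) cReD mulrDr.
- by rewrite -[(F + G).2]/(F.2 + G.2) cReD mulrDr.
- by apply/funext => x; rewrite -[(F + G).1 x]/(F.1 x + G.1 x) cImD mulrDr.
- by rewrite -[(F + G).2]/(F.2 + G.2) cImD mulrDr.
Qed.
Lemma TrZ (c : R[i]) F : Tr (c *: F) = cRe c *: Tr F + cIm c *: Jrot (Tr F).
Proof.
congr ((_, _), (_, _)).
- apply/funext => x; rewrite -[(c *: F).1 x]/(c * F.1 x) cReM.
  rewrite -[RHS]/(cRe c * (wt x * cRe (F.1 x)) + cIm c * - (wt x * cIm (F.1 x))); ring.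
- rewrite -[(c *: F).2]/(c * F.2) cReM.
  rewrite -[RHS]/(cRe c * (wprod n * cRe F.2) + cIm c * - (wprod n * cIm F.2)); ring.
- apply/funext => x; rewrite -[(c *: F).1 x]/(c * F.1 x) cImM.
  rewrite -[RHS]/(cRe c * (wt x * cIm (F.1 x)) + cIm c * (wt x * cRe (F.1 x))); ring.
- rewrite -[(c *: F).2]/(c * F.2) cImM.
  rewrite -[RHS]/(cRe c * (wprod n * cIm F.2) + cIm c * (wprod n * cRe F.2)); ring.
Qed.

End Transform.

(** * From eigenvectors of the real operator back to eigenfunctions of [A] *)

Section Eigenfunctions.
Context {R : realType} (P : bvp R).
Local Notation mu := (@lebesgue_measure R).
Local Notation n := (npts P).
Local Notation h := (mesh P).
Local Notation J := `[(-1 : R), 1]%classic.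
Local Notation I := (prim (-1 : R)).
Local Notation L1i := (L1i (-1 : R) 1).
Local Notation L2i := (L2i (-1 : R) 1).
Local Notation pcontinuous := (pcontinuous P).
Local Notation wt := (wt P).
Local Notation wprod := (wprod P).
Local Notation q := (potential P).
Local Notation cRe := (@complex.Re R).
Local Notation cIm := (@complex.Im R).
Local Notation in_realH := (in_realH (-1) 1).
Local Notation in_pairH := (in_pairH (-1) 1).
Local Notation eformP := (eform (-1) 1 (beta1 P) (beta2 P) (betap1 P) (betap2 P)).
Local Notation vformP := (vform (-1) 1 (beta1 P) (beta2 P) (betap1 P) (betap2 P)).
Local Notation N11 := (lt_N11 (R := R)).
Implicit Types (F G : Hspace (R := R)) (W : @pairH R).

Lemma eform_ae (X X' Z : @realH R) : in_realH X -> in_realH X' -> in_realH Z ->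
  {ae mu, forall x, J x -> X.1 x = X'.1 x} -> X.2 = X'.2 -> eformP Z X = eformP Z X'.
Proof.
move=> [mX _] [mX' _] [mZ _] H e2; rewrite /eform e2; congr (_ + _).
apply: (eq_prim_ae (lexx 1)); [exact: measurable_funM|exact: measurable_funM|].
by apply: ae_imp H => x /[apply] ->.
Qed.

Lemma ae_itvoo (p : R -> Prop) : {ae mu, forall x, x \in `](-1 : R), 1[ -> p x} ->
  {ae mu, forall x, J x -> p x}.
Proof.
move=> H; apply: ae_imp (ae_and H (ae_and (ae_neq (-1)) (ae_neq 1))) => x [Hx [x0 x1]] Jx.
by apply: Hx; move: Jx; rewrite /= !in_itv/= !lt_neqAle x1 eq_sym x0.
Qed.

Lemma vform_Heq F G W : inH F -> inH G -> in_pairH W -> Heq F G ->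
  vformP W (Tr P F) = vformP W (Tr P G).
Proof.
move=> FH GH [W1 W2] [/ae_itvoo Hae H2].
have [F1 F2] := in_pairH_Tr P FH; have [G1 G2] := in_pairH_Tr P GH.
rewrite /vform (eform_ae F1 G1 W1) ?(eform_ae F2 G2 W2)//=; rewrite ?H2//.
- by apply: ae_imp Hae => x /[apply] ->.
- by apply: ae_imp Hae => x /[apply] ->.
Qed.

Lemma scaled_derive (f g : R -> R) c x : derivable f x 1 -> (\forall t \near x, c * f t = g t) ->
  derivable g x 1 /\ derive1 g x = c * derive1 f x.
Proof.
move=> df fg; have Df : is_derive x (1 : R) f (derive1 f x).
  by rewrite derive1E; apply: DeriveDef.
have H : is_derive x (1 : R) (fun t => c * f t) (c * derive1 f x).
  exact: (@is_deriveZ _ _ _ f c x 1 _ Df).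
have [H1 H2] := near_eq_is_derive fg H.
by rewrite derive1E H2.
Qed.

Lemma piece_nbhs i x : h i < x < h i.+1 -> \forall t \near x, h i < t < h i.+1.
Proof.
move=> /andP[x1 x2]; near=> t; apply/andP; split; near: t; [exact: lt_nbhsr|exact: lt_nbhsl].
Unshelve. all: by end_near. Qed.

Lemma prim_derive c (f y : R -> R) i x : L1i f -> (forall t, J t -> y t = c + I f t) ->
  (i <= n)%N -> h i < x < h i.+1 -> {for x, continuous f} ->
  derivable y x 1 /\ derive1 y x = f x.
Proof.
move=> f1 yE ilen xi fx; have /andP[x1 x2] := xi.
have xlt1 : x < 1 by apply: lt_le_trans x2 _; exact: mesh_le.
have xgt : -1 < x by apply: le_lt_trans x1; apply: mesh_ge; exact: leqW.
have [d1 d2] := continuous_FTC1_closed xlt1 f1 xgt fx.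
have D : is_derive x (1 : R) (I f) (f x) by rewrite -d2 derive1E; apply: DeriveDef.
have D' : is_derive x (1 : R) (fun t => c + I f t) (0 + f x).
  exact: (@is_deriveD _ _ _ (cst c) (I f) x 1 0 (f x) (is_derive_cst _ _ _) D).
have nE : \forall t \near x, c + I f t = y t.
  by apply: filterS (piece_nbhs xi) => t ti; rewrite yE//; exact: (piece_sub ilen).
have [H1 H2] := near_eq_is_derive nE D'.
by rewrite derive1E H2 add0r.
Qed.

Lemma continuousJ_at f i x : {within J, continuous f} -> (i <= n)%N -> h i < x < h i.+1 ->
  {for x, continuous (f : R -> R)}.
Proof.
move=> cf ilen xi.
have sub : `]h i, h i.+1[%classic `<=` J.
  by move=> t /=; rewrite in_itv/=; exact: piece_sub.
have := continuous_subspaceW sub cf.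
by rewrite continuous_open_subspace//; apply; rewrite ?inE/= ?in_itv.
Qed.

Lemma piece_lims (v : R -> R[i]) (F G : R -> R) i : (i <= n)%N ->
  {within J, continuous F} -> {within J, continuous G} ->
  (forall x, h i < x < h i.+1 -> v x = ((wprod i)^-1 * F x) +i* ((wprod i)^-1 * G x)) ->
  rlim v (h i) = ((wprod i)^-1 * F (h i)) +i* ((wprod i)^-1 * G (h i)) /\
  llim v (h i.+1) = ((wprod i)^-1 * F (h i.+1)) +i* ((wprod i)^-1 * G (h i.+1)).
Proof.
move=> ilen cF cG vE; have hi := mesh_lt ilen.
have sc (H : R -> R) : {within J, continuous H} ->
    {within `[h i, h i.+1], continuous (fun x => (wprod i)^-1 * H x)}.
  move=> cH; have cH' := continuous_subspaceW (@cpiece_sub _ P i ilen) cH.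
  by move=> x; apply: cvgMr; exact: cH'.
split; congr (_ +i* _); apply: cvg_lim => //.
- by apply: (within_cvg_right hi (sc _ cF)) => x xi; rewrite vE.
- by apply: (within_cvg_right hi (sc _ cG)) => x xi; rewrite vE.
- by apply: (within_cvg_left hi (sc _ cF)) => x xi; rewrite vE.
- by apply: (within_cvg_left hi (sc _ cG)) => x xi; rewrite vE.
Qed.

Lemma tau_algebra (a b qx lam : R) :
  - (((qx - lam) * a) +i* ((qx - lam) * b)) + qx%:C * (a +i* b) = lam%:C * (a +i* b).
Proof. by apply: complex_ext => /=; ring. Qed.

Lemma complex_scale (d a b : R) : d%:C * (a +i* b) = (d * a) +i* (d * b).
Proof. by apply: complex_ext => /=; ring. Qed.
Lemma complex_lincomb (a b c d e f : R) :
  a%:C * (c +i* d) + b%:C * (e +i* f) = (a * c + b * e) +i* (a * d + b * f).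
Proof. by apply: complex_ext => /=; ring. Qed.

(** Division by [wt] restores the jumps of the transmission conditions. It turns an eigenvector
    orthogonal to the given family into an admissible competitor in the maximality hypothesis. *)
Lemma eigen_pair_A_eigenfunction W lam : ArelP P W.1 (lam *: W.1) -> ArelP P W.2 (lam *: W.2) ->
  vformP W W != 0 -> exists U, [/\ inH U, Tr P U = W & A_eigenfunction P U].
Proof.
move=> AX AY Wn0; have [X2 Y2] := (Arel_in_realH N11 AX, Arel_in_realH N11 AY).
have WV : in_pairH W by [].
have Lmeas : pcontinuous q := @potential_pcontinuous _ P.
have mq : measurable_fun J q := pcontinuous_measurable Lmeas.
have [Q qQ] := pcontinuous_bounded Lmeas.
(* For an eigenvector the integrands are continuous inside each piece, so both equations can be
   differentiated there; boundedness of the integrands gives Lipschitz bounds, hence absolute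
   continuity up to the end points. *)
have regular (X : @realH R) y1 : solves (-1) 1 q (fun t => - (lam *: X).1 t) (X.1 (-1)) (y1 (-1)) X.1 y1 ->
    [/\ forall i x, (i <= n)%N -> h i < x < h i.+1 -> derivable X.1 x 1 /\ derive1 X.1 x = y1 x,
        forall i x, (i <= n)%N -> h i < x < h i.+1 -> derivable y1 x 1 /\ derive1 y1 x = (q x - lam) * X.1 x
      & exists M, forall x x', J x -> J x' ->
         `|X.1 x - X.1 x'| <= M * `|x - x'| /\ `|y1 x - y1 x'| <= M * `|x - x'|].
  move=> [cy cy1 yE y1E].
  have y1E' x : J x -> y1 x = y1 (-1) + I (fun t => (q t - lam) * X.1 t) x.
    move=> Jx; rewrite y1E//; congr (_ + _); apply: eq_Rintegral => t _.
    rewrite -[(lam *: X).1 t]/(lam * X.1 t); ring.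
  have [My yM] := bounded_continuousJ cy; have [My1 y1M] := bounded_continuousJ cy1.
  have My0 : 0 <= My by apply: le_trans (yM 1 _); rewrite //= in_itv/= lexx andbT ltW.
  have mql : measurable_fun J (fun t => q t - lam) by apply: measurable_funB => //; exact: measurable_cst.
  have qlQ t : J t -> `|q t - lam| <= Q + `|lam|.
    by move=> Jt; apply: le_trans (ler_normB _ _) _; rewrite lerD2r qQ.
  have qy1 : L1i (fun t => (q t - lam) * X.1 t) := L1M (continuous_L1 N11 cy) mql qlQ.
  have y11 := continuous_L1 N11 cy1.
  split.
  - move=> i x ilen xi; apply: (prim_derive y11 yE ilen xi).
    exact: continuousJ_at cy1 ilen xi.
  - move=> i x ilen xi; apply: (prim_derive qy1 y1E' ilen xi).
    apply: cvgM; last exact: (continuousJ_at cy ilen xi).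
    by apply: cvgB; [exact: potential_continuous_at ilen xi|exact: cvg_cst].
  exists (Num.max My1 ((Q + `|lam|) * My)) => x x' Jx Jx'; split.
    rewrite [X.1 x]yE// [X.1 x']yE// opprD addrACA subrr add0r.
    apply: le_trans (prim_lip N11 y11 y1M Jx Jx') _.
    by rewrite ler_wpM2r// le_max lexx.
  rewrite [y1 x]y1E'// [y1 x']y1E'// opprD addrACA subrr add0r.
  apply: le_trans (prim_lip N11 qy1 (M := (Q + `|lam|) * My) _ Jx Jx') _.
    by move=> t Jt; rewrite normrM ler_pM// ?qlQ// yM.
  by rewrite ler_wpM2r// le_max lexx orbT.
have [y1 [ySol ybc yR1p yR1]] := AX; have [z1 [zSol zbc zR1p zR1]] := AY.
have [dy dy1 [My ylip]] := regular _ _ ySol; have [dz dz1 [Mz zlip]] := regular _ _ zSol.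
have [cy cy1 _ _] := ySol; have [cz cz1 _ _] := zSol.
set y : R -> R := W.1.1 in dy dy1 ylip cy ybc yR1p yR1.
set z : R -> R := W.2.1 in dz dz1 zlip cz zbc zR1p zR1.
pose u (x : R) : R[i] := (y x / wt x) +i* (z x / wt x).
pose U : Hspace (R := R) := (u, (W.1.2 / wprod n) +i* (W.2.2 / wprod n)).
have uE i x : (i <= n)%N -> h i < x < h i.+1 ->
    u x = ((wprod i)^-1 * y x) +i* ((wprod i)^-1 * z x).
  by move=> ilen xi; rewrite /u (wt_piece ilen xi) mulrC [z x / _]mulrC.
have du i x : (i <= n)%N -> h i < x < h i.+1 -> cderivable u x /\
    cderive u x = ((wprod i)^-1 * y1 x) +i* ((wprod i)^-1 * z1 x).
  move=> ilen xi; have [d1 e1] := dy i x ilen xi; have [d2 e2] := dz i x ilen xi.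
  have [|a1 b1] := @scaled_derive y (fun t => cRe (u t)) (wprod i)^-1 x d1.
    by apply: filterS (piece_nbhs xi) => t ti; rewrite (uE i).
  have [|a2 b2] := @scaled_derive z (fun t => cIm (u t)) (wprod i)^-1 x d2.
    by apply: filterS (piece_nbhs xi) => t ti; rewrite (uE i).
  by split=> //; rewrite /cderive b1 b2 e1 e2.
have du2 i x : (i <= n)%N -> h i < x < h i.+1 ->
    cderive (cderive u) x = ((q x - lam) * ((wprod i)^-1 * y x)) +i* ((q x - lam) * ((wprod i)^-1 * z x)).
  move=> ilen xi; have [d1 e1] := dy1 i x ilen xi; have [d2 e2] := dz1 i x ilen xi.
  have [|a1 b1] := @scaled_derive y1 (fun t => cRe (cderive u t)) (wprod i)^-1 x d1.
    by apply: filterS (piece_nbhs xi) => t ti; rewrite (du i t ilen ti).2.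
  have [|a2 b2] := @scaled_derive z1 (fun t => cIm (cderive u t)) (wprod i)^-1 x d2.
    by apply: filterS (piece_nbhs xi) => t ti; rewrite (du i t ilen ti).2.
  by rewrite {1}/cderive b1 b2 e1 e2 mulrCA [X in _ +i* X]mulrCA.
have tauE i x : (i <= n)%N -> h i < x < h i.+1 -> tau P u x = lam%:C * u x.
  move=> ilen xi; rewrite /tau (du2 i x ilen xi) (uE i x ilen xi).
  exact: tau_algebra.
have limu i : (i <= n)%N -> _ := fun ilen => piece_lims ilen cy cz (fun x xi => uE i x ilen xi).
have limu1 i : (i <= n)%N -> _ := fun ilen => piece_lims ilen cy1 cz1 (fun x xi => (du i x ilen xi).2).
have w0 : wprod 0 = 1 := wprod0 P.
have wn0 i : (i <= n)%N -> wprod i != 0 := @wprod_neq0 _ P i.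
have TrU : Tr P U = W.
  rewrite (surjective_pairing W) (surjective_pairing W.1) (surjective_pairing W.2).
  congr ((_, _), (_, _)) => /=.
  - by apply/funext => x; rewrite mulrC divfK// wt_neq0.
  - by rewrite mulrC divfK// wn0.
  - by apply/funext => x; rewrite mulrC divfK// wt_neq0.
  - by rewrite mulrC divfK// wn0.
have pcE (f F : R -> R) : {within J, continuous F} ->
    (forall i x, (i <= n)%N -> h i < x < h i.+1 -> f x = (wprod i)^-1 * F x) -> L2i f.
  move=> cF fF; apply: (pcontinuous_L2 (P := P)) => i ilen.
  exists (fun x => (wprod i)^-1 * F x); last by move=> x xi; exact: fF.
  have cF' := continuous_subspaceW (@cpiece_sub _ P i ilen) cF.
  by move=> x; apply: cvgMr; exact: cF'.
have clam (F : R -> R) : {within J, continuous F} -> {within J, continuous (fun x => lam * F x)}.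
  by move=> cF x; apply: cvgMr; exact: cF.
have UH : inH U.
  apply/L2P; split; [apply: (pcE _ y cy)|apply: (pcE _ z cz)] => i x ilen xi /=.
    by rewrite (wt_piece ilen xi) mulrC.
  by rewrite (wt_piece ilen xi) mulrC.
exists U; split=> //.
have lu : llim u 1 = ((wprod n)^-1 * y 1) +i* ((wprod n)^-1 * z 1).
  by have [_] := limu n (leqnn n); rewrite mesh_last.
have lu1 : llim (cderive u) 1 = ((wprod n)^-1 * y1 1) +i* ((wprod n)^-1 * z1 1).
  by have [_] := limu1 n (leqnn n); rewrite mesh_last.
have NC (r : R) : - r%:C = (- r)%:C by rewrite rmorphN.
have R1pE : U.2 = R1p P u.
  rewrite /R1p lu lu1 -mulNr NC complex_lincomb /U/= yR1p zR1p; congr (_ +i* _); ring.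
have R1E : - R1 P u = lam%:C * U.2.
  rewrite /R1 lu lu1 -mulNr NC complex_lincomb /U/=.
  have yR : lam * W.1.2 = - (beta1 P * y 1 - beta2 P * y1 1) := yR1.
  have zR : lam * W.2.2 = - (beta1 P * z 1 - beta2 P * z1 1) := zR1.
  rewrite complex_scale !mulrA yR zR.
  by apply: complex_ext; rewrite /=; ring.
have AC (F G : R -> R) c i : (i <= n)%N ->
    (forall x x', J x -> J x' -> `|F x - F x'| <= My * `|x - x'|) ->
    (forall x x', J x -> J x' -> `|G x - G x'| <= Mz * `|x - x'|) ->
    absolutely_continuous (h i) (h i.+1) (fun x => (c * F x) +i* (c * G x)).
  move=> ilen FM GM.
  have JI x : h i <= x <= h i.+1 -> J x.
    by move=> xi; apply: (cpiece_sub ilen); rewrite /= in_itv.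
  apply: (Lipschitz_AC (M := `|c| * Num.max My Mz)) => x x' /JI Jx /JI Jx'.
  - rewrite /= -mulrBr normrM -mulrA ler_wpM2l//; apply: le_trans (FM _ _ Jx Jx') _.
    by rewrite ler_wpM2r// le_max lexx.
  - rewrite /= -mulrBr normrM -mulrA ler_wpM2l//; apply: le_trans (GM _ _ Jx Jx') _.
    by rewrite ler_wpM2r// le_max lexx orbT.
have domU : domA P U.
  split=> //.
  - split=> // i ilen; split.
    + exists (fun x => ((wprod i)^-1 * y x) +i* ((wprod i)^-1 * z x)).
        by move=> x; rewrite in_itv/=; exact: uE.
      apply: AC => // x x' Jx Jx'; [exact: (ylip x x' Jx Jx').1|exact: (zlip x x' Jx Jx').1].
    + by move=> x; rewrite in_itv/= => xi; have [] := du i x ilen xi.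
    + exists (fun x => ((wprod i)^-1 * y1 x) +i* ((wprod i)^-1 * z1 x)).
        by move=> x; rewrite in_itv/= => xi; have [] := du i x ilen xi.
      apply: AC => // x x' Jx Jx'; [exact: (ylip x x' Jx Jx').2|exact: (zlip x x' Jx Jx').2].
  - apply/L2P; split; [apply: (pcE _ _ (clam y cy))|apply: (pcE _ _ (clam z cz))] => i x ilen xi.
      by rewrite (tauE i x ilen xi) (uE i x ilen xi) /=; ring.
    by rewrite (tauE i x ilen xi) (uE i x ilen xi) /=; ring.
  - have [ru _] := limu 0%N (leq0n _); have [ru1 _] := limu1 0%N (leq0n _).
    rewrite mesh0 in ru ru1.
    rewrite /left_bc ru ru1 w0 invr1 !mul1r complex_lincomb ybc zbc //.
  - case=> // i /= ilen; have iltn := ltnW ilen.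
    (* Across [h i.+1] the functions [y] and [y1] are continuous and only the factor [1 / wprod]
       changes, which is the transmission condition. *)
    have dw : (wprod i)^-1 = delta P i.+1 * (wprod i.+1)^-1.
      by rewrite wprodS invfM mulrCA mulfV ?mulr1// delta_neq0.
    split.
      by rewrite (limu i iltn).2 (limu i.+1 ilen).1 complex_scale !mulrA -dw.
    by rewrite (limu1 i iltn).2 (limu1 i.+1 ilen).1 complex_scale !mulrA -dw.
split=> //.
- move=> H0; have H0' : inH (0 : Hspace (R := R)).
    by apply/L2P; split; exact: (L2_cst N11 0).
  move: Wn0; have -> : vformP W W = vformP W (Tr P 0) by rewrite -(vform_Heq UH H0' WV H0) TrU.
  have -> : Tr P 0 = 0 *: W.
    by rewrite -[X in Tr P X](scale0r (0 : Hspace (R := R))) TrZ !scale0r addr0.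
  rewrite vform_sym /vform (eform_Z N11 (rho_gt0 P))// (eform_Z N11 (rho_gt0 P))//.
  by rewrite !mul0r addr0 eqxx.
- exists lam%:C; split.
    have H : {ae mu, forall x, J x -> tau P u x = lam%:C * u x}.
      by apply: ae_pieces => i x ilen xi; exact: (tauE i x ilen xi).
    apply: ae_imp H => x Hx xi; apply: Hx.
    by move: xi; rewrite /= !in_itv/= => /andP[/ltW -> /ltW ->].
  exact: R1E.
Unshelve. all: exact: P. Qed.

End Eigenfunctions.

(** * Complex expansions as real ones, maximality and conclusion *)

Section Completeness.
Context {R : realType} (P : bvp R).
Local Notation J := `[(-1 : R), 1]%classic.
Local Notation L2i := (L2i (-1 : R) 1).
Local Notation cRe := (@complex.Re R).
Local Notation cIm := (@complex.Im R).
Local Notation in_pairH := (in_pairH (-1) 1).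
Local Notation vformP := (vform (-1) 1 (beta1 P) (beta2 P) (betap1 P) (betap2 P)).
Local Notation N11 := (lt_N11 (R := R)).
Implicit Types (F G : Hspace (R := R)) (W : @pairH R).

Let mq : measurable_fun J (potential P).
Proof. exact: pcontinuous_measurable (@potential_pcontinuous _ P). Qed.

Lemma ArelP_Z k (X Z : @realH R) : L2i Z.1 -> ArelP P X Z -> ArelP P (k *: X) (k *: Z).
Proof.
move=> Z2 [y1 [S bc e1 e2]].
have [Q qQ] := pcontinuous_bounded (@potential_pcontinuous _ P).
have Z1 : L1i (-1) 1 (fun t => - Z.1 t).
  by apply: L1_eq (L1Z (-1) (L2_L1 N11 Z2)) => t _; rewrite mulN1r.
(* Scaling by [k] obtained from the linear combination of the solution with itself, with factors
   [k - 1] and 1. *)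
have S' := solves_ZD N11 mq qQ (k - 1) Z1 Z1 S S.
have E (a : R) : (k - 1) * a + a = k * a by ring.
exists (fun t => k * y1 t); split.
- rewrite -[(k *: X).1]/(fun t => k * X.1 t).
  rewrite (_ : (fun t => - (k *: Z).1 t) = (fun t => (k - 1) * - Z.1 t + - Z.1 t)); last first.
    by apply/funext => t; rewrite E -[(k *: Z).1 t]/(k * Z.1 t) mulrN.
  rewrite (_ : (fun t => k * X.1 t) = (fun t => (k - 1) * X.1 t + X.1 t)); last first.
    by apply/funext => t; rewrite E.
  rewrite (_ : (fun t => k * y1 t) = (fun t => (k - 1) * y1 t + y1 t)); last first.
    by apply/funext => t; rewrite E.
  by rewrite -(E (X.1 (-1))) -(E (y1 (-1))).
- by rewrite -[(k *: X).1 _]/(k * X.1 _) mulrCA (mulrCA _ k) -mulrDr bc mulr0.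
- by rewrite -[LHS]/(k * X.2) e1 -[(k *: X).1 _]/(k * X.1 _); ring.
- by rewrite -[LHS]/(k * Z.2) e2 -[(k *: X).1 _]/(k * X.1 _); ring.
Qed.

Lemma eigen_Z k (X : @realH R) lam : ArelP P X (lam *: X) -> ArelP P (k *: X) (lam *: (k *: X)).
Proof.
move=> AX; rewrite scalerA mulrC -scalerA; apply: ArelP_Z => //.
exact: (in_realHZ N11 lam (Arel_in_realH N11 AX)).
Qed.

Lemma inH_ZD (c : R[i]) F G : inH F -> inH G -> inH (c *: F + G).
Proof.
move=> /L2P[Fr Fi] /L2P[Gr Gi]; apply/L2P; split.
- have := L2ZD (cRe c) Fr (L2ZD (- cIm c) Fi Gr).
  apply: L2_eq => x _; rewrite -[(c *: F + G).1 x]/(c * F.1 x + G.1 x) !cparts; ring.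
- have := L2ZD (cRe c) Fi (L2ZD (cIm c) Fr Gi).
  apply: L2_eq => x _; rewrite -[(c *: F + G).1 x]/(c * F.1 x + G.1 x) !cparts; ring.
Qed.

Lemma TrZD (c : R[i]) F G :
  Tr P (c *: F + G) = cRe c *: Tr P F + cIm c *: Jrot (Tr P F) + Tr P G.
Proof. by rewrite TrD TrZ. Qed.

(* Over the reals a complex vector [F] contributes the two directions [F] and [i F]. *)
Definition realified (Phi : nat -> Hspace (R := R)) k : @pairH R :=
  if odd k then Jrot (Tr P (Phi k./2)) else Tr P (Phi k./2).

(** A complex coefficient acts as its real part along [Phi k] plus its imaginary part along
    [i Phi k], and by [ip_Re] and [ip_Im] these are the two real coefficients; hence [N] complex
    terms make [N.*2] real ones. *)
Lemma sum_realified (Phi : nat -> Hspace (R := R)) F N :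
  inH F -> (forall k, inH (Phi k)) ->
  let S := \sum_(k < N) ip P F (Phi k) *: Phi k in
  inH (F - S) /\ Tr P (F - S) =
    Tr P F - \sum_(k < N.*2) vformP (Tr P F) (realified Phi k) *: realified Phi k.
Proof.
move=> FH PH /=; elim: N => [|N [IH IT]].
  by rewrite !big_ord0 !subr0.
have E : F - \sum_(k < N.+1) ip P F (Phi k) *: Phi k =
    (- ip P F (Phi N)) *: Phi N + (F - \sum_(k < N) ip P F (Phi k) *: Phi k).
  by rewrite big_ord_recr/= opprD addrA addrC scaleNr.
rewrite E; split; first exact: inH_ZD.
rewrite TrZD IT cReN cImN (ip_Re P FH (PH N)) (ip_Im P FH (PH N)).
rewrite doubleS !big_ord_recr/= /realified/= odd_double/= doubleK uphalf_double.
by rewrite !scaleNr [LHS]addrC !opprD !addrA.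
Qed.

Section Eigensequence.
Variable Phi : nat -> Hspace (R := R).
Hypothesis PhiA : forall k, A_eigenfunction P (Phi k).
Hypothesis Phi_on : forall k m, ip P (Phi k) (Phi m) = (k == m)%:R.
Let PhiH k : inH (Phi k). Proof. by have [[[? _] _ _ _ _] _ _] := PhiA k. Qed.
Let in_pairH_T k : in_pairH (Tr P (Phi k)) := in_pairH_Tr P (PhiH k).

Lemma realified_in_pairH k : in_pairH (realified Phi k).
Proof. by rewrite /realified; case: odd; first apply: in_pairH_Jrot; exact: in_pairH_T. Qed.

Lemma realified_on i j : vformP (realified Phi i) (realified Phi j) = (i == j)%:R.
Proof.
have Pre k m : vformP (Tr P (Phi k)) (Tr P (Phi m)) = (k == m)%:R.
  by rewrite -ip_Re// Phi_on; case: (k == m).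
have Pim k m : vformP (Tr P (Phi k)) (Jrot (Tr P (Phi m))) = 0.
  by rewrite -ip_Im// Phi_on; case: (k == m).
rewrite /realified -[in RHS](odd_double_half i) -[in RHS](odd_double_half j).
case: (odd i); case: (odd j); rewrite /= ?vform_JrotJ// ?Pre ?Pim.
- by congr (_%:R); lia.
- by rewrite vform_sym Pim; case: eqP => //; lia.
- by case: eqP => //; lia.
- by congr (_%:R); lia.
Qed.

Hypothesis Phi_max : forall S, S `<=` A_eigenfunction P -> orthonormal_set P S ->
  range Phi `<=` S -> forall G, S G -> exists k, Heq G (Phi k).

(** Being orthogonal to [Phi k] and to [i Phi k] over the reals amounts to complex orthogonality, so
    a non-null [W] could be normalized and adjoined to the family. *)
Lemma realified_max W lam : ArelP P W.1 (lam *: W.1) -> ArelP P W.2 (lam *: W.2) ->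
  (forall k, vformP W (realified Phi k) = 0) -> vformP W W = 0.
Proof.
move=> A1 A2 W0; apply/eqP; apply: contraT => Wn0.
have WV : in_pairH W by split; [exact: (Arel_in_realH N11 A1)|exact: (Arel_in_realH N11 A2)].
have Wgt0 : 0 < vformP W W by rewrite lt0r Wn0 (vform_ge0 (rho_gt0 P)).
have T0 k : vformP W (Tr P (Phi k)) = 0 by have := W0 k.*2; rewrite /realified odd_double doubleK.
have J0 k : vformP W (Jrot (Tr P (Phi k))) = 0.
  by have := W0 k.*2.+1; rewrite /realified/= odd_double/= uphalf_double.
pose c := (Num.sqrt (vformP W W))^-1.
have vZ k W1 W2 : in_pairH W1 -> in_pairH W2 -> vformP (k *: W1) W2 = k * vformP W1 W2.
  move=> [? ?] [? ?]; rewrite /vform !(eform_Z N11 (rho_gt0 P))//; ring.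
have cWV : in_pairH (c *: W) by case: WV => ? ?; split; exact: in_realHZ.
have cW1 : vformP (c *: W) (c *: W) = 1.
  rewrite vZ// vform_sym vZ// mulrA -expr2 exprVn sqr_sqrtr ?mulVf//; exact: ltW.
have [|||U [UH UT UA]] := @eigen_pair_A_eigenfunction _ P (c *: W) lam.
- exact: eigen_Z.
- exact: eigen_Z.
- by rewrite cW1 oner_eq0.
have UU : ip P U U = 1.
  by rewrite ip_vform// UT cW1 vform_Jrot_self.
have UP k : ip P U (Phi k) = 0.
  by rewrite ip_vform// UT !vZ// ?T0 ?J0 ?mulr0//; exact: in_pairH_Jrot.
have PU k : ip P (Phi k) U = 0.
  rewrite ip_vform// UT vform_sym vZ// T0 mulr0 -[X in _ +i* X]opprK -vform_Jrot//.
  by rewrite vform_sym vZ ?J0 ?mulr0 ?oppr0//; exact: in_pairH_Jrot.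
have [||||k Uk] := @Phi_max (range Phi `|` [set U]) _ _ _ U.
- by move=> _ [[k _ <-]//|->].
- move=> _ _ [[k _ <-]|->] [[m _ <-]|->].
  + split; first by rewrite Phi_on eqxx.
    by move=> H; rewrite Phi_on; case: eqP => // km; case: H; rewrite km; split=> //; exact: aeW.
  + by rewrite Phi_on eqxx PU.
  + by rewrite UU UP.
  + by split=> // -[]; split=> //; exact: aeW.
- by left.
- by right.
(* Maximality identifies [U] with some [Phi k], to which it is orthogonal although its norm is 1. *)
have := vform_Heq P UH (PhiH k) cWV Uk.
by rewrite UT cW1 vZ// T0 mulr0 => /eqP; rewrite oner_eq0.
Qed.

End Eigensequence.

(** The eigenvalue is real, so rotating an eigenvector by [i] gives another for the same value. The
    vector of the family is matched with a true eigenvector only through the form, as the two agree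
    almost everywhere. *)
Lemma realified_eigen (phi : nat -> R -> R[i]) k :
  (forall k, inH (augment P (phi k))) -> (exists l, bvp_solution P l (phi k./2)) ->
  exists lam W, [/\ ArelP P W.1 (lam *: W.1), ArelP P W.2 (lam *: W.2)
    & forall W', in_pairH W' -> vformP W' (realified (fun k => augment P (phi k)) k) = vformP W' W].
Proof.
move=> phiH [l /bvp_solution_Arel[lam [X [Y [AX AY Hae X2 Y2]]]]].
set F := augment P (phi k./2).
have FV : in_pairH (Tr P F) := in_pairH_Tr P (phiH _).
have XYV : in_pairH (X, Y) by split; [exact: (Arel_in_realH N11 AX)|exact: (Arel_in_realH N11 AY)].
have key W' : in_pairH W' -> vformP W' (Tr P F) = vformP W' (X, Y).
  move=> [V1 V2]; have [F1 F2] := FV; have [X2' Y2'] := XYV.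
  rewrite /vform; congr (_ + _); apply: eform_ae => //.
    by apply: ae_imp Hae => x /[apply] -[->].
  by apply: ae_imp Hae => x /[apply] -[_ ->].
rewrite /realified; case: odd; last by exists lam, (X, Y).
exists lam, (Jrot (X, Y)); split=> //=.
  by rewrite -scaleN1r; exact: eigen_Z.
move=> W' W'V; apply: oppr_inj; rewrite -!vform_Jrot//; exact/key/in_pairH_Jrot.
Qed.

End Completeness.

Theorem theorem5p3 (R : realType) (P : bvp R) (phi : nat -> R -> R[i])
    (hphi : forall n, bvp_eigenfunction P (phi n))
    (hmax : maximal_orthonormal_eigenfunctions P
              (fun n => augment P (phi n))) :
  forall F : Hspace (R := R), inH F ->
    Hnorm P (F - \sum_(n < N)
                   ip P F (augment P (phi n)) *: augment P (phi n))
      @[N --> \oo] --> (0 : R).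
Proof.
move=> F FH; have [PhiA Phi_on Phi_max] := hmax.
pose Phi k := augment P (phi k).
have PhiH k : inH (Phi k) by have [[[? _] _ _ _ _] _ _] := PhiA k.
have [Q qQ] := pcontinuous_bounded (@potential_pcontinuous _ P).
have mq := pcontinuous_measurable (@potential_pcontinuous _ P).
have := real_expansion (@lt_N11 R) mq qQ (alpha_or P) (rho_gt0 P) (realified_in_pairH PhiA)
  (realified_on PhiA Phi_on) (fun k => realified_eigen PhiH (hphi k./2).1)
  (realified_max PhiA Phi_on Phi_max) (in_pairH_Tr P FH).
move=> cvgV.
(* The complex partial sums are the real ones of even length. *)
have dbl : N.*2 @[N --> \oo] --> \oo.
  by apply/cvgnyPge => A; exists A => // N /= AN; lia.
have := cvg_comp _ _ dbl cvgV.
apply: cvg_trans; apply: near_eq_cvg; near=> N => /=.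
have [SH ST] := sum_realified P N FH PhiH.
by rewrite Hnorm_seminorm// ST.
Unshelve. all: by end_near. Qed.
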